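(* Let $Q$ be the quiver (with the labelling and orientation given in the context) of an extended Dynkin graph of type $\widetilde{A_{n-1}}$ with $n\ge2$, $\widetilde{D_{n-1}}$ with $n\ge5$, or $\widetilde{E_m}$ with $m\in\{6,7,8\}$ (in which case put $n=m+1$), and let $A=\Pi(Q)$ be its preprojective algebra over $k$. Let $g$ be a graded automorphism of $A$ of finite order which fixes the trivial paths and scales the arrows: $g(\alpha_i)=c_i\alpha_i$ and $g(\alpha_i^* )=t_i\alpha_i^*$ with nonzero scalars $c_i,t_i\in k$ for every arrow $\alpha_i$ of $Q$. Then $\operatorname{Hdet}(g)=c_1t_1\,I_n$.
   Context: Throughout $k$ is an algebraically closed field of characteristic $0$. Modules are right modules unless stated otherwise. Preprojective algebra. For a quiver $Q$, the double $\bar Q$ has the same vertices and, for each arrow $\alpha:i\to j$ of $Q$, both $\alpha$ and a new arrow $\alpha^*:j\to i$. Paths are composed left to right ($\alpha\beta\neq0$ in the path algebra iff the target of $\alpha$ is the source of $\beta$). $\Pi(Q)=k\bar Q/\big(\sum_{\alpha\in Q_1}(\alpha\alpha^*-\alpha^*\alpha)\big)$, graded by path length; $e_i$ denotes the trivial path at vertex $i$. The relations force $c_it_i=c_1t_1$ for all arrows $\alpha_i$. Quivers. $\widetilde{A_{n-1}}$: vertices $1,\dots,n$, arrows $\alpha_i:i\to i+1$ for $1\le i\le n-1$, and $\alpha_n:n\to1$. $\widetilde{D_{n-1}}$: vertices $1,\dots,n$, arrows $\alpha_1:1\to3$, $\alpha_2:2\to3$, $\alpha_i:i\to i+1$ for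 $3\le i\le n-3$, $\alpha_{n-1}:n-2\to n-1$, $\alpha_n:n-2\to n$. $\widetilde{E_6}$: vertices $1,\dots,7$, arrows $\alpha_i:i\to i+1$ for $1\le i\le4$, $\alpha_6:3\to6$, $\alpha_7:6\to7$. $\widetilde{E_7}$: vertices $1,\dots,8$, arrows $\alpha_i:i\to i+1$ for $1\le i\le6$, $\alpha_8:4\to8$. $\widetilde{E_8}$: vertices $1,\dots,9$, arrows $\alpha_i:i\to i+1$ for $1\le i\le7$, $\alpha_9:6\to9$. Homological determinant. For a graded module $M$, $M[\ell]_j=M_{\ell+j}$; $\underline{\operatorname{Hom}}_A(M,N)=\bigoplus_\ell\operatorname{Hom}_A^\ell(M,N)$ (homomorphisms homogeneous of degree $\ell$), with derived functors $\underline{\operatorname{Ext}}^i_A$. Put $\mathfrak m=A_{\ge1}$ and $H^i_{\mathfrak m}(M)=\varinjlim_r\underline{\operatorname{Ext}}^i_A(A/A_{\ge r},M)$. Let $e_bA^\vee=\bigoplus_m\operatorname{Hom}_k(A_{-m}e_b,k)$ be the graded dual of $Ae_b$, a right $A$-module via $(\varphi\cdot a)(x)=\varphi(ax)$, and $A^\vee=\bigoplus_b e_bA^\vee$. It is known that $A$ is noetherian of global dimension $2$, generalized Gorenstein in the sense that $\underline{\operatorname{Ext}}^i_A(S_j,A)\cong S_j^\vee[2]$ for $i=2$ and $0$ otherwise (where $S_j=e_jA/(e_jA)_{\ge1}$, $S_j^\vee=Ae_j/(Ae_j)_{\ge1}$), and that $H^2_{\mathfrak m}(A)\cong A^\vee[2]$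 as right $A$-modules, with $H^2_{\mathfrak m}(e_bA)$ corresponding to $e_bA^\vee[2]$. View $g$ as an $A$-linear map $A\to A^g$, where $A^g$ is $A$ with action $m*r=m\,g(r)$; applying $H^2_{\mathfrak m}$ and using $H^2_{\mathfrak m}(A^g)=H^2_{\mathfrak m}(A)^g$ gives a $g$-linear map $H^2_{\mathfrak m}(g):A^\vee\to A^\vee$ ($\Phi(ma)=\Phi(m)g(a)$). There are nonzero scalars $\lambda_1,\dots,\lambda_n$ with $H^2_{\mathfrak m}(g)(\varphi)=\lambda_s(\varphi\circ g^{-1})$ for all $\varphi\in e_sA^\vee$. $\operatorname{Hdet}(g)$ is the diagonal matrix with $\operatorname{Hdet}(g)_{ii}=\lambda_i^{-1}$. *)

(* Defs.v *)
From HB Require Import structures.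
From mathcomp Require Import all_boot all_order all_algebra.
From mathcomp Require Import finmap generic_quotient boolp monalg.

Set Implicit Arguments.
Unset Strict Implicit.
Unset Printing Implicit Defensive.

Import GRing.Theory.
Local Open Scope ring_scope.

(* The vertex set is nonempty so that kQ <> 0, as nzRingType requires. *)
Record quiver := Quiver {
  nv : nat;
  arr : finType;
  src : arr -> 'I_nv.+1;
  tgt : arr -> 'I_nv.+1
}.

Definition vert (Q : quiver) := 'I_(nv Q).+1.

(* The double of Q: inl a is the arrow a, inr a is a^*. *)
Definition double (Q : quiver) : quiver :=
  @Quiver (nv Q) (arr Q + arr Q)%type
    (fun b => match b with inl a => src a | inr a => tgt a end)
    (fun b => match b with inl a => tgt a | inr a => src a end).

Section Paths.
Variable Q : quiver.

Fixpoint walk (v : vert Q) (w : seq (arr Q)) : bool :=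
  if w is a :: w' then (src a == v) && walk (tgt a) w' else true.

Fixpoint wend (v : vert Q) (w : seq (arr Q)) : vert Q :=
  if w is a :: w' then wend (tgt a) w' else v.

Lemma walk_cat v w w' : walk v (w ++ w') = walk v w && walk (wend v w) w'.
Proof. by elim: w v => //= a w IH v; rewrite IH andbA. Qed.

Lemma wend_cat v w w' : wend v (w ++ w') = wend (wend v w) w'.
Proof. by elim: w v => //= a w IH v. Qed.

(* Starting vertex and composable word of arrows; paths are composed from
   left to right. *)
Definition qpath := {x : vert Q * seq (arr Q) | walk x.1 x.2}.

Definition pstart (p : qpath) : vert Q := (val p).1.
Definition pword (p : qpath) : seq (arr Q) := (val p).2.
Definition pend (p : qpath) : vert Q := wend (pstart p) (pword p).
Definition plen (p : qpath) : nat := size (pword p).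

Definition ptriv (v : vert Q) : qpath :=
  exist _ (v, [::]) isT.

Lemma parr_subproof (a : arr Q) : walk (src a, [:: a]).1 (src a, [:: a]).2.
Proof. by rewrite /= eqxx. Qed.

Definition parr (a : arr Q) : qpath := exist _ (src a, [:: a]) (parr_subproof a).

(* Concatenation; meaningful only when pend p = pstart q. *)
Definition pcat (p q : qpath) : qpath :=
  insubd p (pstart p, pword p ++ pword q).

Lemma val_pcat p q : pend p = pstart q ->
  val (pcat p q) = (pstart p, pword p ++ pword q).
Proof.
move=> e; apply: insubdK; rewrite unfold_in /= walk_cat.
rewrite -/(pend p) e; apply/andP; split; [exact: (valP p) | exact: (valP q)].
Qed.

Lemma pstart_pcat p q : pend p = pstart q -> pstart (pcat p q) = pstart p.
Proof. by move=> e; rewrite /pstart val_pcat. Qed.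

Lemma pword_pcat p q :
  pend p = pstart q -> pword (pcat p q) = pword p ++ pword q.
Proof. by move=> e; rewrite /pword val_pcat. Qed.

Lemma pend_pcat p q : pend p = pstart q -> pend (pcat p q) = pend q.
Proof.
by move=> e; rewrite /pend pstart_pcat // pword_pcat // wend_cat -/(pend p) e.
Qed.

Lemma qpath_inj p q : pstart p = pstart q -> pword p = pword q -> p = q.
Proof.
move=> es ew; apply: val_inj; rewrite [LHS]surjective_pairing.
by rewrite [RHS]surjective_pairing; congr pair.
Qed.

Lemma pcatA p q r : pend p = pstart q -> pend q = pstart r ->
  pcat p (pcat q r) = pcat (pcat p q) r.
Proof.
move=> e1 e2; apply: qpath_inj.
  by rewrite !pstart_pcat // ?pend_pcat // pstart_pcat.
by rewrite !pword_pcat ?pend_pcat ?pstart_pcat ?pword_pcat // catA.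
Qed.

Lemma pend_triv v : pend (ptriv v) = v. Proof. by []. Qed.
Lemma pstart_triv v : pstart (ptriv v) = v. Proof. by []. Qed.

Lemma pcat1p p : pcat (ptriv (pstart p)) p = p.
Proof. by apply: qpath_inj; rewrite ?pstart_pcat ?pword_pcat. Qed.

Lemma pcatp1 p : pcat p (ptriv (pend p)) = p.
Proof. by apply: qpath_inj; rewrite ?pstart_pcat ?pword_pcat //= cats0. Qed.

End Paths.

Definition pathalg (k : fieldType) (Q : quiver) : Type := {malg k[qpath Q]}.

Section LinearExtension.
Variables (k : fieldType) (K : choiceType) (W : lmodType k) (phi : K -> W).

Definition lext (f : {malg k[K]}) : W := \sum_(p <- msupp f) f@_p *: phi p.

Lemma lextEw (d : {fset K}) (f : {malg k[K]}) : (msupp f `<=` d)%fset ->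
  lext f = \sum_(p <- d) f@_p *: phi p.
Proof.
move=> le; rewrite /lext (big_fset_incl _ le) // => p _ /mcoeff_outdom ->.
by rewrite scale0r.
Qed.

Lemma lext_is_linear : linear lext.
Proof.
move=> c f g; pose d := (msupp f `|` msupp g `|` msupp (c *: f + g))%fset.
have sub1 : (msupp f `<=` d)%fset by rewrite /d -fsetUA fsubsetUl.
have sub2 : (msupp g `<=` d)%fset by rewrite /d [(msupp f `|` _)%fset]fsetUC -fsetUA fsubsetUl.
have sub3 : (msupp (c *: f + g) `<=` d)%fset by rewrite /d fsubsetUr.
rewrite (lextEw sub1) (lextEw sub2) (lextEw sub3) scaler_sumr -big_split /=.
by apply: eq_bigr => p _; rewrite mcoeffD mcoeffZ scalerDl scalerA.
Qed.

HB.instance Definition _ :=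
  GRing.isLinear.Build k {malg k[K]} W *:%R lext lext_is_linear.

Lemma lextU p : lext << p >> = phi p.
Proof.
rewrite (lextEw (msuppU_le (k := p) (x := 1))) big_seq_fset1 mcoeffUU.
by rewrite scale1r.
Qed.

Lemma malgEl (f : {malg k[K]}) : f = \sum_(p <- msupp f) f@_p *: << p >>.
Proof.
rewrite {1}[f]monalgE; apply: eq_bigr => p _; apply/malgP => q.
by rewrite mcoeffZ !mcoeffU mulr_natr.
Qed.

End LinearExtension.

Lemma lext_uniq (k : fieldType) (K : choiceType) (W : lmodType k)
    (u v : {linear {malg k[K]} -> W}) :
  (forall p, u << p >> = v << p >>) -> u =1 v.
Proof.
move=> e f; rewrite [f]malgEl !linear_sum; apply: eq_bigr => p _.
by rewrite !linearZ e.
Qed.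

Lemma bilinear_assoc (k : fieldType) (V : lmodType k) (mul : V -> V -> V) :
  left_distributive mul +%R -> right_distributive mul +%R ->
  (forall c f g, mul (c *: f) g = c *: mul f g) ->
  (forall c f g, mul f (c *: g) = c *: mul f g) ->
  forall (I : Type) (b : I -> V),
  (forall P : V -> Prop, P 0 ->
     (forall c f g, P f -> P g -> P (c *: f + g)) -> (forall p, P (b p)) ->
     forall f, P f) ->
  (forall p q r, mul (b p) (mul (b q) (b r)) = mul (mul (b p) (b q)) (b r)) ->
  associative mul.
Proof.
move=> Dl Dr Zl Zr I b ind Hb.
have m0 f : mul f 0 = 0 by rewrite -[X in mul f X](scale0r (0 : V)) Zr scale0r.
have m0' f : mul 0 f = 0 by rewrite -[X in mul X f](scale0r (0 : V)) Zl scale0r.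
move=> f g h; elim/ind: f => [|c f f' IH IH'|p]; first by rewrite !m0'.
  by rewrite !(Dl, Zl) IH IH'.
elim/ind: g => [|c g g' IH IH'|q]; first by rewrite !(m0, m0').
  by rewrite !(Dl, Zl, Dr, Zr) IH IH'.
elim/ind: h => [|c h h' IH IH'|r]; first by rewrite !m0.
  by rewrite !(Dr, Zr) IH IH'.
exact: Hb.
Qed.

HB.lock Definition pelt (k : fieldType) (Q : quiver) (p : qpath Q) :
  pathalg k Q := << p >>.

Definition pbmul (k : fieldType) (Q : quiver) (p q : qpath Q) : pathalg k Q :=
  if pend p == pstart q then pelt k (pcat p q) else 0.

HB.lock Definition pamul (k : fieldType) (Q : quiver) (f g : pathalg k Q) :
  pathalg k Q := lext (fun p => lext (fun q => pbmul k p q) g) f.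

Section PathAlgebra.
Variables (k : fieldType) (Q : quiver).
Local Notation kQ := (pathalg k Q).
Local Notation pelt := (@pelt k Q).
Local Notation pbmul := (@pbmul k Q).
Local Notation pamul := (@pamul k Q).

HB.instance Definition _ := GRing.Lmodule.on kQ.

Lemma peltE p : pelt p = << p >>. Proof. by rewrite pelt.unlock. Qed.

Lemma pelt_coef p q : (pelt p)@_q = (p == q)%:R.
Proof. by rewrite peltE mcoeffU. Qed.

Lemma lextE (W : lmodType k) (phi : qpath Q -> W) p : lext phi (pelt p) = phi p.
Proof. by rewrite peltE lextU. Qed.

Definition paone : kQ := \sum_(v : vert Q) pelt (ptriv v).

Lemma pamulUU p q : pamul (pelt p) (pelt q) = pbmul p q.
Proof. by rewrite pamul.unlock !lextE. Qed.

Lemma pamul_linl g : linear (pamul^~ g).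
Proof. by move=> c f f'; rewrite pamul.unlock linearP. Qed.

Lemma pamul_linr f : linear (pamul f).
Proof.
move=> c g g'; rewrite pamul.unlock /lext scaler_sumr -big_split /=.
apply: eq_bigr => p _.
by rewrite -!/(lext _ _) linearP scalerDr !scalerA mulrC.
Qed.

Definition pamulr g := pamul^~ g.
HB.instance Definition _ g :=
  GRing.isLinear.Build k kQ kQ *:%R (pamulr g) (pamul_linl g).
HB.instance Definition _ f :=
  GRing.isLinear.Build k kQ kQ *:%R (pamul f) (pamul_linr f).

Lemma pamulDl : left_distributive pamul +%R.
Proof. by move=> f f' g; exact: (raddfD (pamulr g)). Qed.

Lemma pamulDr : right_distributive pamul +%R.
Proof. by move=> f g g'; exact: (raddfD (pamul f)). Qed.

Lemma pamul0l f : pamul 0 f = 0. Proof. exact: (raddf0 (pamulr f)). Qed.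
Lemma pamul0r f : pamul f 0 = 0. Proof. exact: (raddf0 (pamul f)). Qed.

Lemma pamulZl c f g : pamul (c *: f) g = c *: pamul f g.
Proof. exact: (linearZ_LR (pamulr g)). Qed.

Lemma pamulZr c f g : pamul f (c *: g) = c *: pamul f g.
Proof. exact: (linearZ_LR (pamul f)). Qed.

Lemma pa_ind (P : kQ -> Prop) : P 0 ->
  (forall c f g, P f -> P g -> P (c *: f + g)) -> (forall p, P (pelt p)) ->
  forall f, P f.
Proof.
move=> P0 Plin PU f; have -> : f = \sum_(p <- msupp f) f@_p *: pelt p.
  by rewrite {1}[f]malgEl; apply: eq_bigr => p _; rewrite peltE.
elim: (enum_fset _) => [|p s IH]; first by rewrite big_nil.
by rewrite big_cons; apply: Plin.
Qed.

Lemma pbmulA p q r : pamul (pelt p) (pbmul q r) = pamul (pbmul p q) (pelt r).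
Proof.
rewrite /pbmul; case: (eqVneq (pend q) (pstart r)) => [e2|n2]; last first.
  rewrite pamul0r; case: eqVneq => [e1|_]; last by rewrite pamul0l.
  by rewrite pamulUU /pbmul pend_pcat // (negPf n2).
rewrite pamulUU /pbmul pstart_pcat //.
case: (eqVneq (pend p) (pstart q)) => [e1|_]; last by rewrite pamul0l.
by rewrite pamulUU /pbmul pend_pcat // e2 eqxx pcatA.
Qed.

Lemma pamulA : associative pamul.
Proof.
apply: (@bilinear_assoc k kQ pamul pamulDl pamulDr pamulZl pamulZr _
  pelt pa_ind) => p q r.
by rewrite !pamulUU pbmulA.
Qed.

Lemma pamul1l : left_id paone pamul.
Proof.
elim/pa_ind => [|c f g IH IH'|p]; first by rewrite pamul0r.
  by rewrite pamulDr pamulZr IH IH'.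
rewrite -/(pamulr _ _) linear_sum (bigD1 (pstart p)) //= /pamulr.
rewrite pamulUU /pbmul pend_triv eqxx pcat1p big1 ?addr0 // => v nv.
by rewrite pamulUU /pbmul pend_triv (negPf nv).
Qed.

Lemma pamul1r : right_id paone pamul.
Proof.
elim/pa_ind => [|c f g IH IH'|p]; first by rewrite pamul0l.
  by rewrite pamulDl pamulZl IH IH'.
rewrite linear_sum (bigD1 (pend p)) //=.
rewrite pamulUU /pbmul pstart_triv eqxx pcatp1 big1 ?addr0 // => v nv.
by rewrite pamulUU /pbmul pstart_triv eq_sym (negPf nv).
Qed.

Lemma paone_coef v : paone@_(ptriv v) = 1.
Proof.
rewrite /paone raddf_sum (bigD1 v) //= pelt_coef eqxx big1 ?addr0 // => w nw.
rewrite pelt_coef; case: eqP => // /(congr1 (@pstart Q)) /= e.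
by move: nw; rewrite -(pstart_triv w) e eqxx.
Qed.

Lemma paone_neq0 : paone != 0.
Proof.
apply/eqP => /(congr1 (mcoeff (ptriv (ord0 : vert Q)))).
by rewrite paone_coef mcoeff0; apply/eqP/oner_neq0.
Qed.

HB.instance Definition _ := GRing.Zmodule_isNzRing.Build kQ
  pamulA pamul1l pamul1r pamulDl pamulDr paone_neq0.

Lemma pascalerAl (c : k) (f g : kQ) : c *: (f * g) = (c *: f) * g.
Proof. exact: esym (pamulZl c f g). Qed.
HB.instance Definition _ := GRing.Lmodule_isLalgebra.Build k kQ pascalerAl.

Lemma pascalerAr (c : k) (f g : kQ) : c *: (f * g) = f * (c *: g).
Proof. exact: esym (pamulZr c f g). Qed.
HB.instance Definition _ := GRing.Lalgebra_isAlgebra.Build k kQ pascalerAr.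

End PathAlgebra.

Section Preprojective.
Variables (k : fieldType) (Q : quiver).
Local Notation kQ := (pathalg k (double Q)).
Local Open Scope quotient_scope.

Definition darr (b : arr (double Q)) : kQ := pelt k (parr b).

Definition preproj_rel : kQ :=
  \sum_(a : arr Q) (darr (inl a) * darr (inr a) - darr (inr a) * darr (inl a)).

Definition preproj_ideal (x : kQ) : Prop :=
  exists s : seq (kQ * kQ), x = \sum_(u <- s) u.1 * preproj_rel * u.2.

Lemma pideal0 : preproj_ideal 0.
Proof. by exists [::]; rewrite big_nil. Qed.

Lemma pidealD x y : preproj_ideal x -> preproj_ideal y -> preproj_ideal (x + y).
Proof. by move=> [s ->] [t ->]; exists (s ++ t); rewrite big_cat. Qed.

Lemma pidealMl a x : preproj_ideal x -> preproj_ideal (a * x).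
Proof.
move=> [s ->]; exists [seq (a * u.1, u.2) | u <- s].
by rewrite big_map mulr_sumr; apply: eq_bigr => u _ /=; rewrite !mulrA.
Qed.

Lemma pidealMr a x : preproj_ideal x -> preproj_ideal (x * a).
Proof.
move=> [s ->]; exists [seq (u.1, u.2 * a) | u <- s].
by rewrite big_map mulr_suml; apply: eq_bigr => u _ /=; rewrite -!mulrA.
Qed.

Lemma pidealZ c x : preproj_ideal x -> preproj_ideal (c *: x).
Proof. by move=> Hx; rewrite -[x]mul1r scalerAl; apply: pidealMl. Qed.

Lemma pidealN x : preproj_ideal x -> preproj_ideal (- x).
Proof. by move=> Hx; rewrite -scaleN1r; apply: pidealZ. Qed.

(* The coefficient at a trivial path is multiplicative and kills the arrows,
   whence 1 is not in the ideal. *)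
Lemma coef_trivM (v : vert (double Q)) (f g : kQ) :
  (f * g)@_(ptriv v) = f@_(ptriv v) * g@_(ptriv v).
Proof.
elim/(@pa_ind k (double Q)): f => [|c f f' IH IH'|p].
- by rewrite mul0r mcoeff0 mul0r.
- rewrite mulrDl -scalerAl 1!mcoeffD mcoeffZ IH IH' mcoeffD mcoeffZ.
  by rewrite mulrDl mulrA.
elim/(@pa_ind k (double Q)): g => [|c g g' IH IH'|q].
- by rewrite mulr0 mcoeff0 mulr0.
- rewrite mulrDr -scalerAr 1!mcoeffD mcoeffZ IH IH' [in RHS]mcoeffD mcoeffZ.
  by rewrite mulrDr mulrCA.
rewrite [pelt k p * pelt k q]pamulUU /pbmul !pelt_coef -natrM mulnb.
case: (eqVneq (pend p) (pstart q)) => [e|ne]; last first.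
  rewrite mcoeff0; case: eqP => //= ep; case: eqP => //= eq.
  by rewrite ep eq eqxx in ne.
rewrite pelt_coef; congr (nat_of_bool _)%:R; apply/eqP/andP.
  move=> H; have := pword_pcat e; rewrite H => /esym/eqP.
  have := pstart_pcat e; rewrite H pstart_triv => sp.
  have tnil (r : qpath (double Q)) : pword r = [::] -> r = ptriv (pstart r).
    by move=> rn; apply: qpath_inj.
  case Ep: (pword p) => [|//]; case Eq: (pword q) => [|//] _.
  have pE := tnil _ Ep; have qE := tnil _ Eq.
  have pe : pend p = v by rewrite pE pend_triv.
  by rewrite pE qE -e pe sp !eqxx.
by move=> [/eqP -> /eqP ->]; rewrite -[X in pcat _ X]/(ptriv (pend (ptriv v))) pcatp1.
Qed.

Lemma pideal_coef v x : preproj_ideal x -> x@_(ptriv v) = 0.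
Proof.
have d0 b : (darr b)@_(ptriv v) = 0.
  by rewrite /darr pelt_coef; case: eqP.
move=> [s ->]; rewrite raddf_sum big1 // => u _.
rewrite /= !coef_trivM /preproj_rel raddf_sum /= big1 ?mulr0 ?mul0r // => a _.
by rewrite mcoeffB !coef_trivM !d0 mulr0 subrr.
Qed.

Definition preproj_equiv (x y : kQ) : bool := `[< preproj_ideal (x - y) >].

Lemma preproj_equiv_class : equiv_class_of preproj_equiv.
Proof.
split=> [x|x y|y x z].
- by apply/asboolP; rewrite subrr; apply: pideal0.
- by apply/asboolP/asboolP => /pidealN; rewrite opprB.
- move=> /asboolP H1 /asboolP H2; apply/asboolP.
  by rewrite -(subrKA y); apply: pidealD.
Qed.

Canonical preproj_equivRel := EquivRelPack preproj_equiv_class.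

Definition preproj : Type := {eq_quot preproj_equivRel}.

HB.instance Definition _ : Choice preproj := Choice.on preproj.
HB.instance Definition _ : EqQuotient kQ preproj_equivRel preproj :=
  EqQuotient.on preproj.

Local Notation A := preproj.

Definition ppi (x : kQ) : A := \pi_A x.

Lemma ppiP x y : ppi x = ppi y <-> preproj_ideal (x - y).
Proof. by split=> [/eqmodP/asboolP //|H]; apply/eqmodP/asboolP. Qed.

Lemma ppi_surj (x : A) : exists y, x = ppi y.
Proof. by exists (repr x); rewrite /ppi reprK. Qed.

Lemma ppi_repr x : exists2 z, preproj_ideal z & repr (ppi x) = x + z.
Proof.
exists (repr (ppi x) - x); last by rewrite addrC subrK.
by apply/ppiP; rewrite /ppi reprK.
Qed.

Definition pp_add (x y : A) : A := ppi (repr x + repr y).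
Definition pp_opp (x : A) : A := ppi (- repr x).
Definition pp_mul (x y : A) : A := ppi (repr x * repr y).
Definition pp_scale (c : k) (x : A) : A := ppi (c *: repr x).

Lemma ppiD x y : pp_add (ppi x) (ppi y) = ppi (x + y).
Proof.
rewrite /pp_add; have [u Hu ->] := ppi_repr x; have [v Hv ->] := ppi_repr y.
by apply/ppiP; rewrite (addrACA x u y v) [x + y + _]addrC addrK; apply: pidealD.
Qed.

Lemma ppiN x : pp_opp (ppi x) = ppi (- x).
Proof.
rewrite /pp_opp; have [u Hu ->] := ppi_repr x.
by apply/ppiP; rewrite opprD [- x - u]addrC addrK; apply: pidealN.
Qed.

Lemma ppiM x y : pp_mul (ppi x) (ppi y) = ppi (x * y).
Proof.
rewrite /pp_mul; have [u Hu ->] := ppi_repr x; have [v Hv ->] := ppi_repr y.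
apply/ppiP; rewrite mulrDr [(x + u) * y]mulrDl [x * y + _]addrC addrAC addrK.
by apply: pidealD; [apply: pidealMr | apply: pidealMl].
Qed.

Lemma ppiZ c x : pp_scale c (ppi x) = ppi (c *: x).
Proof.
rewrite /pp_scale; have [u Hu ->] := ppi_repr x.
by apply/ppiP; rewrite scalerDr [c *: x + _]addrC addrK; apply: pidealZ.
Qed.

Lemma pp_addA : associative pp_add.
Proof.
move=> x y z; have [x' ->] := ppi_surj x; have [y' ->] := ppi_surj y.
by have [z' ->] := ppi_surj z; rewrite !ppiD addrA.
Qed.

Lemma pp_addC : commutative pp_add.
Proof. by move=> x y; rewrite /pp_add addrC. Qed.

Lemma pp_add0 : left_id (ppi 0) pp_add.
Proof. by move=> x; have [x' ->] := ppi_surj x; rewrite ppiD add0r. Qed.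

Lemma pp_addN : left_inverse (ppi 0) pp_opp pp_add.
Proof. by move=> x; have [x' ->] := ppi_surj x; rewrite ppiN ppiD addNr. Qed.

HB.instance Definition _ :=
  GRing.isZmodule.Build A pp_addA pp_addC pp_add0 pp_addN.

Lemma pp_mulA : associative pp_mul.
Proof.
move=> x y z; have [x' ->] := ppi_surj x; have [y' ->] := ppi_surj y.
by have [z' ->] := ppi_surj z; rewrite !ppiM mulrA.
Qed.

Lemma pp_mul1 : left_id (ppi 1) pp_mul.
Proof. by move=> x; have [x' ->] := ppi_surj x; rewrite ppiM mul1r. Qed.

Lemma pp_mulr1 : right_id (ppi 1) pp_mul.
Proof. by move=> x; have [x' ->] := ppi_surj x; rewrite ppiM mulr1. Qed.

Lemma pp_mulDl : left_distributive pp_mul +%R.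
Proof.
move=> x y z; have [x' ->] := ppi_surj x; have [y' ->] := ppi_surj y.
have [z' ->] := ppi_surj z.
rewrite -[LHS]/(pp_mul (pp_add _ _) _) -[RHS]/(pp_add _ _).
by rewrite ppiD !ppiM ppiD mulrDl.
Qed.

Lemma pp_mulDr : right_distributive pp_mul +%R.
Proof.
move=> x y z; have [x' ->] := ppi_surj x; have [y' ->] := ppi_surj y.
have [z' ->] := ppi_surj z.
rewrite -[LHS]/(pp_mul _ (pp_add _ _)) -[RHS]/(pp_add _ _).
by rewrite ppiD !ppiM ppiD mulrDr.
Qed.

Lemma pp_neq0 : ppi 1 != 0.
Proof.
apply/eqP => /ppiP; rewrite subr0 => /(pideal_coef (ord0 : vert (double Q))).
by rewrite [X in X = _ -> _]paone_coef => /eqP; rewrite oner_eq0.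
Qed.

HB.instance Definition _ := GRing.Zmodule_isNzRing.Build A
  pp_mulA pp_mul1 pp_mulr1 pp_mulDl pp_mulDr pp_neq0.

Lemma pp_scaleA c d x : pp_scale c (pp_scale d x) = pp_scale (c * d) x.
Proof. by have [x' ->] := ppi_surj x; rewrite !ppiZ scalerA. Qed.

Lemma pp_scale1 : left_id 1 pp_scale.
Proof. by move=> x; have [x' ->] := ppi_surj x; rewrite ppiZ scale1r. Qed.

Lemma pp_scaleDr : right_distributive pp_scale +%R.
Proof.
move=> c x y; have [x' ->] := ppi_surj x; have [y' ->] := ppi_surj y.
rewrite -[LHS]/(pp_scale _ (pp_add _ _)) -[RHS]/(pp_add _ _).
by rewrite ppiD !ppiZ ppiD scalerDr.
Qed.

Lemma pp_scaleDl x : {morph pp_scale^~ x : c d / c + d}.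
Proof.
move=> c d /=; have [x' ->] := ppi_surj x; rewrite -[RHS]/(pp_add _ _).
by rewrite !ppiZ ppiD scalerDl.
Qed.

HB.instance Definition _ := GRing.Zmodule_isLmodule.Build k A
  pp_scaleA pp_scale1 pp_scaleDr pp_scaleDl.

Lemma pp_scalerAl (c : k) (x y : A) : c *: (x * y) = (c *: x) * y.
Proof.
have [x' ->] := ppi_surj x; have [y' ->] := ppi_surj y.
rewrite -[LHS]/(pp_scale _ (pp_mul _ _)) -[RHS]/(pp_mul (pp_scale _ _) _).
by rewrite ppiM !ppiZ ppiM scalerAl.
Qed.
HB.instance Definition _ := GRing.Lmodule_isLalgebra.Build k A pp_scalerAl.

Lemma pp_scalerAr (c : k) (x y : A) : c *: (x * y) = x * (c *: y).
Proof.
have [x' ->] := ppi_surj x; have [y' ->] := ppi_surj y.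
rewrite -[LHS]/(pp_scale _ (pp_mul _ _)) -[RHS]/(pp_mul _ (pp_scale _ _)).
by rewrite ppiM !ppiZ ppiM scalerAr.
Qed.
HB.instance Definition _ := GRing.Lalgebra_isAlgebra.Build k A pp_scalerAr.

Lemma ppi_is_linear : linear ppi.
Proof. by move=> c x y; rewrite -ppiD -ppiZ. Qed.
HB.instance Definition _ := GRing.isLinear.Build k kQ A *:%R ppi ppi_is_linear.

Lemma ppi_is_monoid_morphism : monoid_morphism ppi.
Proof. by split=> // x y; rewrite -ppiM. Qed.
HB.instance Definition _ :=
  GRing.isMonoidMorphism.Build kQ A ppi ppi_is_monoid_morphism.

End Preprojective.

Section Grading.
Variables (k : fieldType) (Q : quiver).
Local Notation A := (preproj k Q).

Definition pidem (v : vert Q) : A := ppi (pelt k (ptriv (v : vert (double Q)))).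
Definition parrow (a : arr Q) : A := ppi (darr k (inl a)).
Definition parrowV (a : arr Q) : A := ppi (darr k (inr a)).

Definition pgr (d : nat) (x : A) : Prop :=
  exists2 y : pathalg k (double Q),
    (forall p, y@_p != 0 -> plen p = d) & x = ppi y.

Definition pge (r : nat) (x : A) : Prop :=
  exists2 y : pathalg k (double Q),
    (forall p, y@_p != 0 -> (r <= plen p)%N) & x = ppi y.

Definition pgrz (j : int) (x : A) : Prop :=
  match j with Posz d => pgr d x | Negz _ => x = 0 end.

Record gr_aut := GrAut {
  gaut :> {lrmorphism A -> A};
  gautV : A -> A;
  gautK : cancel gaut gautV;
  gautVK : cancel gautV gaut;
  gaut_gr : forall d x, pgr d x -> pgr d (gaut x)
}.

End Grading.

(* H^2_m(N) for a graded right A-module N.                                  *)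
(*                                                                          *)
(* Right A-modules are left modules over the opposite algebra A^c.          *)
(*                                                                          *)
(* Ext_A(M, -) is computed with the bar resolution of M, the graded free    *)
(* right modules M (x)_k A^{(x) n} (x)_k A.  As                             *)
(*   Hom_A(M (x) A^{(x) n} (x) A, N) = Hom_k(M (x) A^{(x) n}, N),           *)
(* an n-cochain is a k-multilinear map M x A^n -> N, and the underlined     *)
(* Hom consists of the finite sums of homogeneous ones.  For M = A/A_{>= r} *)
(* a map on M is written as a map on A which vanishes on A_{>= r}.  With    *)
(* this convention the transition map induced by A/A_{>= s} -> A/A_{>= r}   *)
(* is the inclusion of the r-cochains into the s-cochains, so that an       *)
(* element of the direct limit over r is the class of an r-cocycle for some *)
(* r, two of these being identified when they differ by an s-coboundary for *)
(* some s.                                                                  *)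

Section LocalCohomology.
Variables (k : fieldType) (Q : quiver).
Local Notation A := (preproj k Q).

Definition ract (N : lmodType A^c) (m : N) (a : A) : N := (a : A^c) *: m.

Section Bar.
Variables (N : lmodType A^c) (gN : int -> N -> Prop).
Local Notation "m ** a" := (ract m a) (at level 40, left associativity).

Definition klin (h : A -> N) : Prop :=
  forall (c : k) x y, h (c *: x + y) = h x ** c%:A + h y.

Definition hom_cochain1 (r : nat) (l : int) (h : A -> A -> N) : Prop :=
  [/\ forall a, klin (h^~ a), forall x, klin (h x),
      forall x a, pge r x -> h x a = 0
    & forall i j x a, pgr i x -> pgr j a -> gN (i%:Z + j%:Z + l) (h x a)].

Definition cochain1 (r : nat) (h : A -> A -> N) : Prop :=
  exists (s : seq int) (F : int -> A -> A -> N),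
    (forall l, hom_cochain1 r l (F l)) /\
    (forall x a, h x a = \sum_(l <- s) F l x a).

Definition hom_cochain2 (r : nat) (l : int) (f : A -> A -> A -> N) : Prop :=
  [/\ forall a b, klin (fun x => f x a b),
      forall x b, klin (fun a => f x a b),
      forall x a, klin (f x a),
      forall x a b, pge r x -> f x a b = 0
    & forall i j m x a b, pgr i x -> pgr j a -> pgr m b ->
        gN (i%:Z + j%:Z + m%:Z + l) (f x a b)].

Definition cochain2 (r : nat) (f : A -> A -> A -> N) : Prop :=
  exists (s : seq int) (F : int -> A -> A -> A -> N),
    (forall l, hom_cochain2 r l (F l)) /\
    (forall x a b, f x a b = \sum_(l <- s) F l x a b).

Definition bar_d1 (h : A -> A -> N) (x a b : A) : N :=
  h (x * a) b - h x (a * b) + h x a ** b.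

Definition bar_d2 (f : A -> A -> A -> N) (x a b c : A) : N :=
  f (x * a) b c - f x (a * b) c + f x a (b * c) - f x a b ** c.

(* Representatives of the elements of Ext^2_A(A/A_{>= r}, N), those of      *)
(* degree l, and those of zero.                                             *)
Definition cocycle2 (r : nat) (f : A -> A -> A -> N) : Prop :=
  cochain2 r f /\ forall x a b c, bar_d2 f x a b c = 0.

Definition hom_cocycle2 (r : nat) (l : int) (f : A -> A -> A -> N) : Prop :=
  hom_cochain2 r l f /\ forall x a b c, bar_d2 f x a b c = 0.

Definition coboundary2 (r : nat) (f : A -> A -> A -> N) : Prop :=
  exists2 h, cochain1 r h & forall x a b, f x a b = bar_d1 h x a b.

(* Representatives of the elements of H^2_m(N), those of degree l, and      *)
(* equality of the elements they represent.                                 *)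
Definition H2m (f : A -> A -> A -> N) : Prop := exists r, cocycle2 r f.

Definition H2m_deg (l : int) (f : A -> A -> A -> N) : Prop :=
  exists r, hom_cocycle2 r l f.

Definition H2m_eq (f f' : A -> A -> A -> N) : Prop :=
  exists r, coboundary2 r (fun x a b => f x a b - f' x a b).

(* The right A-module structure induced by the left one of A/A_{>= r}. *)
Definition H2m_act (f : A -> A -> A -> N) (c : A) : A -> A -> A -> N :=
  fun x a b => f (c * x) a b.

End Bar.

Definition H2m_map (N N' : lmodType A^c) (h : N -> N')
    (f : A -> A -> A -> N) : A -> A -> A -> N' :=
  fun x a b => h (f x a b).

(* A as a right module over itself; here ract m a = m * a. *)
Definition regmod : lmodType A^c := (A^c)^o.

(* A^g: the space A with the right action of r sending m to m * g r. *)
Definition twist (g : gr_aut k Q) : Type := A.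

Section Twist.
Variable g : gr_aut k Q.
Local Notation Ag := (twist g).

HB.instance Definition _ := GRing.Zmodule.on Ag.

Definition twist_scale (r : A^c) (m : Ag) : Ag := (m : A) * g (r : A).

Lemma twist_scaleA (a b : A^c) (m : Ag) :
  twist_scale a (twist_scale b m) = twist_scale (a * b) m.
Proof.
rewrite /twist_scale -[in RHS]/((b : A) * (a : A)).
by rewrite [g (_ * _)]rmorphM mulrA.
Qed.

Lemma twist_scale1 : left_id (1 : A^c) twist_scale.
Proof. by move=> m; rewrite /twist_scale [g _]rmorph1 mulr1. Qed.

Lemma twist_scaleDr : right_distributive twist_scale +%R.
Proof. by move=> a m m'; rewrite /twist_scale [LHS]mulrDl. Qed.

Lemma twist_scaleDl m : {morph twist_scale^~ m : a b / a + b}.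
Proof. by move=> a b; rewrite /twist_scale [g _]rmorphD [LHS]mulrDr. Qed.

HB.instance Definition _ := GRing.Zmodule_isLmodule.Build A^c Ag
  twist_scaleA twist_scale1 twist_scaleDr twist_scaleDl.

(* The identification H^2_m(A^g) = H^2_m(A)^g.  Precomposing with g^{-1}    *)
(* turns A-linear maps Bar(A/A_{>= r}) -> A^g into A-linear maps            *)
(* Bar(A/A_{>= r}) -> A.  In degree 0 it does not change the value of       *)
(* A/A_{>= r} -> A^g at 1, hence it is the identity on the m-torsion, where *)
(* H^0_m(A^g) = H^0_m(A)^g is an equality of subsets of A.                  *)
Definition H2m_untwist (f : A -> A -> A -> Ag) : A -> A -> A -> regmod :=
  fun x a b => f (gautV g x) (gautV g a) (gautV g b).

Definition H2m_aut (f : A -> A -> A -> regmod) : A -> A -> A -> regmod :=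
  H2m_untwist (H2m_map (N := regmod) (N' := Ag) (g : A -> A) f).

End Twist.

(* A^\vee: the linear forms that vanish in all but finitely many degrees.   *)
(* The right action of c maps phi to x |-> phi (c * x).                     *)
Definition gdual (phi : A -> k) : Prop :=
  (forall c x y, phi (c *: x + y) = c * phi x + phi y) /\
  (exists r, forall x, pge r x -> phi x = 0).

(* The forms that belong to the summand e_b A^\vee, the dual of A e_b: they *)
(* are those which vanish on A e_c for all c <> b.                          *)
Definition gdual_at (b : vert Q) (phi : A -> k) : Prop :=
  forall x, phi x = phi (x * pidem k b).

(* Elements of degree j of A^\vee: the forms supported on A_{-j}. *)
Definition gdual_deg (j : int) (phi : A -> k) : Prop :=
  forall d x, pgr d x -> d%:Z != - j -> phi x = 0.

Local Notation H2mA := (@H2m regmod (@pgrz k Q)).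
Local Notation H2mA_eq := (@H2m_eq regmod (@pgrz k Q)).
Local Notation H2mA_deg := (@H2m_deg regmod (@pgrz k Q)).

(* theta induces an isomorphism H^2_m(A) ~ A^\vee[2] of graded right        *)
(* A-modules under which H^2_m(e_b A) corresponds to e_b A^\vee[2] for      *)
(* every vertex b.                                                          *)
Record local_duality (theta : (A -> A -> A -> regmod) -> A -> k) : Prop := {
  ld_dual : forall f, H2mA f -> gdual (theta f);
  ld_add : forall f f', H2mA f -> H2mA f' ->
    theta (fun x a b => f x a b + f' x a b) =1
    (fun x => theta f x + theta f' x);
  ld_act : forall f c, H2mA f ->
    theta (H2m_act f c) =1 (fun x => theta f (c * x));
  ld_inj : forall f f', H2mA f -> H2mA f' ->
    (theta f =1 theta f' <-> H2mA_eq f f');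
  ld_surj : forall phi, gdual phi -> exists2 f, H2mA f & theta f =1 phi;
  ld_deg : forall l f, H2mA_deg l f -> gdual_deg (l + 2) (theta f);
  ld_idem : forall b f, H2mA f ->
    (gdual_at b (theta f) <->
     exists f', [/\ H2mA f', H2mA_eq f f' &
                    forall x u v, (f' x u v : A) = pidem k b * f' x u v])
}.

Definition is_Hdet (g : gr_aut k Q) (D : 'M[k]_((nv Q).+1)) : Prop :=
  exists (theta : (A -> A -> A -> regmod) -> A -> k) (lambda : vert Q -> k),
  [/\ local_duality theta,
      forall s, lambda s != 0,
      forall s f, H2mA f -> gdual_at s (theta f) ->
        theta (H2m_aut g f) =1 (fun x => lambda s * theta f (gautV g x))
    & D = diag_mx (\row_s (lambda s)^-1)].

End LocalCohomology.

(* ExtA n and ExtD n are the graphs with n vertices. *)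
Inductive ext_dynkin := ExtA (n : nat) | ExtD (n : nat) | ExtE6 | ExtE7 | ExtE8.

Definition ext_dynkin_ok (T : ext_dynkin) : bool :=
  match T with ExtA n => (2 <= n)%N | ExtD n => (5 <= n)%N | _ => true end.

Definition ed_size (T : ext_dynkin) : nat :=
  match T with ExtA n => n | ExtD n => n | ExtE6 => 7 | ExtE7 => 8 | ExtE8 => 9
  end.

(* The arrows, as pairs (source, target) of vertices numbered from 1: the   *)
(* arrow alpha_1, and then the other ones in the order of their labels.     *)
Definition ed_arrows (T : ext_dynkin) : (nat * nat) * seq (nat * nat) :=
  match T with
  | ExtA n => ((1, 2), [seq (i, i.+1) | i <- iota 2 (n - 2)] ++ [:: (n, 1)])
  | ExtD n => ((1, 3), (2, 3) :: [seq (i, i.+1) | i <- iota 3 (n - 5)] ++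
                       [:: (n - 2, n - 1); (n - 2, n)])
  | ExtE6 => ((1, 2), [:: (2, 3); (3, 4); (4, 5); (3, 6); (6, 7)])
  | ExtE7 => ((1, 2), [:: (2, 3); (3, 4); (4, 5); (5, 6); (6, 7); (4, 8)])
  | ExtE8 =>
      ((1, 2), [:: (2, 3); (3, 4); (4, 5); (5, 6); (6, 7); (7, 8); (6, 9)])
  end%N.

(* The vertex numbered i is represented by i - 1 : 'I_n. *)
Definition edge_quiver (n : nat) (e : nat * nat) (s : seq (nat * nat)) : quiver :=
  @Quiver n.-1 'I_(size s).+1
    (fun i => inord (nth e (e :: s) i).1.-1)
    (fun i => inord (nth e (e :: s) i).2.-1).

Definition ed_quiver (T : ext_dynkin) : quiver :=
  edge_quiver (ed_size T) (ed_arrows T).1 (ed_arrows T).2.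

Definition ed_alpha1 (T : ext_dynkin) : arr (ed_quiver T) := ord0.

(* Main.v *)
Require Import Defs.
From HB Require Import structures.
From mathcomp Require Import all_boot all_order all_algebra.
From mathcomp Require Import finmap generic_quotient boolp monalg zify ring.

(** The scalars lambda_s are computed from an explicit isomorphism between the
second local cohomology of A and the shifted graded dual of A, which is given
by a trace.

The trace form.  Write b' for the reverse of an arrow b of the double quiver
and sgn b = 1 or -1, so that the sum of the sgn b *: b b' is zero in A.
Evaluating a 2-cocycle f on this relation gives the linear map
on_rel f : m |-> sum of the sgn b *: f m b b', which vanishes on A_{>= r}, and
theta f x is the trace of m |-> on_rel f (x m).  If f is the coboundary of h,
then on_rel f = koszul_d h, a sum of commutators of right multiplications with
the maps h(-, b), so that its trace is zero: theta is defined on cohomology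
classes by the cyclicity of the trace alone.  Conjugating the trace by g shows
theta (f^g) = (c t)^-1 (theta f) o g^-1, because g multiplies b b' by c_b t_b,
and this is where Hdet = c t comes from.

Bijectivity of theta.  A normalised 2-cocycle is determined up to a coboundary
by its values on the relation, and these can be moved into degree 0 by dividing
on the right by arrows; the trace then sees exactly what is left
(inj_normalised).  Conversely, a linear form is realised by a cocycle because
left multiplication by all the arrows is injective on A, with an explicit
retraction (kdiv_rel): this is the exactness of the Koszul complex at its left
end, and the point at which the extended Dynkin condition enters.  Let delta be
the positive vector with C delta = 2 delta, where C is the adjacency matrix,
and kappa b = delta (tgt b) / delta (src b).  Then the kappa b with given source
add up to 2, and kappa b * kappa b' = 1.  With these weights A behaves like a
polynomial ring: it carries partial derivatives with the Euler identity
sum of the c D_c x = deg(x) x and with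
sum of the kappa b * D_b' (b' w) = (deg w + 2) w.  The second identity shows
both that the D_c respect the relation and, in characteristic 0, that the b' w
determine w.  Iterated derivatives also give the graded linear section of the
path algebra over A on which traces are computed.

Uniqueness.  For any other isomorphism th, the class f with th f equal to the
coefficient of e_s spans the part of the cohomology that is annihilated by the
arrows and by the other idempotents, so that theta f is a multiple of the same
form; comparing the two descriptions of f^g gives lambda_s = (c t)^-1
(is_HdetE).

Independence of the arrow.  Applying D_c to the image under g of the relation
shows that the products c_b t_b agree for arrows that leave the same vertex
(scale_product_local), and an extended Dynkin graph is connected. *)

Set Implicit Arguments.
Unset Strict Implicit.
Unset Printing Implicit Defensive.

Import GRing.Theory.
Local Open Scope ring_scope.

(** * Linear maps and sums *)

Section Lin.
Variables (k : fieldType) (V W : lmodType k).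
(** Cochains are functions of several variables that are linear in each of
them, so that linearity is handled as a predicate rather than as a bundle. *)
Definition lin (h : V -> W) : Prop := forall c x y, h (c *: x + y) = c *: h x + h y.
Variable h : V -> W.
Hypothesis hl : lin h.
Lemma lin0 : h 0 = 0.
Proof. by have := hl 1 0 0; rewrite !scale1r addr0 => /eqP; rewrite -subr_eq0 opprD addrA subrr sub0r oppr_eq0 => /eqP. Qed.

Lemma linZ c x : h (c *: x) = c *: h x.
Proof. by rewrite -[c *: x]addr0 hl lin0 addr0. Qed.

Lemma linD x y : h (x + y) = h x + h y.
Proof. by rewrite -[x]scale1r hl !scale1r. Qed.

Lemma linN x : h (- x) = - h x.
Proof. by rewrite -scaleN1r linZ scaleN1r. Qed.

Lemma linB x y : h (x - y) = h x - h y.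
Proof. by rewrite linD linN. Qed.

Lemma lin_sum I (s : seq I) (P : pred I) F :
  h (\sum_(i <- s | P i) F i) = \sum_(i <- s | P i) h (F i).
Proof. by apply: (big_morph h linD lin0). Qed.

End Lin.

Section LinClosure.
Variables (k : fieldType) (U V W : lmodType k).
Lemma lin_comp (f : V -> W) (h : U -> V) : lin f -> lin h -> lin (fun x => f (h x)).
Proof. by move=> lf lh c x y; rewrite lh lf. Qed.

Lemma lin_add (f h : V -> W) : lin f -> lin h -> lin (fun x => f x + h x).
Proof. by move=> lf lh c x y; rewrite lh lf scalerDr addrACA. Qed.

Lemma lin_opp (f : V -> W) : lin f -> lin (fun x => - f x).
Proof. by move=> lf c x y; rewrite lf opprD scalerN. Qed.

Lemma lin_scale a (f : V -> W) : lin f -> lin (fun x => a *: f x).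
Proof. by move=> lf c x y; rewrite lf scalerDr !scalerA mulrC. Qed.

Lemma lin_zero : lin (fun _ : V => 0 : W).
Proof. by move=> c x y; rewrite scaler0 addr0. Qed.

Lemma lin_bigsum I (s : seq I) (P : pred I) (F : I -> V -> W) :
  (forall i, lin (F i)) -> lin (fun x => \sum_(i <- s | P i) F i x).
Proof.
move=> lF c x y; rewrite scaler_sumr -big_split /=.
by apply: eq_bigr => i _; rewrite lF.
Qed.

End LinClosure.

Lemma lin_id (k : fieldType) (V : lmodType k) : lin (fun x : V => x).
Proof. by []. Qed.

Lemma lin_linear (k : fieldType) (V W : lmodType k) (f : {linear V -> W}) : lin f.
Proof. by move=> c x y; rewrite linearP. Qed.

Lemma lin_mulr (k : fieldType) (V : lmodType k) (R : algType k) (f : V -> R) a :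
  lin f -> lin (fun x => f x * a).
Proof. by move=> lf c x y; rewrite lf mulrDl scalerAl. Qed.

Lemma lin_mull (k : fieldType) (V : lmodType k) (R : algType k) (f : V -> R) a :
  lin f -> lin (fun x => a * f x).
Proof. by move=> lf c x y; rewrite lf mulrDr scalerAr. Qed.

Lemma lin_ext (k : fieldType) (V W : lmodType k) (f g : V -> W) : f =1 g -> lin g -> lin f.
Proof. by move=> e lg c x y; rewrite !e lg. Qed.

Lemma sum_only (V : nmodType) (I : finType) (i : I) (F : I -> V) :
  (forall j, j != i -> F j = 0) -> \sum_j F j = F i.
Proof. by move=> H; rewrite (bigD1 i) //= big1 ?addr0. Qed.

Lemma sum_only_seq (V : nmodType) (I : eqType) (s : seq I) (i : I) (F : I -> V) :
  i \in s -> uniq s -> (forall j, j != i -> F j = 0) -> \sum_(j <- s) F j = F i.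
Proof. by move=> si us H; rewrite (bigD1_seq i) //= big1 ?addr0. Qed.

Lemma sumrBB (V : zmodType) (I : finType) (F1 F2 F3 : I -> V) :
  \sum_i (F1 i - F2 i - F3 i) = \sum_i F1 i - \sum_i F2 i - \sum_i F3 i.
Proof. by rewrite !sumrB. Qed.

(** * The preprojective algebra: arrows, idempotents and degrees *)

Section Base.
Variables (k : fieldType) (Q : quiver).
Local Notation A := (preproj k Q).
Local Notation T := (pathalg k (Defs.double Q)).
Local Notation arrs := (arr (Defs.double Q)).
Local Notation E := (@pidem k Q).

Definition inva (b : arrs) : arrs := match b with inl a => inr a | inr a => inl a end.
Definition sgn (b : arrs) : k := match b with inl _ => 1 | inr _ => - 1 end.

Lemma invaK : involutive inva. Proof. by case. Qed.

Lemma src_inva b : src (inva b) = tgt b. Proof. by case: b. Qed.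

Lemma tgt_inva b : tgt (inva b) = src b. Proof. by case: b. Qed.

Lemma sgn_inva b : sgn (inva b) = - sgn b. Proof. by case: b; rewrite //= opprK. Qed.

Lemma sgn_sqr b : sgn b * sgn b = 1. Proof. by case: b => _ /=; rewrite ?mulrNN mulr1. Qed.

Lemma inva_inj : injective inva. Proof. exact: inv_inj invaK. Qed.

Definition ar (b : arrs) : A := ppi (darr k b).

Lemma pelt_cons (b : arrs) (w : seq arrs) (H : walk (src b, b :: w).1 (src b, b :: w).2)
  (H' : walk (tgt b, w).1 (tgt b, w).2) :
  pelt k (exist _ (src b, b :: w) H : qpath (Defs.double Q)) =
  darr k b * pelt k (exist _ (tgt b, w) H' : qpath (Defs.double Q)).
Proof.
rewrite /darr [_ * _]pamulUU /pbmul ifT; last by rewrite eqxx.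
by congr pelt; apply: val_inj; rewrite val_pcat.
Qed.

Lemma pelt_mul (p q : qpath (Defs.double Q)) : pelt k p * pelt k q = pbmul k p q.
Proof. exact: pamulUU. Qed.

(** The induction scheme that matches recursion on the first letter of a path. *)
Lemma pa_ind_left (P : T -> Prop) :
  (forall c f g, P f -> P g -> P (c *: f + g)) ->
  (forall v : vert (Defs.double Q), P (pelt k (ptriv v))) ->
  (forall (b : arrs) x, P x -> P (darr k b * x)) -> forall x, P x.
Proof.
move=> Pl Pv Pb; have P0 : P 0.
  by rewrite -(addNr (pelt k (ptriv (ord0 : vert (Defs.double Q))))) -scaleN1r; apply: Pl.
apply: pa_ind => // [[[v w] H]].
elim: w v H => [|b w IH] v H.
  have -> : exist _ (v, [::]) H = ptriv v by apply: val_inj.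
  exact: Pv.
have /= /andP[/eqP sb H'] := H; subst v.
by rewrite (pelt_cons _ H'); apply: Pb.
Qed.

Lemma rel_sum : preproj_rel k Q = \sum_(b : arrs) sgn b *: (darr k b * darr k (inva b)).
Proof.
rewrite /preproj_rel big_split /= big_sumType /=.
by congr (_ + _); apply: eq_bigr => a _; rewrite ?scale1r ?scaleN1r.
Qed.

Lemma ppi_mul (x y : T) : ppi (x * y) = ppi x * ppi y.
Proof. exact: rmorphM. Qed.

Lemma ar_rel : \sum_b sgn b *: (ar b * ar (inva b)) = 0.
Proof.
transitivity (ppi (preproj_rel k Q)).
  by rewrite rel_sum linear_sum; apply: eq_bigr => b _; rewrite linearZ /= ppi_mul.
transitivity (ppi (0 : T)); last by rewrite linear0.
apply/ppiP; rewrite subr0; exists [:: (1, 1)].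
by rewrite big_seq1 /= mul1r mulr1.
Qed.

Lemma idemM v w : E v * E w = if v == w then E v else 0.
Proof.
rewrite /pidem -ppi_mul pelt_mul /pbmul pend_triv pstart_triv; case: eqP => [->|_]; last by rewrite linear0.
by rewrite -[X in pcat _ X]/(ptriv (pend (ptriv (w : vert (Defs.double Q))))) pcatp1.
Qed.

Lemma idem_ar v (b : arrs) : E v * ar b = if v == src b then ar b else 0.
Proof.
rewrite /pidem /ar -ppi_mul /darr pelt_mul /pbmul pend_triv; case: eqP => [->|_]; last by rewrite linear0.
by rewrite pcat1p.
Qed.

Lemma ar_idem (b : arrs) v : ar b * E v = if tgt b == v then ar b else 0.
Proof.
rewrite /pidem /ar -ppi_mul /darr pelt_mul /pbmul pstart_triv; case: eqP => [<-|_]; last by rewrite linear0.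
by rewrite pcatp1.
Qed.

Lemma idem_sum : \sum_v E v = 1.
Proof. by rewrite -[RHS]/(ppi (paone k (Defs.double Q))) /paone linear_sum. Qed.

Lemma idem_ar_src (b : arrs) : E (src b) * ar b = ar b. Proof. by rewrite idem_ar eqxx. Qed.

Lemma ar_idem_tgt (b : arrs) : ar b * E (tgt b) = ar b. Proof. by rewrite ar_idem eqxx. Qed.

Lemma A_ind (P : A -> Prop) :
  (forall c f g, P f -> P g -> P (c *: f + g)) ->
  (forall v, P (E v)) -> (forall (b : arrs) x, P x -> P (ar b * x)) -> forall x, P x.
Proof.
move=> Pl Pv Pb x; have [y ->] := ppi_surj x.
elim/pa_ind_left: y => [c f g Pf Pg|v|b y Py]; first by rewrite linearP; apply: Pl.
  exact: Pv.
by rewrite ppi_mul; apply: Pb.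
Qed.

(** Taking S to be the singleton of d or the half-line from r on gives the degree
d part or the part in degrees at least r, so that both are treated at once. *)
Definition tlen (S : nat -> Prop) (y : T) := forall p, y@_p != 0 -> S (plen p).
Definition alen (S : nat -> Prop) (x : A) := exists2 y : T, tlen S y & x = ppi y.

Section Supp.
Variable S : nat -> Prop.
Lemma tlen_lin c x y : tlen S x -> tlen S y -> tlen S (c *: x + y).
Proof.
move=> Hx Hy p; rewrite mcoeffD mcoeffZ.
have [e|/Hx //] := eqVneq (x@_p) 0.
by rewrite e mulr0 add0r; apply: Hy.
Qed.

Lemma tlen0 : tlen S 0. Proof. by move=> p; rewrite mcoeff0 eqxx. Qed.

Lemma tlen_pelt p : S (plen p) -> tlen S (pelt k p).
Proof. by move=> Sp q; rewrite pelt_coef; case: (p =P q) => [<- //|_]; rewrite eqxx. Qed.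

Lemma tlenD x y : tlen S x -> tlen S y -> tlen S (x + y).
Proof. by move=> Hx Hy; rewrite -[x]scale1r; apply: tlen_lin. Qed.

Lemma tlenZ c x : tlen S x -> tlen S (c *: x).
Proof. by move=> Hx; rewrite -[_ *: _]addr0; apply: tlen_lin => //; apply: tlen0. Qed.

Lemma tlen_sum I (s : seq I) (P : pred I) F : (forall i, P i -> tlen S (F i)) ->
  tlen S (\sum_(i <- s | P i) F i).
Proof. by move=> H; apply: big_ind => //; [apply: tlen0 | apply: tlenD]. Qed.

Lemma tlen_ind (P : T -> Prop) : P 0 -> (forall c f g, P f -> P g -> P (c *: f + g)) ->
  (forall p, S (plen p) -> P (pelt k p)) -> forall y, tlen S y -> P y.
Proof.
move=> P0 Pl Pu y Sy; rewrite [y]malgEl big_seq.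
apply: (big_ind P) => //; first by move=> a b Pa Pb; rewrite -[a]scale1r; apply: Pl.
move=> p; rewrite -mcoeff_neq0 => /Sy Sp; rewrite -[_ *: _]addr0; apply: Pl => //.
by rewrite -peltE; apply: Pu.
Qed.

Lemma alen_lin c x y : alen S x -> alen S y -> alen S (c *: x + y).
Proof.
by move=> [u Hu ->] [v Hv ->]; exists (c *: u + v); [apply: tlen_lin | rewrite linearP].
Qed.

Lemma alen0 : alen S 0.
Proof. by exists 0; [apply: tlen0 | rewrite linear0]. Qed.

Lemma alenD x y : alen S x -> alen S y -> alen S (x + y).
Proof. by move=> Hx Hy; rewrite -[x]scale1r; apply: alen_lin. Qed.

Lemma alenZ c x : alen S x -> alen S (c *: x).
Proof. by move=> Hx; rewrite -[_ *: _]addr0; apply: alen_lin => //; apply: alen0. Qed.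

Lemma alenN x : alen S x -> alen S (- x).
Proof. by move=> Hx; rewrite -scaleN1r; apply: alenZ. Qed.

Lemma alenB x y : alen S x -> alen S y -> alen S (x - y).
Proof. by move=> Hx Hy; apply: alenD => //; apply: alenN. Qed.

Lemma alen_sum I (s : seq I) (P : pred I) F : (forall i, P i -> alen S (F i)) ->
  alen S (\sum_(i <- s | P i) F i).
Proof. by move=> H; apply: big_ind => //; [apply: alen0 | apply: alenD]. Qed.

Lemma alen_pelt p : S (plen p) -> alen S (ppi (pelt k p)).
Proof. by move=> H; exists (pelt k p) => //; apply: tlen_pelt. Qed.

Lemma alen_ind (P : A -> Prop) : P 0 -> (forall c f g, P f -> P g -> P (c *: f + g)) ->
  (forall p, S (plen p) -> P (ppi (pelt k p))) -> forall x, alen S x -> P x.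
Proof.
move=> P0 Pl Pu x [y Sy ->].
apply: (@tlen_ind (fun y => P (ppi y))) Sy => [|c f g Pf Pg|p Sp]; last exact: Pu.
  by rewrite linear0.
by rewrite linearP; apply: Pl.
Qed.

End Supp.

Lemma tlenM (S1 S2 S3 : nat -> Prop) : (forall i j, S1 i -> S2 j -> S3 (i + j)%N) ->
  forall x y, tlen S1 x -> tlen S2 y -> tlen S3 (x * y).
Proof.
move=> H x y Hx Hy; apply: (@tlen_ind S1 (fun x => tlen S3 (x * y))) Hx => [|c f g Pf Pg|p Sp].
- by rewrite mul0r; apply: tlen0.
- by rewrite mulrDl -scalerAl; apply: tlen_lin.
apply: (@tlen_ind S2 (fun y => tlen S3 (pelt k p * y))) Hy => [|c f g Pf Pg|q Sq].
- by rewrite mulr0; apply: tlen0.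
- by rewrite mulrDr -scalerAr; apply: tlen_lin.
rewrite pelt_mul /pbmul; case: eqP => e; last exact: tlen0.
by apply: tlen_pelt; rewrite /plen pword_pcat // size_cat; apply: H.
Qed.

Lemma alenM (S1 S2 S3 : nat -> Prop) : (forall i j, S1 i -> S2 j -> S3 (i + j)%N) ->
  forall x y, alen S1 x -> alen S2 y -> alen S3 (x * y).
Proof.
move=> H x y [u Hu ->] [v Hv ->]; exists (u * v); last by rewrite ppi_mul.
exact: tlenM Hu Hv.
Qed.

Lemma alen_sub (S S' : nat -> Prop) x : (forall n, S n -> S' n) -> alen S x -> alen S' x.
Proof. by move=> H [y Hy ->]; exists y => // p /Hy/H. Qed.

Lemma pgrE d (x : A) : pgr d x = alen (fun n => n = d) x. Proof. by []. Qed.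

Lemma pgeE r (x : A) : pge r x = alen (fun n => (r <= n)%N) x. Proof. by []. Qed.

Lemma pgrM d e (x y : A) : pgr d x -> pgr e y -> pgr (d + e) (x * y).
Proof. by rewrite !pgrE; apply: alenM => i j -> ->. Qed.

Lemma pgeM r s (x y : A) : pge r x -> pge s y -> pge (r + s) (x * y).
Proof. by rewrite !pgeE; apply: alenM => i j; apply: leq_add. Qed.

Lemma pge0 (x : A) : pge 0 x.
Proof. by have [y ->] := ppi_surj x; exists y. Qed.

Lemma pgeMr r (x y : A) : pge r x -> pge r (x * y).
Proof. by move=> H; rewrite -[r]addn0; apply: pgeM => //; apply: pge0. Qed.

Lemma pgeMl r (x y : A) : pge r x -> pge r (y * x).
Proof. by move=> H; rewrite -[r]add0n; apply: pgeM => //; apply: pge0. Qed.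

Lemma pge_leq r s (x : A) : (r <= s)%N -> pge s x -> pge r x.
Proof. by move=> H; rewrite !pgeE; apply: alen_sub => n; apply: leq_trans. Qed.

Lemma pgr_E v : pgr 0 (E v). Proof. by apply: (alen_pelt (S := fun n => n = 0%N)). Qed.

Lemma pgr_ar b : pgr 1 (ar b). Proof. by apply: (alen_pelt (S := fun n => n = 1%N)). Qed.

Lemma pgr_pge d (x : A) : pgr d x -> pge d x.
Proof. by rewrite pgrE pgeE; apply: alen_sub => n ->. Qed.

Lemma pge_ar b : pge 1 (ar b). Proof. exact/pgr_pge/pgr_ar. Qed.

Lemma mon_ind (P : A -> Prop) : P 0 -> (forall c f g, P f -> P g -> P (c *: f + g)) ->
  (forall p, P (ppi (pelt k p))) -> forall x, P x.
Proof.
move=> P0 Pl Pu x; have := pge0 x; rewrite pgeE.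
by apply: alen_ind.
Qed.

Lemma pgr_mon p : pgr (plen p) (ppi (pelt k p) : A).
Proof. exact: (alen_pelt (S := fun n => n = plen p)). Qed.

(** Statements about A are mostly proved on homogeneous elements; the
homogeneous elements span A. *)
Lemma hom_ind (P : A -> Prop) : (forall c f g, P f -> P g -> P (c *: f + g)) ->
  (forall d x, pgr d x -> P x) -> forall x, P x.
Proof.
move=> Pl Ph; apply: mon_ind => // [|p]; last exact/Ph/pgr_mon.
by apply: (Ph 0%N); exact: (@alen0 (fun n => n = 0%N)).
Qed.

Lemma pgrz_lin j c (x y : A) : pgrz j x -> pgrz j y -> pgrz j (c *: x + y).
Proof. by case: j => d /=; [exact: (@alen_lin (fun n => n = d)) | move=> -> ->; rewrite scaler0 addr0]. Qed.

Lemma pgrz0 j : pgrz j (0 : A). Proof. by case: j => d //=; exact: (@alen0 (fun n => n = d)). Qed.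

Lemma pgrzD j (x y : A) : pgrz j x -> pgrz j y -> pgrz j (x + y).
Proof. by move=> Hx Hy; rewrite -[x]scale1r; apply: pgrz_lin. Qed.

Lemma pgrzZ j c (x : A) : pgrz j x -> pgrz j (c *: x).
Proof. by move=> Hx; rewrite -[_ *: _]addr0; apply: pgrz_lin => //; apply: pgrz0. Qed.

Lemma pgrzN j (x : A) : pgrz j x -> pgrz j (- x).
Proof. by move=> Hx; rewrite -scaleN1r; apply: pgrzZ. Qed.

Lemma pgrzB j (x y : A) : pgrz j x -> pgrz j y -> pgrz j (x - y).
Proof. by move=> Hx Hy; apply: pgrzD => //; apply: pgrzN. Qed.

Lemma pgrz_sum j I (s : seq I) (P : pred I) F : (forall i, P i -> pgrz j (F i : A)) ->
  pgrz j (\sum_(i <- s | P i) F i).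
Proof. by move=> H; apply: big_ind => //; [apply: pgrz0 | apply: pgrzD]. Qed.

Lemma pgrzMr j d (x y : A) : pgrz j x -> pgr d y -> pgrz (j + d%:Z) (x * y).
Proof.
case: j => e; first by move=> Hx Hy; apply: pgrM.
by move=> /= -> _; rewrite mul0r; apply: pgrz0.
Qed.

Lemma pgrzMl j d (x y : A) : pgrz j y -> pgr d x -> pgrz (d%:Z + j) (x * y).
Proof.
case: j => e; first by move=> Hx Hy; apply: pgrM.
by move=> /= -> _; rewrite mulr0; apply: pgrz0.
Qed.

Section Descent.
Variables (W : lmodType k) (F : T -> W).
Hypothesis lF : lin F.
Hypothesis kF : forall u w, F (u * preproj_rel k Q * w) = 0.
(** The value at the representative that the quotient picks; locked, to stop
unification from computing with representatives. *)
Definition descend : A -> W := locked (fun x : A => F (repr x)).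
Lemma kill_ideal z : preproj_ideal z -> F z = 0.
Proof. by move=> [s ->]; rewrite (lin_sum lF) big1 // => u _; apply: kF. Qed.

Lemma descendE y : descend (ppi y) = F y.
Proof.
by rewrite /descend -lock; have [z /kill_ideal Hz ->] := ppi_repr y; rewrite (linD lF) Hz addr0.
Qed.

Lemma descend_lin : lin descend.
Proof.
move=> c x y; have [u ->] := ppi_surj x; have [v ->] := ppi_surj y.
by rewrite -linearP !descendE lF.
Qed.

End Descent.

(** * Linear maps defined degree by degree *)

Section Glue.
Variables (W : lmodType k) (F : nat -> A -> W).
Hypothesis lF : forall n, lin (F n).
(** A family of linear maps, one for each degree, defines a single map on A since
the ideal of relations is homogeneous.  This avoids decomposing elements of A
into their homogeneous components. *)
Definition glueT : T -> W := lext (fun p => F (plen p) (ppi (pelt k p))).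
Lemma glueT_lin : lin glueT. Proof. exact: lin_linear. Qed.

Lemma glueT_hom d y : tlen (fun n => n = d) y -> glueT y = F d (ppi y).
Proof.
apply: (@tlen_ind _ (fun y => glueT y = F d (ppi y))) => [|c f g Hf Hg|p Sp].
- by rewrite (lin0 glueT_lin) linear0 (lin0 (lF d)).
- by rewrite glueT_lin linearP /= lF Hf Hg.
by rewrite /glueT lextE Sp.
Qed.

Lemma rel_hom : tlen (fun n => n = 2) (preproj_rel k Q).
Proof.
rewrite rel_sum; apply: tlen_sum => b _; apply: tlenZ.
by apply: (@tlenM (fun n => n = 1%N) (fun n => n = 1%N)); [by move=> i j -> ->| |]; apply: tlen_pelt.
Qed.

Lemma ppi_rel u w : ppi (u * preproj_rel k Q * w) = 0 :> A.
Proof.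
rewrite !ppi_mul; have -> : ppi (preproj_rel k Q) = 0; last by rewrite mulr0 mul0r.
rewrite rel_sum linear_sum -[RHS]ar_rel; apply: eq_bigr => b _.
by rewrite linearZ /= ppi_mul.
Qed.

(** On paths p and q the element p rel q is homogeneous, so that only one of the
maps of the family meets it, and that map factors through A. *)
Lemma glueT_kill u w : glueT (u * preproj_rel k Q * w) = 0.
Proof.
elim/pa_ind: u => [|c f g IH IH'|p].
- by rewrite !mul0r (lin0 glueT_lin).
- by rewrite !mulrDl -!scalerAl glueT_lin IH IH' scaler0 addr0.
elim/pa_ind: w => [|c f g IH IH'|q].
- by rewrite !mulr0 (lin0 glueT_lin).
- by rewrite !mulrDr -!scalerAr glueT_lin IH IH' scaler0 addr0.
rewrite (@glueT_hom (plen p + 2 + plen q)).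
  by rewrite ppi_rel (lin0 (lF _)).
apply: (@tlenM (fun n => n = (plen p + 2)%N) (fun n => n = plen q)); [by move=> i j -> ->| |exact: tlen_pelt].
by apply: (@tlenM (fun n => n = plen p) (fun n => n = 2)); [by move=> i j -> ->|exact: tlen_pelt|exact: rel_hom].
Qed.

Definition glue : A -> W := descend glueT.
Lemma glue_lin : lin glue. Proof. exact: descend_lin glueT_lin glueT_kill. Qed.

Lemma glue_hom d x : pgr d x -> glue x = F d x.
Proof. by move=> [y Sy ->]; rewrite /glue (descendE glueT_lin glueT_kill) (glueT_hom Sy). Qed.

End Glue.

Definition degscale (w : nat -> k) : A -> A := glue (fun d x => w d *: x).
Lemma degscale_aux (w : nat -> k) n : lin (fun x : A => w n *: x : A).
Proof. by apply: lin_scale; apply: lin_id. Qed.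

Lemma degscale_lin w : lin (degscale w). Proof. exact: (glue_lin (@degscale_aux w)). Qed.

Lemma degscale_hom w d x : pgr d x -> degscale w x = w d *: x.
Proof. exact: (glue_hom (@degscale_aux w)). Qed.

Definition proj (d : nat) : A -> A := degscale (fun n => (n == d)%:R).
Lemma proj_hom d x : pgr d x -> proj d x = x.
Proof. by move=> H; rewrite /proj (degscale_hom _ H) eqxx scale1r. Qed.

Lemma proj_hom0 d e x : pgr e x -> e != d -> proj d x = 0.
Proof. by move=> H /negPf n; rewrite /proj (degscale_hom _ H) n scale0r. Qed.

Lemma proj_lin d : lin (proj d). Proof. exact: degscale_lin. Qed.

Lemma proj_pgr d x : pgr d (proj d x).
Proof.
elim/hom_ind: x => [c f g IH IH'|e x Hx]; first by rewrite /proj degscale_lin; exact: (@alen_lin (fun n => n = d)).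
have [e1|ne] := eqVneq e d; first by rewrite -e1 proj_hom.
by rewrite (proj_hom0 Hx ne); exact: (@alen0 (fun n => n = d)).
Qed.

Lemma proj_pgrz (j : int) d (x : A) : pgrz j x -> j != d%:Z -> proj d x = 0.
Proof.
case: j => [e|e] /=; first by move=> Hx ne; rewrite (proj_hom0 Hx).
by move=> -> _; rewrite /proj (lin0 (degscale_lin _)).
Qed.

(** Project onto the degree e + l. *)
Lemma pgrz_indep (s : seq int) (e : int) (Y : int -> A) : uniq s ->
  (forall l, pgrz (e + l) (Y l)) -> \sum_(l <- s) Y l = 0 ->
  forall l, l \in s -> Y l = 0.
Proof.
move=> us HY H l ls.
have [[d Hd]|[d Hd]] : (exists d, e + l = Posz d) \/ (exists d, e + l = Negz d).
- by case: (e + l) => d; [left|right]; exists d.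
- have := congr1 (proj d) H; rewrite (lin_sum (proj_lin _)) (lin0 (proj_lin _)).
  rewrite (bigD1_seq l) //= big1 ?addr0 => [<-|l' ne]; last first.
    rewrite (proj_pgrz (HY l')) // -Hd; apply: contra_neq ne; exact: addrI.
  by have := HY l; rewrite Hd => Hl; rewrite proj_hom.
by have := HY l; rewrite Hd.
Qed.

Definition tcoefT (v : vert Q) (y : T) : k^o := y@_(ptriv (v : vert (Defs.double Q))).
Lemma tcoefT_lin v : lin (tcoefT v).
Proof. move=> c x y; by rewrite /tcoefT mcoeffD mcoeffZ. Qed.

Lemma tcoefT_kill v u w : tcoefT v (u * preproj_rel k Q * w) = 0.
Proof.
rewrite /tcoefT (@pideal_coef k Q) //.
by exists [:: (u, w)]; rewrite big_seq1.
Qed.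

(** The coefficient at a trivial path: it is multiplicative by coef_trivM and
kills the ideal. *)
Definition tcoef v : A -> k^o := descend (tcoefT v).
Lemma tcoef_lin v : lin (tcoef v). Proof. exact: descend_lin (@tcoefT_lin v) (@tcoefT_kill v). Qed.

Lemma tcoefE v y : tcoef v (ppi y) = y@_(ptriv (v : vert (Defs.double Q))).
Proof. exact: (descendE (@tcoefT_lin v) (@tcoefT_kill v)). Qed.

Lemma tcoefM v x y : tcoef v (x * y) = (tcoef v x : k) * tcoef v y.
Proof.
have [u ->] := ppi_surj x; have [w ->] := ppi_surj y.
by rewrite -ppi_mul !tcoefE coef_trivM.
Qed.

Lemma ptriv_inj (v w : vert (Defs.double Q)) : ptriv v = ptriv w -> v = w.
Proof. by move=> /(congr1 (@pstart _)). Qed.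

Lemma tcoef_E v w : tcoef v (E w) = (v == w)%:R.
Proof.
rewrite tcoefE pelt_coef eq_sym; congr (nat_of_bool _)%:R.
by apply/eqP/eqP => [/ptriv_inj|->].
Qed.

Lemma tcoef_pge v x : pge 1 x -> tcoef v x = 0.
Proof.
move=> [y Hy ->]; rewrite tcoefE; apply/eqP; apply: contraT => /Hy.
by [].
Qed.

Lemma tcoef_hom0 x : pgr 0 x -> x = \sum_v (tcoef v x : k) *: E v.
Proof.
rewrite pgrE; apply: (@alen_ind _ (fun x => x = \sum_v (tcoef v x : k) *: E v)) => [|c f g IH IH'|[[v w] H] /= Hp].
- by rewrite big1 // => v _; rewrite (lin0 (tcoef_lin v)) scale0r.
- rewrite {1}IH {1}IH' scaler_sumr -big_split /=; apply: eq_bigr => v _.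
  by rewrite tcoef_lin scalerDl scalerA.
case: w H Hp => // H _.
have -> : exist _ (v, [::]) H = ptriv v by apply: val_inj.
rewrite (bigD1 v) //= big1 => [|w nw]; rewrite [ppi _]/(E v) tcoef_E.
  by rewrite eqxx scale1r addr0.
by rewrite (negPf nw) scale0r.
Qed.

End Base.

(** * Partial derivatives and the left end of the Koszul complex *)

Section Deriv.
Variables (k : fieldType) (Q : quiver).
Local Notation A := (preproj k Q).
Local Notation T := (pathalg k (Defs.double Q)).
Local Notation arrs := (arr (Defs.double Q)).
Local Notation E := (@pidem k Q).
Local Notation ar := (@ar k Q).
Local Notation sgn := (@sgn k Q).
Variable kappa : arrs -> k.
Hypothesis kappaV : forall b, kappa b * kappa (inva b) = 1.
Hypothesis kappa2 : forall v : vert Q, \sum_(b : arrs | src b == v) kappa b = 2.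
Hypothesis hk : [pchar k] =i pred0.

Lemma natrS_neq0 n : (n.+1%:R : k) != 0.
Proof. by have /pcharf0P -> := hk. Qed.

Definition wprod (w : seq arrs) : A := \prod_(b <- w) ar b.

Lemma ppi_pelt (p : qpath (Defs.double Q)) :
  ppi (pelt k p) = E (pstart p) * wprod (pword p).
Proof.
case: p => [[v w] H]; rewrite /pstart /pword /=.
elim: w v H => [|b w IH] v H.
  rewrite /wprod big_nil mulr1 /pidem; congr (ppi (pelt k _)); exact: val_inj.
have /= /andP[/eqP sb H'] := H; subst v.
rewrite (pelt_cons _ _ H') ppi_mul IH /wprod big_cons !mulrA.
by rewrite -[ppi (darr k b)]/(ar b) idem_ar_src ar_idem_tgt.
Qed.

Lemma triv_darr (v : vert (Defs.double Q)) (b : arrs) (y : T) :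
  pelt k (ptriv v) * (darr k b * y) = if v == src b then darr k b * y else 0.
Proof.
rewrite mulrA /darr pelt_mul /pbmul pend_triv; case: eqP => [->|_]; last by rewrite mul0r.
by rewrite pcat1p.
Qed.

Lemma pgr_wprod w : pgr (size w) (wprod w).
Proof.
elim: w => [|b w IH]; rewrite /wprod ?big_nil ?big_cons.
  rewrite -idem_sum; apply: (@alen_sum _ _ (fun n => n = 0%N)) => v _; exact: pgr_E.
by apply: (@pgrM _ _ 1); [exact: pgr_ar | exact: IH].
Qed.

(** In the tensor algebra of the arrows the weights kappa define a symmetric
braiding of V (x) V, equal to 1 minus the Temperley-Lieb generator, which sends
b b' to a multiple of the relation.  The derivative D_c braids each letter of a
word to the front in turn, and then strips a leading c; the formula is the
resulting recursion on the first letter. *)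
Fixpoint partialw (w : seq arrs) (c : arrs) : A :=
  if w is b :: w' then
    (if b == c then (size w').+1%:R *: (E (tgt b) * wprod w') else 0) -
    (if src c == src b then
      (sgn b * sgn c * kappa b) *: (ar (inva c) * partialw w' (inva b)) else 0)
  else 0.

Lemma partialw_src (v : vert (Defs.double Q)) w c : walk v w -> v != src c -> partialw w c = 0.
Proof.
case: w => [//|b w] /= /andP[/eqP <- _] ne.
rewrite [src c == _]eq_sym (negPf ne) subr0 ifN //.
by apply: contra_neq ne => ->.
Qed.

Definition partialT (c : arrs) : T -> A := locked (lext (fun p => partialw (pword p) c)).
Lemma partialT_lin c : lin (partialT c). Proof. rewrite /partialT -lock; exact: lin_linear. Qed.

Lemma partialT_pelt c p : partialT c (pelt k p) = partialw (pword p) c.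
Proof. by rewrite /partialT -lock lextE. Qed.

Definition deg_succ : A -> A := degscale (fun d => d.+1%:R).

(** The defining recursion, extended by linearity from paths to all elements; the
idempotent takes care of the paths that cannot be composed with b. *)
Lemma partialT_cons c b x : partialT c (darr k b * x) =
  (if b == c then E (tgt b) * deg_succ (ppi x) else 0) -
  (if src c == src b then
    (sgn b * sgn c * kappa b) *: (ar (inva c) * partialT (inva b) x) else 0).
Proof.
have lrhs : lin (fun x : T => (if b == c then E (tgt b) * deg_succ (ppi x) else 0) -
  (if src c == src b then
    (sgn b * sgn c * kappa b) *: (ar (inva c) * partialT (inva b) x) else 0) : A).
  apply: lin_add; [|apply: lin_opp].
    case: eqP => _; [apply: lin_mull | exact: lin_zero].
    by apply: lin_comp; [exact: degscale_lin | exact: lin_linear].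
  case: eqP => _; [apply/lin_scale/lin_mull | exact: lin_zero].
  exact: partialT_lin.
elim/pa_ind: x => [|a f g IH IH'|p].
- by rewrite (lin0 lrhs) mulr0 (lin0 (partialT_lin _)).
- by rewrite lrhs mulrDr -scalerAr partialT_lin IH IH'.
rewrite /deg_succ (degscale_hom _ (pgr_mon k p)) /darr pelt_mul /pbmul.
rewrite -[pend (parr b)]/(tgt b).
case: (eqVneq (tgt b) (pstart p)) => [e|ne].
  by rewrite !partialT_pelt pword_pcat //= ppi_pelt -scalerAr mulrA idemM -e eqxx.
rewrite (lin0 (partialT_lin _)) ppi_pelt -scalerAr mulrA idemM (negPf ne) mul0r scaler0.
rewrite partialT_pelt (@partialw_src (pstart p)) ?(valP p) //; last by rewrite src_inva eq_sym.
by rewrite mulr0 scaler0 !if_same subr0.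
Qed.

Lemma partialT_triv c (v : vert (Defs.double Q)) : partialT c (pelt k (ptriv v)) = 0.
Proof. by rewrite partialT_pelt. Qed.

Definition euler_op : A -> A := degscale (fun d => d%:R).
Lemma deg_succ_E x : deg_succ x = euler_op x + x.
Proof.
elim/hom_ind: x => [c f g IH IH'|d x Hx].
  by rewrite /deg_succ /euler_op !degscale_lin -/deg_succ -/euler_op IH IH' scalerDr addrACA.
by rewrite /deg_succ /euler_op !(degscale_hom _ Hx) -natr1 scalerDl scale1r.
Qed.

Lemma euler_op_ar b x : euler_op (ar b * x) = ar b * deg_succ x.
Proof.
elim/hom_ind: x => [c f g IH IH'|d x Hx].
  by rewrite mulrDr -scalerAr /deg_succ /euler_op !degscale_lin -/deg_succ -/euler_op IH IH' mulrDr scalerAr.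
by rewrite /deg_succ /euler_op (degscale_hom _ Hx) (degscale_hom _ (pgrM (pgr_ar k b) Hx)) scalerAr.
Qed.

Lemma euler_op_E v : euler_op (E v) = 0.
Proof. by rewrite /euler_op (degscale_hom _ (pgr_E k v)) scale0r. Qed.

Lemma ar_rel_v (v : vert Q) : \sum_(b : arrs | src b == v) sgn b *: (ar b * ar (inva b)) = 0.
Proof.
have := congr1 (fun x => E v * x) (ar_rel k Q); rewrite mulr0 mulr_sumr big_mkcond => H.
rewrite -[RHS]H [LHS]big_mkcond /=; apply: eq_bigr => b _.
by rewrite -scalerAr mulrA idem_ar eq_sym; case: eqP; rewrite ?mul0r ?scaler0.
Qed.

(** The correction terms of the recursion add up to a multiple of the relation at
the source of b, so that only the term c = b is left. *)
Lemma euler_T x : \sum_c ar c * partialT c x = euler_op (ppi x).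
Proof.
elim/pa_ind_left: x => [a f g IH IH'|v|b x IH].
- rewrite linearP /euler_op degscale_lin -/euler_op -IH -IH' scaler_sumr -big_split /=.
  by apply: eq_bigr => c _; rewrite partialT_lin mulrDr scalerAr.
- by rewrite big1 => [|c _]; rewrite ?partialT_triv ?mulr0 // -[ppi _]/(E v) euler_op_E.
under eq_bigr => c _ do rewrite partialT_cons mulrBr.
rewrite sumrB [X in X - _](bigD1 b) //= eqxx [X in _ + X - _]big1 ?addr0; last first.
  by move=> c nc; rewrite eq_sym (negPf nc) mulr0.
rewrite ppi_mul -/(ar b) euler_op_ar mulrA ar_idem_tgt.
rewrite [X in _ - X](_ : _ = 0) ?subr0 //.
transitivity ((sgn b * kappa b) *: ((\sum_(c : arrs | src c == src b) sgn c *: (ar c * ar (inva c)))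
   * partialT (inva b) x)).
  rewrite mulr_suml scaler_sumr [RHS]big_mkcond /=; apply: eq_bigr => c _.
  case: eqP => _; last by rewrite mulr0.
  by rewrite -scalerAr -scalerAl scalerA mulrA mulrAC.
by rewrite ar_rel_v mul0r scaler0.
Qed.

(** By the recursion the sum is twice (deg w + 1) w, from the weights that add up to
2 at each vertex, minus the Euler sum deg(w) w, from kappa b * kappa b' = 1. *)
Lemma weighted_partialT_sum w : \sum_b kappa b *: partialT (inva b) (darr k (inva b) * w) =
  deg_succ (ppi w) + ppi w.
Proof.
transitivity (\sum_b (kappa b *: (E (src b) * deg_succ (ppi w)) - ar b * partialT b w)).
  apply: eq_bigr => b _; rewrite partialT_cons !eqxx tgt_inva invaK scalerBr scalerA.
  apply: (f_equal2 (fun x y : A => x - y)); first by [].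
  have -> : kappa b * (sgn (inva b) * sgn (inva b) * kappa (inva b)) = 1; last by rewrite scale1r.
  by rewrite sgn_sqr mul1r kappaV.
rewrite sumrB euler_T.
have -> : \sum_b kappa b *: (E (src b) * deg_succ (ppi w)) = deg_succ (ppi w) + deg_succ (ppi w).
  transitivity (\sum_(v : vert Q) (\sum_(b : arrs | src b == v) kappa b) *: (E v * deg_succ (ppi w))).
    rewrite (partition_big (fun b : arrs => src b : vert Q) xpredT) //=.
    apply: eq_bigr => v _; rewrite scaler_suml.
    by apply: eq_bigr => b /eqP ->.
  under eq_bigr => v _ do rewrite kappa2.
  by rewrite -scaler_sumr -mulr_suml idem_sum mul1r scaler_nat mulr2n.
by rewrite -addrA; congr (_ + _); rewrite deg_succ_E addrC addKr.
Qed.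

Lemma partialT_El (c : arrs) x : E (tgt c) * partialT c x = partialT c x.
Proof.
elim/pa_ind_left: x => [a f g IH IH'|v|b x IH].
- by rewrite partialT_lin mulrDr -scalerAr IH IH'.
- by rewrite partialT_triv mulr0.
rewrite partialT_cons mulrBr; apply: (f_equal2 (fun x y : A => x - y)).
  by case: eqP => [->|_]; rewrite ?mulr0 // mulrA idemM eqxx.
case: eqP => _; rewrite ?mulr0 // -scalerAr mulrA -(src_inva c) idem_ar_src.
by [].
Qed.

(** The two kinds of terms in D_c (rel w) are (deg w + 2) c' w, once directly and
once through weighted_partialT_sum, with opposite signs. *)
Lemma partialT_rel c w : partialT c (preproj_rel k Q * w) = 0.
Proof.
rewrite rel_sum mulr_suml (lin_sum (partialT_lin c)).
transitivity (sgn c *: (ar (inva c) * (deg_succ (ppi w) + ppi w)) -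
   sgn c *: (ar (inva c) * \sum_b kappa b *: partialT (inva b) (darr k (inva b) * w))); last first.
  by rewrite weighted_partialT_sum subrr.
transitivity (\sum_b ((if b == c then sgn c *: (ar (inva c) * (deg_succ (ppi w) + ppi w)) else 0) -
   sgn c *: (ar (inva c) * (kappa b *: partialT (inva b) (darr k (inva b) * w))))).
  apply: eq_bigr => b _; rewrite -scalerAl -mulrA.
  transitivity (sgn b *: partialT c (darr k b * (darr k (inva b) * w))).
    exact: (linZ (partialT_lin c)).
  rewrite [X in _ *: X = _]partialT_cons scalerBr.
  apply: (f_equal2 (fun x y : A => x - y)).
    case: eqP => [->|_]; last by rewrite scaler0.
    rewrite ppi_mul -/(ar _) deg_succ_E euler_op_ar !mulrDr !mulrA -(src_inva c) idem_ar_src.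
    by [].
  case: eqP => [e|ne].
    by rewrite scalerA !mulrA sgn_sqr mul1r -scalerAr scalerA.
  rewrite scaler0 -partialT_El tgt_inva -!scalerAr mulrA ar_idem tgt_inva.
  by case: eqP => // _; rewrite mul0r !scaler0.
rewrite sumrB; apply: (f_equal2 (fun x y : A => x - y)).
  by rewrite (bigD1 c) //= eqxx big1 ?addr0 // => b /negPf ->.
by rewrite mulr_sumr scaler_sumr.
Qed.

Lemma partialT_Er c (v : vert (Defs.double Q)) y :
  partialT c (pelt k (ptriv v) * y) = if v == src c then partialT c y else 0.
Proof.
elim/pa_ind_left: y => [a f g IH IH'|u|b y _].
- rewrite mulrDr -scalerAr !partialT_lin IH IH'.
  by case: eqP; rewrite ?scaler0 ?addr0.
- rewrite pelt_mul /pbmul partialT_triv if_same; case: eqP => [e|_]; last by rewrite (lin0 (partialT_lin _)).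
  have {e} -> : v = u := e.
  by rewrite [pcat _ _](pcat1p (ptriv u)) partialT_triv.
rewrite triv_darr; case: (eqVneq v (src b)) => [e|ne].
  case: (eqVneq v (src c)) => [//|ne]; rewrite partialT_cons !ifN ?subr0 //.
    by rewrite eq_sym -e.
  by apply: contra_neq ne => <-.
rewrite (lin0 (partialT_lin _)); case: eqP => [e|//]; rewrite partialT_cons !ifN ?subr0 //.
  by rewrite -e.
by apply: contra_neq ne => ->.
Qed.

Lemma partialT_kill c u w : partialT c (u * preproj_rel k Q * w) = 0.
Proof.
rewrite -mulrA; elim/pa_ind_left: u c => [a f g IH IH'|v|b x IH] c.
- by rewrite mulrDl -scalerAl partialT_lin IH IH' scaler0 addr0.
- by rewrite partialT_Er partialT_rel if_same.
rewrite -mulrA partialT_cons IH mulr0 scaler0 if_same subr0.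
have -> : ppi (x * (preproj_rel k Q * w)) = 0 :> A by rewrite mulrA ppi_rel.
by rewrite /deg_succ (lin0 (degscale_lin _)) mulr0 if_same.
Qed.

Definition partial (c : arrs) : A -> A := descend (partialT c).
Lemma partial_lin c : lin (partial c). Proof. exact: descend_lin (@partialT_lin c) (@partialT_kill c). Qed.

Lemma partialE c y : partial c (ppi y) = partialT c y.
Proof. exact: (descendE (@partialT_lin c) (@partialT_kill c)). Qed.

Lemma partial_cons c b x : partial c (ar b * x) =
  (if b == c then E (tgt b) * deg_succ x else 0) -
  (if src c == src b then
    (sgn b * sgn c * kappa b) *: (ar (inva c) * partial (inva b) x) else 0).
Proof.
by have [y ->] := ppi_surj x; rewrite -ppi_mul !partialE partialT_cons.
Qed.

Lemma partial_E c v : partial c (E v) = 0. Proof. by rewrite /pidem partialE partialT_triv. Qed.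

Lemma euler_identity x : \sum_c ar c * partial c x = euler_op x.
Proof.
have [y ->] := ppi_surj x; rewrite -euler_T.
by apply: eq_bigr => c _; rewrite partialE.
Qed.

Lemma weighted_partial_sum w : \sum_b kappa b *: partial (inva b) (ar (inva b) * w) = deg_succ w + w.
Proof.
have [y ->] := ppi_surj w; rewrite -weighted_partialT_sum.
by apply: eq_bigr => c _; rewrite -ppi_mul partialE.
Qed.

Lemma partial_El (c : arrs) x : E (tgt c) * partial c x = partial c x.
Proof. by have [y ->] := ppi_surj x; rewrite partialE partialT_El. Qed.

Lemma partial_Er (c : arrs) x : partial c (E (src c) * x) = partial c x.
Proof.
elim/A_ind: x => [a f g IH IH'|v|b x _].
- by rewrite mulrDr -scalerAr !partial_lin IH IH'.
- by rewrite idemM; case: eqP => // _; rewrite ?(lin0 (partial_lin _)) !partial_E.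
rewrite mulrA idem_ar; case: eqP => // ne; rewrite mul0r (lin0 (partial_lin _)) partial_cons.
rewrite ifN; last by apply/eqP => e; apply: ne; rewrite e.
by rewrite ifN ?subr0 //; apply/eqP.
Qed.

Lemma partial_hom0 c x : pgr 0 x -> partial c x = 0.
Proof.
move=> /tcoef_hom0 ->; rewrite (lin_sum (partial_lin c)) big1 // => v _.
by rewrite (linZ (partial_lin c)) partial_E scaler0.
Qed.

Lemma partial_hom c d x : pgr d.+1 x -> pgr d (partial c x).
Proof.
rewrite pgrE; apply: (@alen_ind _ _ _ (fun x => pgr d (partial c x))) => [|a f g IH IH'|p].
- by rewrite (lin0 (partial_lin c)); exact: (@alen0 _ _ (fun n => n = d)).
- by rewrite partial_lin; exact: (@alen_lin _ _ (fun n => n = d)).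
rewrite ppi_pelt /plen; case: p => [[v w] /= H]; rewrite /pstart /pword /= => sw.
have : pgr d (partial c (wprod w)).
  clear H; elim: w c d sw => [//|b w IH] c d [sw]; rewrite /wprod big_cons partial_cons.
  have Hw : pgr d (wprod w) by rewrite -sw; apply: pgr_wprod.
  apply: (@alenB _ _ (fun n => n = d)).
    case: eqP => _; last exact: (@alen0 _ _ (fun n => n = d)).
    apply: (@pgrM _ _ 0); first exact: pgr_E.
    by rewrite /deg_succ (degscale_hom _ Hw); apply: (@alenZ _ _ (fun n => n = d)).
  case: eqP => _; last exact: (@alen0 _ _ (fun n => n = d)).
  apply: (@alenZ _ _ (fun n => n = d)).
  case: d sw Hw => [|d] sw Hw.
    by rewrite (partial_hom0 _ Hw) mulr0; exact: (@alen0 _ _ (fun n => n = 0%N)).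
  by apply: (@pgrM _ _ 1); [exact: pgr_ar | apply: IH].
move=> H1; have [->|ne] := eqVneq v (src c); first by rewrite partial_Er.
rewrite -partial_Er mulrA idemM eq_sym (negPf ne) mul0r (lin0 (partial_lin c)).
exact: (@alen0 _ _ (fun n => n = d)).
Qed.

(** Inverting the Euler identity, in characteristic 0, writes an element of degree
n + 1 as a combination of products of an arrow with elements of degree n. *)
Fixpoint sectn (n : nat) (x : A) : T :=
  if n is n'.+1 then n'.+1%:R^-1 *: \sum_b darr k b * sectn n' (partial b x)
  else \sum_v (tcoef v x : k) *: pelt k (ptriv (v : vert (Defs.double Q))).

Lemma sectnS n x : sectn n.+1 x = n.+1%:R^-1 *: \sum_b darr k b * sectn n (partial b x).
Proof. by []. Qed.

Lemma sectn0 x : sectn 0 x = \sum_v (tcoef v x : k) *: pelt k (ptriv (v : vert (Defs.double Q))).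
Proof. by []. Qed.

Lemma sectn_lin n : lin (sectn n).
Proof.
elim: n => [|n IH] /=.
  by apply: lin_bigsum => v c x y; rewrite tcoef_lin scalerDl scalerA.
apply: lin_scale; apply: lin_bigsum => b; apply: lin_mull.
exact: lin_comp IH (partial_lin b).
Qed.

Lemma sectn_hom n x : tlen (fun m => m = n) (sectn n x).
Proof.
elim: n x => [|n IH] x /=.
  by apply: tlen_sum => v _; apply: tlenZ; apply: tlen_pelt.
apply: tlenZ; apply: tlen_sum => b _.
apply: (@tlenM _ _ (fun m => m = 1%N) (fun m => m = n)); [by move=> i j -> ->| |exact: IH].
exact: tlen_pelt.
Qed.

Lemma sectnK n x : pgr n x -> ppi (sectn n x) = x.
Proof.
elim: n x => [|n IH] x Hx /=.
  rewrite {2}(tcoef_hom0 Hx) linear_sum; apply: eq_bigr => v _.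
  by rewrite linearZ.
rewrite linearZ linear_sum /=.
transitivity (n.+1%:R^-1 *: \sum_c ar c * partial c x).
  congr (_ *: _); apply: eq_bigr => c _.
  by rewrite ppi_mul IH //; apply: partial_hom.
by rewrite euler_identity /euler_op (degscale_hom _ Hx) scalerA mulVf ?scale1r // natrS_neq0.
Qed.

Definition sect : A -> T := glue sectn.
Lemma sect_lin : lin sect. Proof. exact: glue_lin sectn_lin. Qed.

Lemma sect_hom n x : pgr n x -> sect x = sectn n x.
Proof. exact: (glue_hom sectn_lin). Qed.

Lemma sectK x : ppi (sect x) = x.
Proof.
elim/hom_ind: x => [c f g IH IH'|d x Hx]; first by rewrite sect_lin linearP /= IH IH'.
by rewrite (sect_hom Hx) sectnK.
Qed.

Lemma sect_ar b : sect (ar b) = darr k b.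
Proof.
rewrite (sect_hom (pgr_ar k b)).
rewrite sectnS.
rewrite invr1 scale1r.
rewrite (@sum_only _ _ b) => [|c nc].
  rewrite sectn0 -[ar b]ar_idem_tgt partial_cons eqxx partial_E mulr0 scaler0 if_same subr0.
  rewrite /deg_succ (degscale_hom _ (pgr_E k _)) scale1r idemM eqxx.
  rewrite (@sum_only _ _ (tgt b)) => [|v nv]; last first.
    by rewrite tcoef_E (negPf nv) scale0r.
  by rewrite tcoef_E eqxx scale1r /darr pelt_mul /pbmul eqxx -[tgt b]/(pend (parr b)) pcatp1.
rewrite sectn0 -[ar b]ar_idem_tgt partial_cons eq_sym (negPf nc) partial_E mulr0 scaler0 if_same subr0.
by rewrite big1 ?mulr0 // => v _; rewrite (lin0 (tcoef_lin v)) scale0r.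
Qed.

Lemma sect_tlen d x : pgr d x -> tlen (fun m => m = d) (sect x).
Proof. by move=> H; rewrite (sect_hom H); apply: sectn_hom. Qed.

(** Up to sign and weight, D_b' divided by the degree plus 2: a retraction of
w |-> the family of all b' w. *)
Definition kdiv (b : arrs) (y : A) : A :=
  (sgn b * kappa b) *: degscale (fun d => d.+2%:R^-1) (partial (inva b) y).
Lemma kdiv_lin b : lin (kdiv b).
Proof. by apply: lin_scale; apply: lin_comp; [exact: degscale_lin | exact: partial_lin]. Qed.

(** Left multiplication by the arrows is injective on A.  This is false for a
Dynkin quiver, whose preprojective algebra is finite dimensional, and there no
weights kappa exist. *)
Lemma kdiv_rel w : \sum_b sgn b *: kdiv b (ar (inva b) * w) = w.
Proof.
transitivity (degscale (fun d => d.+2%:R^-1) (\sum_b kappa b *: partial (inva b) (ar (inva b) * w))).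
  rewrite (lin_sum (degscale_lin _)); apply: eq_bigr => b _.
  by rewrite /kdiv scalerA mulrA sgn_sqr mul1r (linZ (degscale_lin _)).
have lL : lin (fun w => degscale (fun d => d.+2%:R^-1) (deg_succ w + w)).
  apply: lin_comp; first exact: degscale_lin.
  by apply: lin_add; [exact: degscale_lin | exact: lin_id].
rewrite weighted_partial_sum; elim/hom_ind: w => [c f g IH IH'|d x Hx].
  by rewrite [LHS]lL IH IH'.
have -> : deg_succ x + x = d.+2%:R *: x.
  by rewrite /deg_succ (degscale_hom _ Hx) -[in RHS]natr1 scalerDl scale1r.
rewrite [LHS](linZ (@degscale_lin k Q _)) (degscale_hom _ Hx) scalerA divff ?scale1r //.
exact: natrS_neq0.
Qed.

Lemma kdiv_E (b : arrs) y : kdiv b (E (tgt b) * y) = kdiv b y.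
Proof. by rewrite /kdiv -src_inva partial_Er. Qed.

Lemma kdiv_El (b : arrs) y : E (src b) * kdiv b y = kdiv b y.
Proof.
rewrite /kdiv -scalerAr; congr (_ *: _); rewrite -tgt_inva -[in RHS]partial_El.
elim/hom_ind: (partial (inva b) y) => [c f g IH IH'|d x Hx].
  rewrite mulrDr -scalerAr [in RHS](@degscale_lin k Q) -IH -IH'.
  by rewrite [degscale _ _](@degscale_lin k Q) mulrDr -scalerAr.
by rewrite (degscale_hom _ Hx) (degscale_hom _ (pgrM (pgr_E k _) Hx)) scalerAr.
Qed.

Lemma kdiv_hom b d y : pgr d.+1 y -> pgr d (kdiv b y).
Proof.
move=> H; apply: (@alenZ _ _ (fun n => n = d)).
rewrite (degscale_hom _ (partial_hom _ H)); apply: (@alenZ _ _ (fun n => n = d)); exact: partial_hom.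
Qed.

Lemma kdiv_hom0 b y : pgr 0 y -> kdiv b y = 0.
Proof. by move=> H; rewrite /kdiv (partial_hom0 _ H) (lin0 (degscale_lin _)) scaler0. Qed.

End Deriv.

(** * Traces of linear endomorphisms of A *)

Section Trace.
Variables (k : fieldType) (Q : quiver).
Local Notation A := (preproj k Q).
Local Notation T := (pathalg k (Defs.double Q)).
Local Notation arrs := (arr (Defs.double Q)).
Local Notation E := (@pidem k Q).
Local Notation ar := (@ar k Q).
Local Notation sgn := (@sgn k Q).
Local Notation path := (qpath (Defs.double Q)).
Local Notation mon p := (ppi (pelt k (p : path)) : A).

Fixpoint words (n : nat) : seq (seq arrs) :=
  if n is n'.+1 then [::] :: [seq b :: w | b <- enum arrs, w <- words n'] else [::].
Lemma mem_words n w : (w \in words n) = (size w < n)%N.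
Proof.
elim: n w => [//|n IH] [|b w] //=; rewrite in_cons /= ltnS -IH.
apply/allpairsP/idP => [[[b' w'] /= [_ H [_ ->]]] //|H].
by exists (b, w); rewrite mem_enum.
Qed.

Definition paths (R : nat) : seq path :=
  undup (pmap insub [seq (v, w) | v <- enum (vert (Defs.double Q)), w <- words R]).
Lemma mem_paths R p : (p \in paths R) = (plen p < R)%N.
Proof.
rewrite mem_undup (mem_pmap_sub (sT := path)) -mem_words /plen /pword.
case: p => [[v w] H] /=; apply/allpairsP/idP => [[[v' w'] /= [_ H' [_ ->]]] //|H'].
by exists (v, w); rewrite mem_enum.
Qed.

Variable sect : A -> T.
Hypothesis sect_lin : lin sect.
Hypothesis sectK : forall x, ppi (sect x) = x.
Hypothesis sect_tlen : forall d x, pgr d x -> tlen (fun n => n = d) (sect x).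

Lemma sect_tlenge r x : pge r x -> tlen (fun m => (r <= m)%N) (sect x).
Proof.
rewrite pgeE; apply: (@alen_ind _ _ _ (fun x => tlen (fun m => (r <= m)%N) (sect x))) => [|a f g IH IH'|p Sp].
- by rewrite (lin0 sect_lin); apply: tlen0.
- by rewrite sect_lin; apply: tlen_lin.
by move=> q /(sect_tlen (pgr_mon k p)) ->.
Qed.

Definition path_coef (p : path) (y : T) : k^o := mcoeff p y.
Lemma path_coef_lin p : lin (path_coef p).
Proof. by move=> c x y; rewrite /path_coef mcoeffD mcoeffZ. Qed.

Lemma path_coef_u p q : path_coef p (pelt k q) = (q == p)%:R.
Proof. exact: (@pelt_coef k (Defs.double Q) q p). Qed.

Definition coord (p : path) (y : A) : k^o := path_coef p (sect y).
Lemma coord_lin p : lin (coord p).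
Proof. exact: lin_comp (path_coef_lin p) sect_lin. Qed.

Lemma coord_pge p r y : (plen p < r)%N -> pge r y -> coord p y = 0.
Proof.
by move=> lt /sect_tlenge H; apply/eqP; apply: contraT => /H; rewrite leqNgt lt.
Qed.

Lemma coord_pgrz p j y : pgrz j y -> j != (plen p)%:Z -> coord p y = 0.
Proof.
case: j => d /=; last by move=> -> _; rewrite (lin0 (coord_lin p)).
by move=> /sect_tlen H ne; apply/eqP; apply: contraT => /H e; rewrite e eqxx in ne.
Qed.

(** The images of the paths span A and the coordinates of the section pick one
expansion in them.  These paths need not be independent, but a spanning family
with dual coordinates is enough to define traces. *)
Lemma frame (W : lmodType k) (L : A -> W) R y : lin L ->
  (forall x, pge R x -> L x = 0) ->
  L y = \sum_(p <- paths R) (coord p y : k) *: L (mon p).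
Proof.
move=> lL L0; rewrite -{1}(sectK y) /coord; elim/pa_ind: (sect y) => [|c f g IH IH'|q].
- by rewrite linear0 (lin0 lL) big1 // => p _; rewrite (lin0 (path_coef_lin p)) scale0r.
- rewrite linearP /= lL IH IH' scaler_sumr -big_split /=; apply: eq_bigr => p _.
  by rewrite path_coef_lin scalerDl scalerA.
have [lt|ge] := ltnP (plen q) R.
  rewrite (bigD1_seq q) ?mem_paths ?undup_uniq //= big1 ?addr0 => [|p np].
    by rewrite path_coef_u eqxx scale1r.
  by rewrite path_coef_u eq_sym (negPf np) scale0r.
rewrite L0; last exact: (@alen_pelt _ _ (fun n => (R <= n)%N)).
rewrite big_seq big1 // => p; rewrite mem_paths => lt.
rewrite path_coef_u; case: eqP => [e|_]; last by rewrite scale0r.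
by rewrite -e ltnNge ge in lt.
Qed.

(** The degrees from R on are cut off: the maps whose traces are taken vanish
there. *)
Definition trace (R : nat) (psi : A -> A) : k := \sum_(p <- paths R) coord p (psi (mon p)).

Lemma trace_ext R psi psi' : psi =1 psi' -> trace R psi = trace R psi'.
Proof. by move=> e; apply: eq_bigr => p _; rewrite e. Qed.

(** Expand both composites in the frame.  The maps need not be homogeneous; the
hypotheses make the two truncated double sums range over the same pairs. *)
Lemma trace_cyc R psi chi : lin psi -> lin chi ->
  (forall x, pge R x -> psi x = 0) -> (forall x, pge R x -> pge R (chi x)) ->
  trace R (fun m => psi (chi m)) = trace R (fun m => chi (psi m)).
Proof.
move=> lp lc p0 cR.
transitivity (\sum_(p <- paths R) \sum_(q <- paths R)
   (coord q (chi (mon p)) : k) * coord p (psi (mon q))).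
  apply: eq_bigr => p _; apply: (@frame k^o (fun y => coord p (psi y))).
    exact: lin_comp (coord_lin p) lp.
  by move=> x /p0 ->; rewrite (lin0 (coord_lin p)).
rewrite exchange_big /= [RHS]big_seq [LHS]big_seq; apply: eq_bigr => q.
rewrite mem_paths => ltq; symmetry.
rewrite [LHS](@frame k^o (fun y => coord q (chi y)) R).
- by apply: eq_bigr => p _; rewrite [_ *: _]mulrC.
- exact: lin_comp (coord_lin q) lc.
by move=> x /cR; apply: coord_pge.
Qed.

Lemma trace_indep r R psi : (forall x, pge r x -> psi x = 0) -> (r <= R)%N ->
  trace R psi = trace r psi.
Proof.
move=> p0 le; rewrite /trace (bigID (fun p => (plen p < r)%N)) /= [X in _ + X]big1 ?addr0; last first.
  move=> p; rewrite -leqNgt => ge; rewrite p0 ?(lin0 (coord_lin p)) //.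
  exact: (@alen_pelt _ _ (fun n => (r <= n)%N)).
rewrite -big_filter; apply: perm_big; apply: uniq_perm.
- by rewrite filter_uniq // undup_uniq.
- exact: undup_uniq.
move=> p; rewrite mem_filter !mem_paths andb_idr // => lt; exact: leq_trans lt le.
Qed.

Lemma trace_add R psi psi' : trace R (fun m => psi m + psi' m) = trace R psi + trace R psi'.
Proof. by rewrite -big_split; apply: eq_bigr => p _; rewrite (linD (coord_lin p)). Qed.

Lemma trace_scale R c psi : trace R (fun m => c *: psi m) = c * trace R psi.
Proof. by rewrite mulr_sumr; apply: eq_bigr => p _; rewrite (linZ (coord_lin p)). Qed.

Lemma trace_sum R I (s : seq I) (F : I -> A -> A) :
  trace R (fun m => \sum_(i <- s) F i m) = \sum_(i <- s) trace R (F i).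
Proof.
rewrite /trace exchange_big /=; apply: eq_bigr => p _.
by rewrite (lin_sum (coord_lin p)).
Qed.

(** The second differential of the complex that computes Ext_A(A/A_{>= r}, A) from
the Koszul resolution. *)
Definition koszul_d (phi : A -> arrs -> A) (m : A) : A :=
  \sum_b sgn b *: (phi (m * ar b) (inva b) + phi m b * ar (inva b)).

(** By cyclicity phi_b' o R_b has the same trace as R_b o phi_b', where R_b is right
multiplication by b.  Exchanging b and b' changes the sign, and the two halves
of the sum cancel. *)
Lemma trace_koszul_d R phi : (forall b, lin (phi^~ b)) -> (forall b x, pge R x -> phi x b = 0) ->
  trace R (koszul_d phi) = 0.
Proof.
move=> lp p0; rewrite /koszul_d trace_sum.
transitivity (\sum_b sgn b * trace R (fun m => phi m (inva b) * ar b) +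
              \sum_b sgn b * trace R (fun m => phi m b * ar (inva b))).
  rewrite -big_split; apply: eq_bigr => b _; rewrite trace_scale trace_add mulrDr; congr (_ * _ + _).
  apply: (@trace_cyc R (phi^~ (inva b)) (fun m => m * ar b)).
  - exact: lp.
  - by apply: lin_mulr; apply: lin_id.
  - by move=> x; apply: p0.
  - by move=> x Hx; apply: pgeMr.
rewrite (reindex_inj (@inva_inj Q)) /= -big_split big1 //= => b _.
by rewrite invaK sgn_inva mulNr addNr.
Qed.

Definition vanish (r : nat) (f : A -> A -> A -> A) := forall x a b, pge r x -> f x a b = 0.
(** The chosen cut-off does not matter, by thetaE. *)
Definition radius (f : A -> A -> A -> A) : nat :=
  if pselect (exists r, vanish r f) is left e then projT1 (cid e) else 0%N.
(** The restriction of a bar cochain to the second term of the Koszul resolution. *)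
Definition on_rel (f : A -> A -> A -> A) (m : A) : A :=
  \sum_b sgn b *: f m (ar b) (ar (inva b)).
Definition theta (f : A -> A -> A -> A) (x : A) : k :=
  trace (radius f) (fun m => on_rel f (x * m)).

Lemma on_rel0 r f m : vanish r f -> pge r m -> on_rel f m = 0.
Proof. by move=> v H; rewrite /on_rel big1 // => b _; rewrite v // scaler0. Qed.

Lemma thetaE r f x : vanish r f -> theta f x = trace r (fun m => on_rel f (x * m)).
Proof.
move=> v; rewrite /theta /radius; case: pselect => [e|ne]; last by case: ne; exists r.
case: (cid e) => r' /= v'.
have H s : vanish s f -> forall m, pge s m -> on_rel f (x * m) = 0.
  by move=> vs m Hm; apply: (on_rel0 vs); apply: pgeMl.
by rewrite -(trace_indep (H _ v) (leq_maxl r r')) (trace_indep (H _ v') (leq_maxr r r')).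
Qed.

End Trace.

(** * Recursion along paths *)

Section PathRec.
Variables (k : fieldType) (Q : quiver).
Local Notation A := (preproj k Q).
Local Notation T := (pathalg k (Defs.double Q)).
Local Notation arrs := (arr (Defs.double Q)).
Local Notation E := (@pidem k Q).
Local Notation ar := (@ar k Q).
Local Notation sgn := (@sgn k Q).
Local Notation wprod := (@wprod k Q).
Local Notation rel := (preproj_rel k Q).

Variable B : A -> arrs -> A -> A.
Hypothesis Bx : forall b y, lin (fun x => B x b y).
Hypothesis By : forall x b, lin (B x b).
Hypothesis BE1 : forall x (b : arrs) y, B (x * E (src b)) b y = B x b y.
Hypothesis BE2 : forall x (b : arrs) y, B x b (E (tgt b) * y) = B x b y.

(** The extension of a map B defined on arrows to words: for a derivation-like rule
the value on a word is the sum, over its letters b, of B evaluated at the part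
before b, at b, and at the part after b. *)
Fixpoint pathrecw (x : A) (w : seq arrs) : A :=
  if w is b :: w' then pathrecw (x * ar b) w' + B x b (wprod w') else 0.

Lemma pathrecw_lin w : lin (pathrecw^~ w).
Proof.
elim: w => [|b w IH] /=; first exact: lin_zero.
apply: lin_add; last exact: Bx.
by apply: (lin_comp IH); apply: lin_mulr; apply: lin_id.
Qed.

Lemma pathrecw0 w : pathrecw 0 w = 0. Proof. exact: (lin0 (pathrecw_lin w)). Qed.

Lemma pathrecw_src (u v : vert (Defs.double Q)) x w : walk v w -> u != v -> pathrecw (x * E u) w = 0.
Proof.
case: w => [//|b w] /andP[/eqP sb _] ne; rewrite [pathrecw _ _]/=.
rewrite -mulrA idem_ar sb (negPf ne) mulr0 pathrecw0 add0r -BE1 -mulrA idemM sb (negPf ne) mulr0.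
exact: (lin0 (Bx _ _)).
Qed.

Definition pathrec (x : A) : T -> A := locked (lext (fun p => pathrecw x (pword p))).
Lemma pathrec_linr x : lin (pathrec x). Proof. by rewrite /pathrec -lock; exact: lin_linear. Qed.

Lemma pathrec_pelt x p : pathrec x (pelt k p) = pathrecw x (pword p).
Proof. by rewrite /pathrec -lock lextE. Qed.

Lemma pathrec_linl y : lin (pathrec^~ y).
Proof.
elim/pa_ind: y => [|a f g IH IH'|p].
- by move=> c x y; rewrite !(lin0 (pathrec_linr _)) scaler0 addr0.
- apply: (@lin_ext _ _ _ _ (fun x => a *: pathrec x f + pathrec x g)) => [x|]; first by rewrite pathrec_linr.
  by apply: lin_add; first apply: lin_scale.
- by move=> c x y; rewrite !pathrec_pelt pathrecw_lin.
Qed.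

Lemma pathrec_triv x (v : vert (Defs.double Q)) : pathrec x (pelt k (ptriv v)) = 0.
Proof. by rewrite pathrec_pelt. Qed.

Lemma pathrec_cons x b y : pathrec x (darr k b * y) = pathrec (x * ar b) y + B x b (ppi y).
Proof.
elim/pa_ind: y => [|a f g IH IH'|p].
- by rewrite mulr0 !(lin0 (pathrec_linr _)) linear0 (lin0 (By _ _)) addr0.
- by rewrite mulrDr -scalerAr pathrec_linr IH IH' [in RHS]pathrec_linr linearP By scalerDr addrACA.
rewrite /darr pelt_mul /pbmul -[pend (parr b)]/(tgt b).
case: (eqVneq (tgt b) (pstart p)) => [e|ne].
  by rewrite !pathrec_pelt pword_pcat //= ppi_pelt -e BE2.
rewrite (lin0 (pathrec_linr _)) pathrec_pelt -ar_idem_tgt mulrA (@pathrecw_src _ (pstart p)) ?(valP p) //.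
rewrite ppi_pelt -BE2 mulrA idemM (negPf ne) mul0r (lin0 (By _ _)) addr0.
by [].
Qed.

Lemma pathrec_E x (v : vert (Defs.double Q)) y : pathrec x (pelt k (ptriv v) * y) = pathrec (x * E v) y.
Proof.
elim/pa_ind_left: y => [a f g IH IH'|u|b y _].
- by rewrite mulrDr -scalerAr !pathrec_linr IH IH'.
- rewrite pathrec_triv pelt_mul /pbmul; case: eqP => [e|_]; last by rewrite (lin0 (pathrec_linr _)).
  have {e} -> : v = u := e.
  by rewrite [pcat _ _](pcat1p (ptriv u)) pathrec_triv.
rewrite triv_darr pathrec_cons -mulrA idem_ar; case: eqP => [->|ne].
  by rewrite BE1 pathrec_cons.
rewrite mulr0 (lin0 (pathrec_linr _)) (lin0 (pathrec_linl _)) add0r -BE1 -mulrA idemM.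
by rewrite ifN ?mulr0 ?(lin0 (Bx _ _)) //; apply/eqP.
Qed.

Lemma pathrec_mull x u z : ppi z = 0 :> A -> pathrec x (u * z) = pathrec (x * ppi u) z.
Proof.
move=> z0; elim/pa_ind_left: u x => [a f g IH IH'|v|b u IH] x.
- by rewrite mulrDl -scalerAl pathrec_linr IH IH' linearP mulrDr -scalerAr pathrec_linl.
- by rewrite pathrec_E.
by rewrite -mulrA pathrec_cons IH !ppi_mul z0 mulr0 (lin0 (By _ _)) addr0 mulrA.
Qed.

Variable chi : A -> A.
Hypothesis Bchi : forall x w,
  \sum_b sgn b *: (B (x * ar b) (inva b) w + B x b (ar (inva b) * w)) = chi x * w.

Lemma pathrec_rel x y : pathrec x (rel * y) = chi x * ppi y.
Proof.
have Hb b : pathrec x (sgn b *: (darr k b * darr k (inva b)) * y) =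
    sgn b *: pathrec (x * (ar b * ar (inva b))) y +
    sgn b *: (B (x * ar b) (inva b) (ppi y) + B x b (ar (inva b) * ppi y)).
  rewrite -scalerAl -mulrA [LHS](linZ (pathrec_linr x)) !pathrec_cons ppi_mul mulrA -addrA.
  exact: scalerDr.
rewrite rel_sum mulr_suml (lin_sum (pathrec_linr x)) (eq_bigr _ (fun b _ => Hb b)).
rewrite big_split -Bchi -[RHS]add0r; apply: (f_equal2 (fun x y : A => x + y)); last by [].
transitivity (pathrec (x * \sum_b sgn b *: (ar b * ar (inva b))) y); last first.
  by rewrite ar_rel mulr0 (lin0 (pathrec_linl y)).
rewrite mulr_sumr (lin_sum (pathrec_linl y)); apply: eq_bigr => b _.
by rewrite -scalerAr (linZ (pathrec_linl y)).
Qed.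

(** If B is a null-homotopy of multiplication by chi over the relation, then the
recursion takes a prescribed value on the ideal.  With chi = 0 it descends to A,
which is how cocycles are shown to be coboundaries; with chi = psi its failure to
descend measures psi, which is how cocycles are built. *)
Lemma pathrec_rel2 x u y : pathrec x (u * rel * y) = chi (x * ppi u) * ppi y.
Proof.
rewrite -mulrA pathrec_mull ?pathrec_rel //.
by rewrite -[rel]mul1r ppi_rel.
Qed.

Lemma pathrec_mulr x z u : preproj_ideal z -> pathrec x (z * u) = pathrec x z * ppi u.
Proof.
move=> [s ->]; rewrite mulr_suml !(lin_sum (pathrec_linr x)) mulr_suml.
by apply: eq_bigr => t _; rewrite -[X in pathrec x X]mulrA !pathrec_rel2 ppi_mul mulrA.
Qed.

Variable l : int.
Hypothesis Bhom : forall i j x b y, pgr i x -> pgr j y -> pgrz (i.+1%:Z + j%:Z + l) (B x b y).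

Lemma pathrec_hom i n x y : pgr i x -> tlen (fun m => m = n) y -> pgrz (i%:Z + n%:Z + l) (pathrec x y).
Proof.
move=> Hx; apply: (@tlen_ind _ _ _ (fun y => pgrz (i%:Z + n%:Z + l) (pathrec x y))) => [|a f g IH IH'|p <-].
- by rewrite (lin0 (pathrec_linr x)); apply: pgrz0.
- by rewrite pathrec_linr; apply: pgrz_lin.
rewrite pathrec_pelt /plen; elim: (pword p) i x Hx => [|b w IH] i x Hx /=; first exact: pgrz0.
have e : i%:Z + (size w).+1%:Z + l = i.+1%:Z + (size w)%:Z + l.
  by rewrite -addn1 -[i.+1]addn1 !PoszD [_ + 1]addrC addrA.
rewrite e; apply: pgrzD; last by apply: Bhom => //; apply: pgr_wprod.
by apply: IH; rewrite -addn1; apply: pgrM => //; apply: pgr_ar.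
Qed.

Lemma pathrec_vanish r x y : (forall x b y, pge r x -> B x b y = 0) -> pge r x -> pathrec x y = 0.
Proof.
move=> B0 Hx; elim/pa_ind: y => [|a f g IH IH'|p].
- by rewrite (lin0 (pathrec_linr x)).
- by rewrite pathrec_linr IH IH' scaler0 addr0.
rewrite pathrec_pelt; elim: (pword p) x Hx => [//|b w IH] x Hx /=.
by rewrite IH ?B0 ?addr0 //; apply: pgeMr.
Qed.

End PathRec.

(** * Homogeneous cochains *)

Section Cochains.
Variables (k : fieldType) (Q : quiver).
Local Notation A := (preproj k Q).
Local Notation T := (pathalg k (Defs.double Q)).
Local Notation arrs := (arr (Defs.double Q)).
Local Notation E := (@pidem k Q).
Local Notation ar := (@ar k Q).
Local Notation sgn := (@sgn k Q).

Definition d1 (h : A -> A -> A) (x a b : A) : A :=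
  h (x * a) b - h x (a * b) + h x a * b.
Definition d2 (f : A -> A -> A -> A) (x a b c : A) : A :=
  f (x * a) b c - f x (a * b) c + f x a (b * c) - f x a b * c.

Definition homc1 (r : nat) (l : int) (h : A -> A -> A) : Prop :=
  [/\ forall a, lin (h^~ a), forall x, lin (h x),
      forall x a, pge r x -> h x a = 0
    & forall i j x a, pgr i x -> pgr j a -> pgrz (i%:Z + j%:Z + l) (h x a)].
Definition homc2 (r : nat) (l : int) (f : A -> A -> A -> A) : Prop :=
  [/\ forall a b, lin (fun x => f x a b), forall x b, lin (fun a => f x a b),
      forall x a, lin (f x a), forall x a b, pge r x -> f x a b = 0
    & forall i j m x a b, pgr i x -> pgr j a -> pgr m b ->
        pgrz (i%:Z + j%:Z + m%:Z + l) (f x a b)].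

Lemma homc1_add r l h h' : homc1 r l h -> homc1 r l h' -> homc1 r l (fun x a => h x a + h' x a).
Proof.
move=> [H1 H2 H3 H4] [H1' H2' H3' H4']; split.
- by move=> a; apply: lin_add.
- by move=> x; apply: lin_add.
- by move=> x a Hx; rewrite H3 // H3' // addr0.
- by move=> i j x a Hx Ha; apply: pgrzD; [apply: H4 | apply: H4'].
Qed.

Lemma homc1_opp r l h : homc1 r l h -> homc1 r l (fun x a => - h x a).
Proof.
move=> [H1 H2 H3 H4]; split.
- by move=> a; apply: lin_opp.
- by move=> x; apply: lin_opp.
- by move=> x a Hx; rewrite H3 // oppr0.
- by move=> i j x a Hx Ha; apply: pgrzN; apply: H4.
Qed.

Lemma homc2_add r l f f' : homc2 r l f -> homc2 r l f' -> homc2 r l (fun x a b => f x a b + f' x a b).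
Proof.
move=> [H1 H2 H3 H4 H5] [H1' H2' H3' H4' H5']; split.
- by move=> a b; apply: lin_add.
- by move=> x b; apply: lin_add.
- by move=> x a; apply: lin_add.
- by move=> x a b Hx; rewrite H4 // H4' // addr0.
- by move=> i j m x a b Hx Ha Hb; apply: pgrzD; [apply: H5 | apply: H5'].
Qed.

Lemma homc2_opp r l f : homc2 r l f -> homc2 r l (fun x a b => - f x a b).
Proof.
move=> [H1 H2 H3 H4 H5]; split.
- by move=> a b; apply: lin_opp.
- by move=> x b; apply: lin_opp.
- by move=> x a; apply: lin_opp.
- by move=> x a b Hx; rewrite H4 // oppr0.
- by move=> i j m x a b Hx Ha Hb; apply: pgrzN; apply: H5.
Qed.

Lemma homc2_d1 r l h : homc1 r l h -> homc2 r l (d1 h).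
Proof.
move=> [H1 H2 H3 H4]; rewrite /d1; split.
- move=> a b; apply: lin_add; [apply: lin_add|].
  + by apply: (lin_comp (H1 b)); apply: lin_mulr; apply: lin_id.
  + by apply: lin_opp.
  + by apply: lin_mulr.
- move=> x b; apply: lin_add; [apply: lin_add|].
  + by apply: (lin_comp (H1 b)); apply: lin_mull; apply: lin_id.
  + by apply: lin_opp; apply: (lin_comp (H2 x)); apply: lin_mulr; apply: lin_id.
  + by apply: lin_mulr.
- move=> x a; apply: lin_add; [apply: lin_add|].
  + exact: H2.
  + by apply: lin_opp; apply: (lin_comp (H2 x)); apply: lin_mull; apply: lin_id.
  + by apply: lin_mull; apply: lin_id.
- by move=> x a b Hx; rewrite !H3 ?mul0r ?subr0 ?addr0 //; apply: pgeMr.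
- move=> i j m x a b Hx Ha Hb; apply: pgrzD; [apply: pgrzB|].
  + by rewrite -PoszD; apply: H4 => //; apply: pgrM.
  + by rewrite -[i%:Z + j%:Z + m%:Z]addrA -PoszD; apply: H4 => //; apply: pgrM.
  + by rewrite addrAC; apply: pgrzMr => //; apply: H4.
Qed.

Lemma d2_add f f' x a b c : d2 (fun x a b => f x a b + f' x a b) x a b c =
  d2 f x a b c + d2 f' x a b c.
Proof.
have gen (V : zmodType) (p p' q q' s s' t t' : V) :
    (p + p') - (q + q') + (s + s') - (t + t') = (p - q + s - t) + (p' - q' + s' - t').
  by rewrite !opprD !addrA [LHS](AC 8 ((1*3*5*7)*(2*4*6*8))) /= !addrA.
by rewrite /d2 mulrDl gen.
Qed.

Lemma d2_opp f x a b c : d2 (fun x a b => - f x a b) x a b c = - d2 f x a b c.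
Proof. by rewrite /d2 mulNr !opprD !opprK. Qed.

Lemma d2_d1 r l h x a b c : homc1 r l h -> d2 (d1 h) x a b c = 0.
Proof.
move=> _; have gen (V : zmodType) (p q s t u v : V) :
    p - q + s - (p - t + u) + (q - t + v) - (s - u + v) = 0.
  rewrite !opprD !opprK !addrA.
  rewrite [LHS](AC 12 ((1*4)*(2*7)*(3*10)*(5*8)*(6*11)*(9*12))) /=.
  by rewrite !subrr !addNr !addr0.
by rewrite /d2 /d1 !mulrDl mulNr !mulrA gen.
Qed.

End Cochains.

(** * Normalisation of cocycles at the idempotents *)

Section Normalise.
Variables (k : fieldType) (Q : quiver).
Local Notation A := (preproj k Q).
Local Notation E := (@pidem k Q).

Lemma d1_add (h h' : A -> A -> A) x a b :
  d1 (fun x a => h x a + h' x a) x a b = d1 h x a b + d1 h' x a b.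
Proof.
have gen (V : zmodType) (p p' q q' s s' : V) :
    (p + p') - (q + q') + (s + s') = (p - q + s) + (p' - q' + s').
  by rewrite !opprD !addrA [LHS](AC 6 ((1*3*5)*(2*4*6))) /= !addrA.
by rewrite /d1 mulrDl gen.
Qed.

Lemma d1_opp (h : A -> A -> A) x a b : d1 (fun x a => - h x a) x a b = - d1 h x a b.
Proof. by rewrite /d1 mulNr !opprD !opprK. Qed.

Definition normalised (f : A -> A -> A -> A) : Prop :=
  (forall x v b, f x (E v) b = 0) /\ (forall x a v, f x a (E v) = 0).

Lemma sum_mul_idem (F : A -> A) a : lin F -> \sum_v F (a * E v) = F a.
Proof. by move=> lF; rewrite -(lin_sum lF) -mulr_sumr idem_sum mulr1. Qed.

Lemma sum_idem_l (F : 'I_(nv Q).+1 -> A -> A) w : (forall v, F v 0 = 0) ->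
  \sum_v F v (E v * E w) = F w (E w).
Proof.
move=> F0; rewrite (@sum_only _ _ w) ?idemM ?eqxx // => v nv.
by rewrite idemM (negPf nv).
Qed.

Lemma sum_idem_r (F : 'I_(nv Q).+1 -> A -> A) w : (forall v, F v 0 = 0) ->
  \sum_v F v (E w * E v) = F w (E w).
Proof.
move=> F0; rewrite (@sum_only _ _ w) ?idemM ?eqxx // => v nv.
by rewrite idemM eq_sym (negPf nv).
Qed.

(** The idempotents span a separable subalgebra, and h inserts its separability
idempotent, the sum of the e_v (x) e_v, in the first two slots.  The claim is the
cocycle identity at (x e_v, e_v, e_w, b), summed over v. *)
Lemma normalise_left r l f : homc2 r l f -> (forall x a b c, d2 f x a b c = 0) ->
  exists2 h, homc1 r l h & forall x v b, f x (E v) b = d1 h x (E v) b.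
Proof.
move=> [H1 H2 H3 H4 H5] cf.
exists (fun x a => \sum_v f (x * E v) (E v) a).
  split.
  - move=> a; apply: lin_bigsum => v; apply: (lin_comp (H1 _ _)).
    by apply: lin_mulr; apply: lin_id.
  - by move=> x; apply: lin_bigsum => v; apply: H3.
  - by move=> x a Hx; apply: big1 => v _; apply: H4; apply: pgeMr.
  - move=> i j x a Hx Ha; apply: pgrz_sum => v _.
    have := H5 i 0%N j (x * E v) (E v) a; rewrite addr0; apply => //; last exact: pgr_E.
    by rewrite -[i]addn0; apply: pgrM => //; apply: pgr_E.
move=> x w b; rewrite /d1.
have H : \sum_v d2 f (x * E v) (E v) (E w) b = 0 by apply: big1 => v _.
move: H; rewrite /d2 !sumrB big_split sumrB /=.
have -> : \sum_v f (x * E v * E v) (E w) b = f x (E w) b.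
  rewrite -[RHS](sum_mul_idem (F := fun x => f x (E w) b)); last exact: H1.
  by apply: eq_bigr => v _; rewrite -mulrA idemM eqxx.
have -> : \sum_v f (x * E v) (E v * E w) b = f (x * E w) (E w) b.
  by apply: (@sum_idem_l (fun v y => f (x * E v) y b)) => v; rewrite (lin0 (H2 _ _)).
rewrite -mulr_suml.
have -> : \sum_v f (x * E w * E v) (E v) b = f (x * E w) (E w) b.
  transitivity (\sum_v f (x * (E w * E v)) (E v) b); first by apply: eq_bigr => v _; rewrite mulrA.
  rewrite (@sum_idem_r (fun v y => f (x * y) (E v) b)) // => v.
  by rewrite mulr0 (lin0 (H1 _ _)).
move=> /eqP; rewrite subr_eq0 => /eqP <-.
by rewrite !addrA [RHS](AC 5 ((1*4)*(2*5)*3)) /= subrr addNr !add0r.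
Qed.

Section Bal.
Variables (f : A -> A -> A -> A).
Hypothesis cf : forall x a b c, d2 f x a b c = 0.
Hypothesis uf : forall x v b, f x (E v) b = 0.
Lemma idem_shift12 x v a b : f (x * E v) a b = f x (E v * a) b.
Proof.
by have /eqP := cf x (E v) a b; rewrite /d2 !uf mul0r subr0 addr0 subr_eq0 => /eqP.
Qed.

Hypothesis uf' : forall x a v, f x a (E v) = 0.
Lemma idem_shift23 x a v b : f x (a * E v) b = f x a (E v * b).
Proof.
have := cf x a (E v) b; rewrite /d2 !uf !uf' mul0r subr0 sub0r addrC => /eqP.
by rewrite subr_eq0 => /eqP.
Qed.

Lemma idem_shift_out x a b v : f x a (b * E v) = f x a b * E v.
Proof.
have := cf x a b (E v); rewrite /d2 !uf' subrr add0r => /eqP.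
by rewrite subr_eq0 => /eqP.
Qed.

End Bal.

(** The same device in the last two slots; now the cocycle identity is used at
(x, a e_w, e_w, e_u). *)
Lemma normalise_right r l f : homc2 r l f -> (forall x a b c, d2 f x a b c = 0) ->
  (forall x v b, f x (E v) b = 0) ->
  exists2 h, homc1 r l h & normalised (fun x a b => f x a b + d1 h x a b).
Proof.
move=> [H1 H2 H3 H4 H5] cf uf.
exists (fun x a => \sum_v f x (a * E v) (E v)).
  split.
  - by move=> a; apply: lin_bigsum => v; apply: H1.
  - move=> x; apply: lin_bigsum => v; apply: (lin_comp (H2 _ _)).
    by apply: lin_mulr; apply: lin_id.
  - by move=> x a Hx; apply: big1 => v _; apply: H4.
  - move=> i j x a Hx Ha; apply: pgrz_sum => v _.
    have := H5 i j 0%N x (a * E v) (E v); rewrite addr0; apply => //; last exact: pgr_E.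
    by rewrite -[j]addn0; apply: pgrM => //; apply: pgr_E.
have hE x u : \sum_v f x (E u * E v) (E v) = 0.
  rewrite (@sum_idem_r (fun v y => f x y (E v))) ?uf // => v.
  exact: (lin0 (H2 _ _)).
split=> [x u b|x a u]; rewrite /d1.
  rewrite uf hE mul0r addr0 add0r; apply/eqP; rewrite subr_eq0; apply/eqP.
  by apply: eq_bigr => v _; rewrite (idem_shift12 cf uf) mulrA.
rewrite hE sub0r.
have -> : \sum_v f x (a * E u * E v) (E v) = f x (a * E u) (E u).
  transitivity (\sum_v f x (a * (E u * E v)) (E v)); first by apply: eq_bigr => v _; rewrite mulrA.
  rewrite (@sum_idem_r (fun v y => f x (a * y) (E v))) // => v.
  by rewrite mulr0 (lin0 (H2 _ _)).
have H : \sum_w d2 f x (a * E w) (E w) (E u) = 0 by apply: big1 => w _.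
move: H; rewrite /d2 !sumrB big_split sumrB /=.
rewrite [X in X - _ + _ - _]big1 ?sub0r => [|w _]; last exact: uf.
have -> : \sum_w f x (a * E w * E w) (E u) = f x a (E u).
  rewrite -[RHS](sum_mul_idem (F := fun a => f x a (E u))); last exact: H2.
  by apply: eq_bigr => v _; rewrite -mulrA idemM eqxx.
have -> : \sum_w f x (a * E w) (E w * E u) = f x (a * E u) (E u).
  by apply: (@sum_idem_l (fun v y => f x (a * E v) y)) => v; rewrite (lin0 (H3 _ _)).
rewrite -mulr_suml => /eqP; rewrite subr_eq0 => /eqP <-.
by rewrite !addrA [LHS](AC 4 ((1*3)*(2*4))) /= subrr addNr addr0.
Qed.

Lemma normalise r l f : homc2 r l f -> (forall x a b c, d2 f x a b c = 0) ->
  exists2 h, homc1 r l h & normalised (fun x a b => f x a b + d1 h x a b).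
Proof.
move=> Hf cf; have [h0 Hh0 e0] := normalise_left Hf cf.
pose f1 x a b := f x a b - d1 h0 x a b.
have Hf1 : homc2 r l f1 by apply: homc2_add => //; apply: homc2_opp; apply: homc2_d1.
have cf1 x a b c : d2 f1 x a b c = 0.
  by rewrite /f1 d2_add d2_opp (d2_d1 _ _ _ _ Hh0) cf oppr0 addr0.
have uf1 x v b : f1 x (E v) b = 0 by rewrite /f1 e0 subrr.
have [h1 Hh1 [u1 u2]] := normalise_right Hf1 cf1 uf1.
exists (fun x a => - h0 x a + h1 x a).
  by apply: homc1_add => //; apply: homc1_opp.
by split=> *; rewrite d1_add d1_opp addrA; [apply: u1 | apply: u2].
Qed.

End Normalise.

(** * Injectivity of the trace form *)

Section Inject.
Variables (k : fieldType) (Q : quiver).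
Local Notation A := (preproj k Q).
Local Notation T := (pathalg k (Defs.double Q)).
Local Notation arrs := (arr (Defs.double Q)).
Local Notation E := (@pidem k Q).
Local Notation ar := (@ar k Q).
Local Notation sgn := (@sgn k Q).
Variable sect : A -> T.
Hypothesis sect_lin : lin sect.
Hypothesis sectK : forall x, ppi (sect x) = x.
Hypothesis sect_tlen : forall d x, pgr d x -> tlen (fun n => n = d) (sect x).
Local Notation theta := (theta sect).
Local Notation trace := (trace sect).

Definition chopw (c : arrs) (p : qpath (Defs.double Q)) : A :=
  if pword p is b :: w then
    if last b w == c then E (pstart p) * wprod k (belast b w) * E (src c) else 0
  else 0.
Definition chop (c : arrs) : T -> A := locked (lext (chopw c)).
Lemma chop_lin c : lin (chop c). Proof. by rewrite /chop -lock; exact: lin_linear. Qed.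

Lemma chop_pelt c p : chop c (pelt k p) = chopw c p. Proof. by rewrite /chop -lock lextE. Qed.

Lemma chop_sum (y : T) : ppi y = \sum_v (tcoef v (ppi y) : k) *: E v + \sum_c chop c y * ar c.
Proof.
have lL : lin (fun y : T => \sum_v (tcoef v (ppi y) : k) *: E v + \sum_c chop c y * ar c : A).
  apply: lin_add.
    by apply: lin_bigsum => v a f g; rewrite linearP tcoef_lin scalerDl scalerA.
  by apply: lin_bigsum => c; apply: lin_mulr; apply: chop_lin.
elim/pa_ind: y => [|a f g IH IH'|[[v w] H]].
- by rewrite (lin0 lL) linear0.
- by rewrite [RHS]lL [LHS]linearP; apply: (f_equal2 (fun x y : A => a *: x + y)).
case: w H => [|b w] H.
  rewrite [X in _ + X]big1 ?addr0 => [|c _]; last by rewrite chop_pelt mul0r.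
  by apply: tcoef_hom0; apply: (@alen_pelt _ _ (fun n => n = 0%N)).
rewrite big1 ?add0r => [|u _]; last first.
  by rewrite tcoef_pge ?scale0r //; apply: (@alen_pelt _ _ (fun n => (1 <= n)%N)).
rewrite (@sum_only _ _ (last b w)) => [|c nc]; last first.
  by rewrite chop_pelt /chopw /= eq_sym (negPf nc) mul0r.
rewrite chop_pelt /chopw /= eqxx -mulrA idem_ar_src ppi_pelt -mulrA; congr (_ * _).
by rewrite /pword /= lastI /wprod big_rcons /=.
Qed.

Lemma chop_hom c n y : tlen (fun m => m = n) y -> pgrz (n%:Z - 1) (chop c y).
Proof.
apply: (@tlen_ind _ _ _ (fun y => pgrz (n%:Z - 1) (chop c y))) => [|a f g IH IH'|[[v w] H] e].
- by rewrite (lin0 (chop_lin c)); apply: pgrz0.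
- by rewrite chop_lin; apply: pgrz_lin.
rewrite chop_pelt; case: w H e => [|b w] H e; first exact: pgrz0.
rewrite -[chopw c _]/(if last b w == c then E v * wprod k (belast b w) * E (src c) else 0).
case: eqP => _; last exact: pgrz0.
have -> : n%:Z - 1 = (0 + size (belast b w) + 0)%N by rewrite -e /plen /= size_belast addn0 -addn1 PoszD addrK.
apply: pgrM; last exact: pgr_E.
by apply: pgrM; [exact: pgr_E | exact: pgr_wprod].
Qed.

Lemma chop_E (c : arrs) y : chop c y * E (src c) = chop c y.
Proof.
elim/pa_ind: y => [|a f g IH IH'|p].
- by rewrite (lin0 (chop_lin c)) mul0r.
- by rewrite chop_lin mulrDl -scalerAl IH IH'.
rewrite chop_pelt /chopw; case: (pword p) => [|b w]; first by rewrite mul0r.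
by case: eqP; rewrite ?mul0r // -mulrA idemM eqxx.
Qed.

(** Right multiplication by the idempotent, which makes the quotient vanish on paths
that do not end at the target of c whatever the section does. *)
Definition rdiv (c : arrs) (y : A) : A := chop c (sect (y * E (tgt c))).
Lemma rdiv_lin c : lin (rdiv c).
Proof.
apply: (lin_comp (chop_lin c)); apply: (lin_comp sect_lin).
by apply: lin_mulr; apply: lin_id.
Qed.

Lemma rdiv_E1 (c : arrs) y : rdiv c (y * E (tgt c)) = rdiv c y.
Proof. by rewrite /rdiv -mulrA idemM eqxx. Qed.

Lemma rdiv_E2 (c : arrs) y : rdiv c y * E (src c) = rdiv c y.
Proof. exact: chop_E. Qed.

Lemma rdiv_sum y : y = \sum_v (tcoef v y : k) *: E v + \sum_c rdiv c y * ar c.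
Proof.
have Hv v : y * E v = (tcoef v y : k) *: E v +
    \sum_(c : arrs | tgt c == v) rdiv c y * ar c.
  have EvE : E v * E v = E v by rewrite idemM eqxx.
  rewrite -{1}EvE mulrA.
  rewrite -{1}[y * E v]sectK chop_sum sectK mulrDl !mulr_suml; congr (_ + _).
    rewrite (@sum_only _ _ v) => [|u nu].
      by rewrite -scalerAl idemM eqxx tcoefM tcoef_E eqxx mulr1.
    by rewrite -scalerAl idemM (negPf nu) scaler0.
  rewrite [RHS]big_mkcond; apply: eq_bigr => c _ /=.
  rewrite -mulrA ar_idem; case: eqP => [<-//|_]; by rewrite mulr0.
rewrite -{1}[y]mulr1 -idem_sum mulr_sumr (eq_bigr _ (fun v _ => Hv v)) big_split /=.
congr (_ + _); rewrite [RHS](partition_big (fun c : arrs => tgt c : vert Q) xpredT) //=.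
Qed.

Lemma rdiv_hom c j y : pgrz j y -> pgrz (j - 1) (rdiv c y).
Proof.
case: j => n; last by move=> ->; rewrite (lin0 (rdiv_lin c)); exact: (@pgrz0 k Q (Negz n - 1)).
move=> Hy; apply: chop_hom; apply: sect_tlen; rewrite -[n]addn0.
by apply: pgrM => //; apply: pgr_E.
Qed.

Lemma koszul_d_add (p q : A -> arrs -> A) x : koszul_d (fun x b => p x b + q x b) x = koszul_d p x + koszul_d q x.
Proof.
rewrite /koszul_d -big_split; apply: eq_bigr => b _ /=.
by rewrite mulrDl addrACA scalerDr.
Qed.

(** Modulo values in degree 0, every psi is a boundary.  Dividing psi x on the right
by the arrows gives phi1, and psi minus the boundary of phi1 is, up to degree 0,
a combination of the phi1 (x b), which vanishes one degree earlier in x than psi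
did. *)
Lemma koszul_d_solve (r : nat) (l : int) (psi : A -> A) : lin psi ->
  (forall x v, psi (x * E v) = psi x * E v) ->
  (forall x, pge r x -> psi x = 0) ->
  (forall i x, pgr i x -> pgrz (i%:Z + 2 + l) (psi x)) ->
  exists phi : A -> arrs -> A,
   [/\ forall b, lin (phi^~ b),
      forall b x, pge r x -> phi x b = 0,
      forall x (b : arrs), phi (x * E (src b)) b = phi x b,
      forall x (b : arrs), phi x b * E (tgt b) = phi x b &
      (forall i x b, pgr i x -> pgrz (i%:Z + 1 + l) (phi x b)) /\
      (forall x, pgr 0 (psi x - koszul_d phi x))].
Proof.
elim: r psi => [|r IH] psi lp pE p0 ph.
  exists (fun _ _ => 0); split=> //.
  - by move=> b; apply: lin_zero.
  - by move=> x b; rewrite mul0r.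
  split=> [i x b _|x]; first exact: pgrz0.
  rewrite p0 ?sub0r; last exact: pge0.
  rewrite /koszul_d big1 ?oppr0 => [|b _]; first exact: (@alen0 _ _ (fun n => n = 0%N)).
  by rewrite mul0r addr0 scaler0.
pose phi1 x b := sgn b *: rdiv (inva b) (psi x).
have l1 b : lin (phi1^~ b) by apply: lin_scale; apply: (lin_comp (rdiv_lin _)).
have z1 b x : pge r.+1 x -> phi1 x b = 0.
  by move=> Hx; rewrite /phi1 p0 // (lin0 (rdiv_lin _)) scaler0.
have E1 x (b : arrs) : phi1 (x * E (src b)) b = phi1 x b.
  by rewrite /phi1 pE -tgt_inva rdiv_E1.
have E2 x (b : arrs) : phi1 x b * E (tgt b) = phi1 x b.
  by rewrite /phi1 -scalerAl -src_inva rdiv_E2.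
have h1 i x b : pgr i x -> pgrz (i%:Z + 1 + l) (phi1 x b).
  move=> Hx; apply: pgrzZ.
  have -> : i%:Z + 1 + l = i%:Z + 2 + l - 1 by lia.
  by apply: rdiv_hom; apply: ph.
(* what is left of psi, up to degree 0, after dividing once by the arrows *)
pose psi' x := - \sum_b sgn b *: phi1 (x * ar b) (inva b).
have dec x : psi x - koszul_d phi1 x = \sum_v (tcoef v (psi x) : k) *: E v + psi' x.
  have -> : koszul_d phi1 x = \sum_b sgn b *: phi1 (x * ar b) (inva b) +
     \sum_c rdiv c (psi x) * ar c.
    rewrite [X in _ = _ + X](reindex_inj (@inva_inj Q)) /= -big_split.
    apply: eq_bigr => b _ /=; rewrite scalerDr; congr (_ + _).
    by rewrite {1}/phi1 -scalerAl scalerA sgn_sqr scale1r.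
  by rewrite {1}[psi x]rdiv_sum opprD addrA addrAC addrK.
have [|x v|x Hx|i x Hx|phi' [l' z' E1' E2' [h' s']]] := IH psi'.
- apply: lin_opp; apply: lin_bigsum => b; apply: lin_scale; apply: (lin_comp (l1 _)).
  by apply: lin_mulr; apply: lin_id.
- rewrite /psi' mulNr mulr_suml; congr (- _); apply: eq_bigr => b _.
  rewrite -scalerAl; congr (_ *: _); rewrite -mulrA idem_ar.
  rewrite -[phi1 (x * ar b) _]E2 tgt_inva -mulrA idemM eq_sym.
  by case: eqP => _; rewrite ?mulr0 ?(lin0 (l1 _)) // -tgt_inva E2.
- rewrite /psi' big1 ?oppr0 // => b _; rewrite z1 ?scaler0 // -addn1.
  by apply: pgeM => //; apply: pge_ar.
- apply: pgrzN; apply: pgrz_sum => b _; apply: pgrzZ.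
  have -> : i%:Z + 2 + l = (i + 1)%N%:Z + 1 + l by lia.
  by apply: h1; apply: pgrM => //; apply: pgr_ar.
exists (fun x b => phi1 x b + phi' x b); split.
- by move=> b; apply: lin_add.
- by move=> b x Hx; rewrite z1 ?z' ?addr0 //; apply: pge_leq Hx.
- by move=> x b; rewrite E1 E1'.
- by move=> x b; rewrite mulrDl E2 E2'.
split=> [i x b Hx|x]; first by apply: pgrzD; [apply: h1 | apply: h'].
rewrite koszul_d_add opprD addrA dec -addrA; apply: (@alenD _ _ (fun n => n = 0%N)); last exact: s'.
apply: (@alen_sum _ _ (fun n => n = 0%N)) => v _; apply: (@alenZ _ _ (fun n => n = 0%N)).
exact: pgr_E.
Qed.

Lemma coord_triv (v : vert (Defs.double Q)) y : coord sect (ptriv v) y = tcoef (v : vert Q) y.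
Proof. by rewrite -[in RHS](sectK y) tcoefE. Qed.

(** A map with values in the span of the idempotents is recovered from the traces of
its translates: precomposing with x e_w leaves the single term at the trivial
path of w. *)
Lemma trace_deg0 (R : nat) (psi : A -> A) : (0 < R)%N -> lin psi -> (forall x, pgr 0 (psi x)) ->
  (forall x v, psi (x * E v) = psi x * E v) ->
  (forall x, trace R (fun m => psi (x * m)) = 0) -> forall x, psi x = 0.
Proof.
move=> R0 lp p0 pE H x; rewrite (tcoef_hom0 (p0 x)) big1 // => w _.
have := H (x * E w).
rewrite /trace (@sum_only_seq _ _ _ (ptriv (w : vert (Defs.double Q)))) ?mem_paths ?undup_uniq //.
  rewrite coord_triv -[ppi _]/(E w) -mulrA idemM eqxx pE tcoefM tcoef_E eqxx mulr1 => ->.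
  by rewrite scale0r.
move=> p np; have [e|ne] := eqVneq (plen p) 0%N; last first.
  have ne' : 0%Z != (plen p)%:Z by rewrite eq_sym.
  by have /(_ _ (p0 _) ne') -> := @coord_pgrz _ _ _ sect_lin sect_tlen p 0%Z.
have pE' : p = ptriv (pstart p).
  by apply: qpath_inj => //; move: e; rewrite /plen; case: (pword p).
rewrite pE' -[ppi _]/(E (pstart p)) -mulrA idemM ifN ?mulr0.
  by rewrite (lin0 lp) (lin0 (coord_lin sect_lin _)).
by apply: contra_neq np => ew; rewrite pE' ew.
Qed.

(** The middle terms of d1 h vanish on the relation, and what is left is koszul_d. *)
Lemma theta_d1 r h f x : (forall a, lin (h^~ a)) -> (forall x, lin (h x)) ->
  (forall x a, pge r x -> h x a = 0) -> (forall x a b, f x a b = d1 h x a b) ->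
  theta f x = 0.
Proof.
move=> H1 H2 H3 e.
have vf : vanish r f.
  by move=> y a b Hy; rewrite e /d1 !H3 ?mul0r ?subr0 ?addr0 //; apply: pgeMr.
rewrite (thetaE sect_lin x vf).
rewrite (@trace_ext k Q sect r _ (koszul_d (fun m b => h (x * m) (ar b)))) => [|m].
  apply: trace_koszul_d => //.
    move=> b; apply: (lin_comp (H1 _)); apply: lin_mull; exact: lin_id.
  by move=> b y Hy; apply: H3; apply: pgeMl.
have mid : \sum_b sgn b *: h (x * m) (ar b * ar (inva b)) = 0.
  have := congr1 (h (x * m)) (ar_rel k Q).
  rewrite (lin0 (H2 _)) (lin_sum (H2 _)) => e0; rewrite -[RHS]e0.
  by apply: eq_bigr => b _; rewrite (linZ (H2 _)).
rewrite -[RHS]subr0 -[X in _ = _ - X]mid /on_rel /koszul_d -[RHS]sumrB; apply: eq_bigr => b _.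
rewrite e /d1 -scalerBr -mulrA; congr (_ *: _).
by rewrite addrAC mulrA.
Qed.

Lemma theta_add r f f' x : vanish r f -> vanish r f' ->
  theta (fun x a b => f x a b + f' x a b) x = theta f x + theta f' x.
Proof.
move=> v v'; have v2 : vanish r (fun x a b => f x a b + f' x a b).
  by move=> y a b Hy; rewrite v // v' // addr0.
rewrite (thetaE sect_lin x v) (thetaE sect_lin x v') (thetaE sect_lin x v2) -trace_add //.
apply: trace_ext => m; rewrite /on_rel -big_split; apply: eq_bigr => b _ /=.
by rewrite scalerDr.
Qed.

Lemma theta_ext f f' x : (forall x a b, f x a b = f' x a b) -> theta f x = theta f' x.
Proof.
move=> e; have -> // : f = f'.
by apply/funext => y; apply/funext => a; apply/funext => b.
Qed.

(** By koszul_d_solve and trace_deg0 the value of f on the relation is koszul_d phi.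
The potential h with d1 h = f is then forced by its values phi on the arrows:
h x (b a) = h (x b) a + phi x b * a - f x b a.  It is well defined on A since the
cocycle identity and the equation for phi make it vanish on the ideal. *)
Lemma inj_normalised r l f : homc2 r l f -> (forall x a b c, d2 f x a b c = 0) ->
  normalised f -> (forall x, theta f x = 0) ->
  exists2 h, homc1 r l h & forall x a b, f x a b = d1 h x a b.
Proof.
move=> [H1 H2 H3 H4 H5] cf [u1 u2] th0.
have b1 := idem_shift12 cf u1; have b2 := idem_shift23 cf u1 u2; have b3 := idem_shift_out cf u2.
have vf : vanish r f by move=> x a b; apply: H4.
have lev : lin (on_rel f) by apply: lin_bigsum => b; apply: lin_scale; apply: H1.
have evE x v : on_rel f (x * E v) = on_rel f x * E v.
  rewrite /on_rel mulr_suml; apply: eq_bigr => b _; rewrite -scalerAl; congr (_ *: _).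
  by rewrite b1 -b3 idem_ar ar_idem tgt_inva eq_sym; case: eqP; rewrite ?(lin0 (H2 _ _)) ?(lin0 (H3 _ _)).
have evh i x : pgr i x -> pgrz (i%:Z + 2 + l) (on_rel f x).
  move=> Hx; apply: pgrz_sum => b _; apply: pgrzZ; rewrite -[2]/(1 + 1) addrA.
  by apply: H5 => //; apply: pgr_ar.
have [phi [lphi zphi E1 E2 [hphi s0]]] := koszul_d_solve lev evE (fun x => on_rel0 vf) evh.
have lbd : lin (koszul_d phi).
  apply: lin_bigsum => b; apply: lin_scale; apply: lin_add.
    by apply: (lin_comp (lphi _)); apply: lin_mulr; apply: lin_id.
  exact: lin_mulr.
(* the difference has values in degree 0, and its trace against every x is zero *)
have solved x : on_rel f x = koszul_d phi x.
  apply/eqP; rewrite -subr_eq0; apply/eqP.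
  apply: (@trace_deg0 r.+1 (fun x => on_rel f x - koszul_d phi x)) => //.
  - by apply: lin_add => //; apply: lin_opp.
  - move=> y v; rewrite evE mulrBl; congr (_ - _); rewrite /koszul_d mulr_suml.
    apply: eq_bigr => b _; rewrite -scalerAl; congr (_ *: _); rewrite mulrDl -!mulrA idem_ar ar_idem tgt_inva.
    case: (eqVneq v (src b : vert Q)) => [->|ne].
      by rewrite E1 -(tgt_inva b) E2.
    have -> : phi (y * E v) b = 0.
      by rewrite -E1 -mulrA idemM (negPf ne) mulr0 (lin0 (lphi _)).
    have -> : phi (y * ar b) (inva b) * E v = 0.
      by rewrite -E2 tgt_inva -mulrA idemM eq_sym (negPf ne) mulr0.
    by rewrite !mulr0 mul0r (lin0 (lphi _)).
  - move=> y; rewrite (@trace_ext k Q sect r.+1 _ (fun m => on_rel f (y * m) + koszul_d (fun m b => (-1 : k) *: phi (y * m) b) m)).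
      have vf' : vanish r.+1 f by move=> z a b Hz; apply: vf; apply: pge_leq Hz.
      have ta : trace r.+1 (fun m => on_rel f (y * m)) = 0.
        by rewrite -(thetaE sect_lin y vf') th0.
      have tb : trace r.+1 (koszul_d (fun m b => (-1 : k) *: phi (y * m) b)) = 0.
        apply: (trace_koszul_d sect_lin sectK sect_tlen).
          by move=> b; apply: lin_scale; apply: (lin_comp (lphi b)); apply: lin_mull; apply: lin_id.
        by move=> b z Hz; rewrite zphi ?scaler0 //; apply: pgeMl; apply: pge_leq Hz.
      by rewrite -[RHS]addr0 -[X in _ = X + _]ta -[X in _ = _ + X]tb; apply: (trace_add sect_lin).
    move=> m; rewrite /koszul_d -scaleN1r scaler_sumr.
    apply: (f_equal2 (fun x y : A => x + y)); first by [].
    apply: eq_bigr => b _.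
    by rewrite mulrA -scalerAl -scalerDr !scalerA mulrC.
have [B BE] : exists B : A -> arrs -> A -> A, forall x b y, B x b y = phi x b * y - f x (ar b) y.
  by exists (fun x b y => phi x b * y - f x (ar b) y).
have Bx b y : lin (fun x => B x b y).
  apply: (lin_ext (fun x => BE x b y)).
  by apply: lin_add; [apply: lin_mulr | apply: lin_opp; apply: H1].
have By x b : lin (B x b).
  apply: (lin_ext (BE x b)).
  by apply: lin_add; [apply: lin_mull; apply: lin_id | apply: lin_opp; apply: H3].
have BE1 x (b : arrs) y : B (x * E (src b)) b y = B x b y.
  by rewrite !BE E1 b1 idem_ar_src.
have BE2 x (b : arrs) y : B x b (E (tgt b) * y) = B x b y.
  by rewrite !BE mulrA E2 -b2 ar_idem_tgt.
have Bchi x w : \sum_b sgn b *: (B (x * ar b) (inva b) w + B x b (ar (inva b) * w)) = 0 * w.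
  have H0 : \sum_b sgn b *: f x (ar b * ar (inva b)) w = 0.
    have := congr1 (fun a => f x a w) (ar_rel k Q).
    rewrite (lin0 (H2 _ _)) (lin_sum (H2 _ _)) => e0; rewrite -[RHS]e0.
    by apply: eq_bigr => b _; rewrite (linZ (H2 _ _)).
  transitivity (koszul_d phi x * w - on_rel f x * w - \sum_b sgn b *: f x (ar b * ar (inva b)) w); last first.
    by rewrite H0 solved subrr subr0 mul0r.
  have e1 : koszul_d phi x * w =
     \sum_b sgn b *: ((phi (x * ar b) (inva b) + phi x b * ar (inva b)) * w).
    by rewrite /koszul_d mulr_suml; apply: eq_bigr => b _; rewrite scalerAl.
  have e2 : on_rel f x * w = \sum_b sgn b *: (f x (ar b) (ar (inva b)) * w).
    by rewrite /on_rel mulr_suml; apply: eq_bigr => b _; rewrite scalerAl.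
  transitivity (\sum_b (sgn b *: ((phi (x * ar b) (inva b) + phi x b * ar (inva b)) * w) -
     sgn b *: (f x (ar b) (ar (inva b)) * w) - sgn b *: f x (ar b * ar (inva b)) w)); last first.
    pose F1 b := sgn b *: ((phi (x * ar b) (inva b) + phi x b * ar (inva b)) * w).
    pose F2 b := sgn b *: (f x (ar b) (ar (inva b)) * w).
    pose F3 b := sgn b *: f x (ar b * ar (inva b)) w.
    have S3 := sumrBB F1 F2 F3.
    transitivity (\sum_b F1 b - \sum_b F2 b - \sum_b F3 b).
    exact: S3.
    rewrite -[X in X - _ - _]/(\sum_b sgn b *: ((phi (x * ar b) (inva b) + phi x b * ar (inva b)) * w)).
    rewrite -[X in X - _ - _ = _]e1.
    rewrite -[X in _ - X - _ = _]e2.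
    by [].
  apply: eq_bigr => b _.
  transitivity (sgn b *: ((phi (x * ar b) (inva b) + phi x b * ar (inva b)) * w -
     f x (ar b) (ar (inva b)) * w - f x (ar b * ar (inva b)) w)); last first.
    by rewrite !scalerBr.
  apply: (f_equal (fun y : A => sgn b *: y)); rewrite mulrDl !BE mulrA.
  have /eqP := cf x (ar b) (ar (inva b)) w; rewrite /d2 subr_eq0 => /eqP <-.
  have gen (V : zmodType) (p q s t u : V) : p - s + (q - t) = p + q - (s - u + t) - u.
    by rewrite !opprD !opprK !addrA [LHS](AC 4 (1*3*2*4)) /= [RHS](AC 6 (1*2*3*5*(4*6))) /= subrr addr0.
  exact: gen.
have kG x u w : pathrec B x (u * preproj_rel k Q * w) = 0.
  by rewrite (pathrec_rel2 Bx By BE1 BE2 Bchi) mul0r.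
pose h x := descend (pathrec B x).
have hE x y : h x (ppi y) = pathrec B x y by exact: descendE (pathrec_linr B x) (kG x) y.
have hx a : lin (h^~ a).
  have [y ->] := ppi_surj a; apply: (@lin_ext _ _ _ _ (fun x => pathrec B x y)) => [x|]; first exact: hE.
  exact: pathrec_linl.
have hl x : lin (h x) by exact: descend_lin (pathrec_linr B x) (kG x).
exists h.
  split=> //.
  - move=> x a Hx; have [y ->] := ppi_surj a; rewrite hE.
    apply: (pathrec_vanish (r := r)) => // z b w Hz; by rewrite BE zphi // vf // mul0r subr0.
  - move=> i j x a Hx [y Hy ->]; rewrite hE; apply: pathrec_hom => // i' j' x' b y' Hx' Hy'.
    rewrite BE; apply: pgrzB.
      rewrite addrAC -addn1 PoszD; apply: pgrzMr => //; exact: hphi.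
    by rewrite -addn1 PoszD; apply: H5 => //; apply: pgr_ar.
have hT x v : h x (E v) = 0 by rewrite hE pathrec_triv.
have hEl x v a : h x (E v * a) = h (x * E v) a.
  by have [y ->] := ppi_surj a; rewrite -ppi_mul !hE (pathrec_E Bx By BE1 BE2).
have hC x b a : h x (ar b * a) = h (x * ar b) a + (phi x b * a - f x (ar b) a).
  by have [y ->] := ppi_surj a; rewrite -BE -ppi_mul !hE (pathrec_cons Bx By BE1 BE2).
move=> x a a'; elim/A_ind: a x => [c p q IH IH'|v|b a IH] x.
- rewrite H2 IH IH'; symmetry.
  have ld : lin (fun a => d1 h x a a').
    apply: lin_add; [apply: lin_add|].
    + by apply: (lin_comp (hx _)); apply: lin_mull; apply: lin_id.
    + by apply: lin_opp; apply: (lin_comp (hl _)); apply: lin_mulr; apply: lin_id.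
    + exact: lin_mulr.
  exact: ld.
- by rewrite u1 /d1 hEl subrr add0r hT mul0r.
rewrite /d1 -mulrA !hC !mulrDl mulNr.
have /eqP := cf x (ar b) a a'; rewrite /d2 subr_eq0 => /eqP <-.
rewrite (IH (x * ar b)) /d1 !mulrA.
have gen (V : zmodType) (p q s t u v : V) :
  v = p - (q + (t - u)) + (s + (t - ((p - q + s) - v + u))).
  rewrite !opprD !opprK !addrA.
  rewrite [RHS](AC 11 ((1*7)*(2*8)*(3*6)*(4*11)*(5*9)*10)) /=.
  by rewrite !subrr !addNr !add0r.
exact: gen.
Qed.

Lemma inj_hom r l f : homc2 r l f -> (forall x a b c, d2 f x a b c = 0) ->
  (forall x, theta f x = 0) ->
  exists2 h, homc1 r l h & forall x a b, f x a b = d1 h x a b.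
Proof.
move=> Hf cf th0; have [h Hh uf] := normalise Hf cf.
have [H1 H2 H3 H4] := Hh.
have Hd := homc2_d1 Hh; have Hf2 := homc2_add Hf Hd.
have [||h2 Hh2 e] := inj_normalised Hf2 _ uf.
- by move=> x a b c; rewrite d2_add cf (d2_d1 _ _ _ _ Hh) addr0.
- move=> x; rewrite (theta_add (r := r)).
  + by rewrite th0 add0r; apply: (theta_d1 (r := r) (h := h)).
  + by case: Hf => _ _ _ v _ y a b; apply: v.
  + by case: Hd => _ _ _ v _ y a b; apply: v.
exists (fun x a => h2 x a + - h x a); first by apply: homc1_add => //; apply: homc1_opp.
by move=> x a b; rewrite d1_add d1_opp -e addrK.
Qed.

End Inject.

(** * Surjectivity of the trace form *)

Section Surject.
Variables (k : fieldType) (Q : quiver).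
Local Notation A := (preproj k Q).
Local Notation T := (pathalg k (Defs.double Q)).
Local Notation arrs := (arr (Defs.double Q)).
Local Notation E := (@pidem k Q).
Local Notation ar := (@ar k Q).
Local Notation sgn := (@sgn k Q).
Variable sect : A -> T.
Hypothesis sect_lin : lin sect.
Hypothesis sectK : forall x, ppi (sect x) = x.
Hypothesis sect_tlen : forall d x, pgr d x -> tlen (fun n => n = d) (sect x).
Hypothesis sect_ar : forall b, sect (ar b) = darr k b.
Variable R : arrs -> A -> A.
Hypothesis R_lin : forall b, lin (R b).
(** R stands for kdiv; from here on only these properties of it matter, and the
weights do not occur. *)
Hypothesis R_rel : forall w, \sum_b sgn b *: R b (ar (inva b) * w) = w.
Hypothesis R_Er : forall (b : arrs) y, R b (E (tgt b) * y) = R b y.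
Hypothesis R_El : forall (b : arrs) y, E (src b) * R b y = R b y.
Hypothesis R_hom : forall b d y, pgr d.+1 y -> pgr d (R b y).
Hypothesis R_hom0 : forall b y, pgr 0 y -> R b y = 0.
Local Notation theta := (theta sect).
Local Notation trace := (trace sect).

Section Correction.
Variable psi : A -> A.
Variables (r : nat) (l : int).
Hypothesis lpsi : lin psi.
Hypothesis psiE : forall x v, psi (x * E v) = psi x * E v.
Hypothesis psi0 : forall x, pge r x -> psi x = 0.
Hypothesis psih : forall i x, pgr i x -> pgrz (i%:Z + 2 + l) (psi x).

(** Over the relation, psi x * R b y has the right value at the second term and an
error at the first one.  The error is the same problem for psi (x b), so that the
correction is iterated; psi vanishes in high degrees and the iteration stops. *)
Fixpoint corr (n : nat) (x : A) (b : arrs) (y : A) : A :=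
  if n is n'.+1 then
    psi x * R b y - \sum_c sgn c *: corr n' (x * ar c) (inva c) (R b y)
  else 0.

Lemma corr_linl n b y : lin (fun x => corr n x b y).
Proof.
elim: n b y => [|n IH] b y; first exact: lin_zero.
apply: lin_add; first exact: lin_mulr.
apply: lin_opp; apply: lin_bigsum => c; apply: lin_scale; apply: (lin_comp (IH _ _)).
by apply: lin_mulr; apply: lin_id.
Qed.

Lemma corr_linr n x b : lin (corr n x b).
Proof.
elim: n x b => [|n IH] x b; first exact: lin_zero.
apply: lin_add; first exact: lin_mull.
apply: lin_opp; apply: lin_bigsum => c; apply: lin_scale.
exact: (lin_comp (IH _ _)).
Qed.

Lemma corr_E2 n x (b : arrs) y : corr n x b (E (tgt b) * y) = corr n x b y.
Proof.
case: n => [//|n] /=; rewrite -[match b with inl _ => _ | inr _ => _ end]/(tgt b).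
by rewrite R_Er.
Qed.

Lemma corrS n x b y : corr n.+1 x b y =
  psi x * R b y - \sum_c sgn c *: corr n (x * ar c) (inva c) (R b y).
Proof. by []. Qed.

Lemma corr_E1 n x (b : arrs) y : corr n (x * E (src b)) b y = corr n x b y.
Proof.
case: n => [//|n]; rewrite !corrS psiE -mulrA R_El.
apply: (f_equal (fun z : A => psi x * R b y - z)); apply: eq_bigr => c _.
rewrite -mulrA idem_ar; case: (eqVneq (src b) (src c)) => [//|ne].
rewrite mulr0 (lin0 (corr_linl _ _ _)) -(corr_E2 n (x * ar c)) tgt_inva -R_El mulrA idemM.
by rewrite eq_sym (negPf ne) mul0r (lin0 (corr_linr _ _ _)).
Qed.

(** An n-fold correction is final as soon as x b_1 ... b_n lies where psi is zero. *)
Lemma corr_stat n i x b y : pge i x -> (r <= i + n)%N -> corr n.+1 x b y = corr n x b y.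
Proof.
elim: n i x b y => [|n IH] i x b y Hx le.
  rewrite corrS psi0 ?mul0r ?sub0r; last by apply: pge_leq Hx; rewrite -[i]addn0.
  by rewrite big1 ?oppr0 // => c _; rewrite scaler0.
rewrite [LHS]corrS [RHS]corrS; apply: (f_equal (fun z : A => psi x * R b y - z)).
apply: eq_bigr => c _; rewrite (IH (i + 1)%N) //; last by rewrite addn1 addSnnS.
by apply: pgeM => //; apply: pge_ar.
Qed.

Lemma corr_rel x w :
  \sum_b sgn b *: (corr r (x * ar b) (inva b) w + corr r x b (ar (inva b) * w)) = psi x * w.
Proof.
pose S z := \sum_c sgn c *: corr r (x * ar c) (inva c) z.
have lS : lin S by apply: lin_bigsum => c; apply: lin_scale; apply: corr_linr.
(* S collects the errors that one more correction has to cancel *)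
have st b y : corr r x b y = psi x * R b y - S (R b y).
  by rewrite -(@corr_stat r 0%N) ?add0n //; apply: pge0.
have [L LE] : exists L : A -> A, forall z, L z = psi x * z - S z.
  by exists (fun z => psi x * z - S z).
have lL : lin L.
  by apply: (lin_ext LE); apply: lin_add; [apply: lin_mull; apply: lin_id | apply: lin_opp].
transitivity (S w + L w); last by rewrite LE addrC addrNK.
transitivity (S w + \sum_b sgn b *: L (R b (ar (inva b) * w))); last first.
  apply: (f_equal (fun z : A => S w + z)).
  transitivity (L (\sum_b sgn b *: R b (ar (inva b) * w))); last by rewrite R_rel.
  by rewrite (lin_sum lL); apply: eq_bigr => b _; rewrite (linZ lL).
rewrite -[RHS]big_split; apply: eq_bigr => b _.
by rewrite st -LE; apply: scalerDr.
Qed.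

Lemma corr_hom n i j x b y : pgr i x -> pgr j y -> pgrz (i.+1%:Z + j%:Z + l) (corr n x b y).
Proof.
elim: n i j x b y => [|n IH] i j x b y Hx Hy; first exact: pgrz0.
case: j Hy => [|j] Hy.
  rewrite corrS (R_hom0 _ Hy) mulr0 sub0r big1 ?oppr0 => [|c _]; first exact: pgrz0.
  by rewrite (lin0 (corr_linr _ _ _)) scaler0.
rewrite corrS; apply: pgrzB.
  have -> : i.+1%:Z + j.+1%:Z + l = i%:Z + 2 + l + j%:Z by lia.
  by apply: pgrzMr; [apply: psih | apply: R_hom].
apply: pgrz_sum => c _; apply: pgrzZ.
have -> : i.+1%:Z + j.+1%:Z + l = (i + 1).+1%:Z + j%:Z + l by lia.
by apply: IH; [apply: pgrM => //; apply: pgr_ar | apply: R_hom].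
Qed.

Lemma corr_vanish n x b y : pge r x -> corr n x b y = 0.
Proof.
elim: n x b y => [//|n IH] x b y Hx.
rewrite corrS psi0 // mul0r sub0r big1 ?oppr0 // => c _.
by rewrite IH ?scaler0 //; apply: pgeMr.
Qed.

Local Notation GC := (pathrec (corr r)).
Local Notation linl := (corr_linl r).
Local Notation linr := (corr_linr r).

(** The section is not multiplicative, and this is the value of the recursion on the
element sect a * sect a' - sect (a a') of the ideal: the connecting map that sends
psi, a cochain of the Koszul resolution, to a bar cocycle. *)
Definition dual_cocycle (x a a' : A) : A := GC x (sect a * sect a') - GC x (sect (a * a')).

Lemma dual_cocycle_homc2 : homc2 r l dual_cocycle.
Proof.
rewrite /dual_cocycle; split.
- by move=> a b; apply: lin_add; [|apply: lin_opp]; apply: (pathrec_linl linl).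
- move=> x b; apply: lin_add; [|apply: lin_opp]; apply: (lin_comp (pathrec_linr _ _)).
    by apply: (@lin_mulr k _ T) => //.
  by apply: (lin_comp sect_lin); apply: lin_mulr; apply: lin_id.
- move=> x a; apply: lin_add; [|apply: lin_opp]; apply: (lin_comp (pathrec_linr _ _)).
    by apply: (@lin_mull k _ T) => //.
  by apply: (lin_comp sect_lin); apply: lin_mull; apply: lin_id.
- move=> x a b Hx; have z y : GC x y = 0.
    by apply: (pathrec_vanish (r := r)) => // z b' w; apply: corr_vanish.
  by rewrite !z subr0.
- move=> i j m x a b Hx Ha Hb.
  have -> : i%:Z + j%:Z + m%:Z + l = i%:Z + (j + m)%N%:Z + l by lia.
  apply: pgrzB; apply: (pathrec_hom (corr_hom r)) => //.
    by apply: tlenM (sect_tlen Ha) (sect_tlen Hb) => p q -> ->.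
  by apply: sect_tlen; apply: pgrM.
Qed.

(** The recursion is compatible with products on the ideal, and the remaining terms
cancel in pairs. *)
Lemma dual_cocycle_d2 x a b c : d2 dual_cocycle x a b c = 0.
Proof.
have H1 : dual_cocycle (x * a) b c = GC x (sect a * sect b * sect c) - GC x (sect a * sect (b * c)).
  rewrite /dual_cocycle -(linB (pathrec_linr _ _)) -[in LHS](sectK a).
  rewrite -(pathrec_mull linl linr (corr_E1 r) (corr_E2 r)).
    by rewrite mulrBr mulrA (linB (pathrec_linr _ _)).
  by rewrite linearB /= ppi_mul !sectK subrr.
have H2 : dual_cocycle x a b * c = GC x (sect a * sect b * sect c) - GC x (sect (a * b) * sect c).
  rewrite /dual_cocycle -(linB (pathrec_linr _ _)) -[X in _ * X](sectK c).
  rewrite -(pathrec_mulr linl linr (corr_E1 r) (corr_E2 r) corr_rel).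
    by rewrite mulrBl (linB (pathrec_linr _ _)).
  by apply/ppiP; rewrite ppi_mul !sectK.
rewrite /d2 H1 H2 /dual_cocycle mulrA.
have gen (V : zmodType) (p q s t : V) : p - q - (s - t) + (q - t) - (p - s) = 0.
  rewrite !opprD !opprK !addrA [LHS](AC 8 ((1*7)*(2*5)*(3*8)*(4*6))) /=.
  by rewrite !subrr !addNr !addr0.
exact: gen.
Qed.

(** The section is the identity on arrows and kills the image of the relation, so
that the combination of the values is the value of the recursion at the relation. *)
Lemma dual_cocycle_on_rel m : on_rel dual_cocycle m = psi m.
Proof.
transitivity (GC m (preproj_rel k Q * 1) - GC m (sect (\sum_b sgn b *: (ar b * ar (inva b))))).
  have lG := pathrec_linr (corr r) m.
  have t b : GC m (sgn b *: (darr k b * darr k (inva b))) -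
      GC m (sect (sgn b *: (ar b * ar (inva b)))) = sgn b *: dual_cocycle m (ar b) (ar (inva b)).
    rewrite (linZ sect_lin) [X in X - _ = _](linZ lG) [X in _ - X = _](linZ lG) /dual_cocycle !sect_ar.
    exact: esym (scalerBr _ _ _).
  transitivity (\sum_b (GC m (sgn b *: (darr k b * darr k (inva b))) -
      GC m (sect (sgn b *: (ar b * ar (inva b)))))).
    by apply: eq_bigr => b _; rewrite t.
  apply: (etrans (sumrB _ _ _ _)); apply: (f_equal2 (fun x y : A => x - y)).
    by rewrite mulr1 rel_sum; apply: esym; apply: (lin_sum lG).
  by rewrite (lin_sum sect_lin); apply: esym; apply: (lin_sum lG).
rewrite ar_rel (lin0 sect_lin) (lin0 (pathrec_linr _ _)) subr0.
rewrite (pathrec_rel linl linr (corr_E1 r) (corr_E2 r) corr_rel).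
by rewrite [ppi 1](rmorph1 (@ppi k Q)) mulr1.
Qed.

End Correction.

(** The cocycle attached to psi x = the sum of the phi (x e_v) e_v. *)
Lemma surj_hom d (phi : A -> k^o) : lin phi -> (forall e x, pgr e x -> e != d -> phi x = 0) ->
  exists f, [/\ homc2 d.+1 (- d%:Z - 2) f, forall x a b c, d2 f x a b c = 0 &
                forall x, theta f x = phi x].
Proof.
move=> lphi hphi; pose psi (x : A) : A := \sum_v (phi (x * E v) : k) *: E v.
have phi0 x : pge d.+1 x -> phi x = 0.
  rewrite pgeE; apply: (@alen_ind _ _ _ (fun x => phi x = 0)) => [|c f g e1 e2|p Hp].
  - exact: lin0.
  - by rewrite lphi e1 e2 scaler0 addr0.
  by apply: (hphi (plen p)); [exact: pgr_mon | rewrite neq_ltn Hp orbT].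
have lpsi : lin psi.
  apply: lin_bigsum => v c x y.
  by rewrite mulrDl -scalerAl lphi scalerDl scalerA.
have psiE x v : psi (x * E v) = psi x * E v.
  rewrite /psi mulr_suml; apply: eq_bigr => w _; rewrite -mulrA -scalerAl !idemM.
  have [<-|ne] := eqVneq v w; first by rewrite ?eqxx.
  by rewrite mulr0 (lin0 lphi) scale0r; apply: esym; apply: scaler0.
have psi0 x : pge d.+1 x -> psi x = 0.
  move=> Hx; apply: big1 => v _; rewrite phi0 ?scale0r //; exact: pgeMr.
have psih i x : pgr i x -> pgrz (i%:Z + 2 + (- d%:Z - 2)) (psi x).
  move=> Hx; have [e|ne] := eqVneq i d.
    have -> : i%:Z + 2 + (- d%:Z - 2) = 0%N by rewrite e; lia.
    by apply: pgrz_sum => v _; apply: pgrzZ; apply: pgr_E.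
  rewrite /psi big1 => [|v _]; first exact: pgrz0.
  rewrite (hphi i) ?scale0r // -[i]addn0; apply: pgrM => //; exact: pgr_E.
exists (dual_cocycle psi d.+1); split.
- exact: dual_cocycle_homc2.
- exact: dual_cocycle_d2.
move=> x; have [_ _ _ vf _] := dual_cocycle_homc2 lpsi psi0 psih.
rewrite (thetaE sect_lin x vf).
rewrite (@trace_ext k Q sect d.+1 _ (fun m => \sum_v (phi (x * m * E v) : k) *: E v)) => [|m].
  rewrite (trace_sum sect_lin).
  transitivity (\sum_v phi (x * E v)); last first.
    by rewrite -(lin_sum lphi) -mulr_sumr idem_sum mulr1.
  apply: eq_bigr => v _.
  pose L y : k^o := phi (x * y * E v).
  have lL : lin L.
    by apply: (lin_comp lphi); apply: lin_mulr; apply: lin_mull; apply: lin_id.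
  have L0 y : pge d.+1 y -> L y = 0.
    by move=> Hy; apply: phi0; apply: pgeMr; apply: pgeMl.
  have -> : phi (x * E v) = L (E v) by rewrite /L -mulrA idemM eqxx.
  rewrite (frame sectK (E v) lL L0) /trace.
  apply: eq_bigr => p _; rewrite (linZ (coord_lin sect_lin p)).
  by rewrite [RHS]mulrC.
by rewrite (dual_cocycle_on_rel lpsi psiE psi0).
Qed.

End Surject.

(** * Local duality *)

Section Duality.
Variables (k : fieldType) (Q : quiver).
Local Notation A := (preproj k Q).
Local Notation T := (pathalg k (Defs.double Q)).
Local Notation arrs := (arr (Defs.double Q)).
Local Notation E := (@pidem k Q).
Local Notation ar := (@ar k Q).
Local Notation sgn := (@sgn k Q).
Local Notation N := (regmod k Q).
Local Notation gN := (@pgrz k Q).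

Lemma klinE (h : A -> A) : klin (N := N) h <-> lin h.
Proof.
have e c (x y : A) : ract (N := N) (h x) c%:A + h y = c *: h x + h y :> A.
  by congr (_ + _); rewrite /ract -[LHS]/((h x : A) * (c%:A : A)) mulr_algr.
split=> H c x y.
  exact: (etrans (esym (esym (H c x y))) (e c x y)).
exact: (etrans (H c x y) (esym (e c x y))).
Qed.

Lemma homc1E r l (h : A -> A -> A) : hom_cochain1 (N := N) gN r l h <-> homc1 r l h.
Proof.
split=> -[H1 H2 H3 H4].
  split; [by move=> a; apply/klinE; apply: H1 | by move=> x; apply/klinE; apply: H2
         | exact: H3 | exact: H4].
split; [by move=> a; apply/klinE; apply: H1 | by move=> x; apply/klinE; apply: H2
       | exact: H3 | exact: H4].
Qed.

Lemma homc2E r l (f : A -> A -> A -> A) : hom_cochain2 (N := N) gN r l f <-> homc2 r l f.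
Proof.
split=> -[H1 H2 H3 H4 H5].
  split; [by move=> a b; apply/klinE; apply: H1 | by move=> x b; apply/klinE; apply: H2
         | by move=> x a; apply/klinE; apply: H3 | exact: H4 | exact: H5].
split; [by move=> a b; apply/klinE; apply: H1 | by move=> x b; apply/klinE; apply: H2
       | by move=> x a; apply/klinE; apply: H3 | exact: H4 | exact: H5].
Qed.

Lemma homc1_zero r l : homc1 r l (fun _ _ => 0 : A).
Proof.
split=> [a|x|//|i j x a _ _]; [exact: lin_zero | exact: lin_zero | exact: pgrz0].
Qed.

Lemma homc2_zero r l : homc2 r l (fun _ _ _ => 0 : A).
Proof.
split=> [a b|x b|x a|//|i j m x a b _ _ _]; [exact: lin_zero | exact: lin_zero
 | exact: lin_zero | exact: pgrz0].
Qed.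

(** The components of a cochain are indexed by a list of degrees that may repeat;
collecting equal degrees makes the index set a set. *)
Lemma regroup (I : eqType) (V : nmodType) (s : seq I) (deg : I -> int) (F : I -> V) :
  \sum_(i <- s) F i = \sum_(l <- undup (map deg s)) \sum_(i <- s | deg i == l) F i.
Proof.
under [RHS]eq_bigr do rewrite big_mkcond.
rewrite exchange_big /= big_seq [RHS]big_seq; apply: eq_bigr => i si.
rewrite (@sum_only_seq _ _ _ (deg i)) ?eqxx ?undup_uniq //.
  by rewrite mem_undup map_f.
by move=> l; rewrite eq_sym => /negPf ->.
Qed.

Lemma homc2_sum r l I (s : seq I) (P : pred I) (F : I -> A -> A -> A -> A) :
  (forall i, P i -> homc2 r l (F i)) ->
  homc2 r l (fun x a b => \sum_(i <- s | P i) F i x a b).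
Proof.
move=> H; elim: s => [|i s IH].
  have e : (fun x a b => \sum_(i <- [::] | P i) F i x a b) = (fun _ _ _ => 0 : A).
    by apply/funext => x; apply/funext => a; apply/funext => b; rewrite big_nil.
  rewrite e; exact: homc2_zero.
have e : (fun x a b => \sum_(j <- i :: s | P j) F j x a b) =
   (fun x a b => (if P i then F i x a b else 0) + \sum_(j <- s | P j) F j x a b).
  apply/funext => x; apply/funext => a; apply/funext => b; rewrite big_cons.
  by case: (P i); rewrite ?add0r.
rewrite e; apply: homc2_add => //; case Pi: (P i); first exact: H.
exact: homc2_zero.
Qed.

(** As cochain2, but with the degrees distinct, so that the components are
determined by the cochain. *)
Definition coch2 (r : nat) (f : A -> A -> A -> A) : Prop :=
  exists (s : seq int) (F : int -> A -> A -> A -> A),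
   [/\ uniq s, forall l, homc2 r l (F l) & forall x a b, f x a b = \sum_(l <- s) F l x a b].

Lemma coch2_fam r (I : eqType) (s : seq I) (deg : I -> int) (F : I -> A -> A -> A -> A) f :
  (forall i, homc2 r (deg i) (F i)) -> (forall x a b, f x a b = \sum_(i <- s) F i x a b) ->
  coch2 r f.
Proof.
move=> H e; exists (undup (map deg s)), (fun l x a b => \sum_(i <- s | deg i == l) F i x a b).
split; [exact: undup_uniq | | by move=> x a b; rewrite e; apply: regroup].
by move=> l; apply: homc2_sum => i /eqP <-.
Qed.

Lemma coch2E r (f : A -> A -> A -> A) : cochain2 (N := N) gN r f <-> coch2 r f.
Proof.
split=> [[s [F [H e]]]|[s [F [us H e]]]].
  by apply: (@coch2_fam r _ s id F) => // l; apply/homc2E.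
by exists s, F; split=> // l; apply/homc2E.
Qed.

Lemma coch2_hom r l f : homc2 r l f -> coch2 r f.
Proof.
move=> H; apply: (@coch2_fam r _ [:: tt] (fun _ => l) (fun _ => f)) => // x a b.
by rewrite big_seq1.
Qed.

Lemma homc2_leq r r' l (f : A -> A -> A -> A) : (r <= r')%N -> homc2 r l f -> homc2 r' l f.
Proof.
move=> le [H1 H2 H3 H4 H5]; split => // x a b Hx; apply: H4; exact: pge_leq Hx.
Qed.

Lemma coch2_leq r r' f : (r <= r')%N -> coch2 r f -> coch2 r' f.
Proof.
by move=> le [s [F [us H e]]]; exists s, F; split=> // l; apply: homc2_leq (H l).
Qed.

Lemma coch2_add r f f' : coch2 r f -> coch2 r f' -> coch2 r (fun x a b => f x a b + f' x a b).
Proof.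
move=> [s [F [us H e]]] [s' [F' [us' H' e']]].
apply: (@coch2_fam r _ ([seq inl l | l <- s] ++ [seq inr l | l <- s'])
  (fun i : int + int => match i with inl l => l | inr l => l end)
  (fun i => match i with inl l => F l | inr l => F' l end)).
  by case.
by move=> x a b; rewrite big_cat !big_map e e'.
Qed.

Lemma coch2_sum r (I : Type) (s : seq I) (F : I -> A -> A -> A -> A) :
  (forall i, coch2 r (F i)) -> coch2 r (fun x a b => \sum_(i <- s) F i x a b).
Proof.
move=> H; elim: s => [|i s IH].
  apply: (@coch2_fam r _ [::] id (fun _ _ _ _ => 0)) => [l|x a b].
    exact: homc2_zero.
  by rewrite !big_nil.
have e : (fun x a b => \sum_(j <- i :: s) F j x a b) =
   (fun x a b => F i x a b + \sum_(j <- s) F j x a b).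
  by apply/funext => x; apply/funext => a; apply/funext => b; rewrite big_cons.
by rewrite e; apply: coch2_add.
Qed.

Lemma coch2_map r f (g : A -> A) : lin g -> (forall j x, pgrz j x -> pgrz j (g x)) ->
  coch2 r f -> coch2 r (fun x a b => g (f x a b)).
Proof.
move=> lg hg [s [F [us H e]]].
exists s, (fun l x a b => g (F l x a b)); split=> // [l|x a b].
  have [H1 H2 H3 H4 H5] := H l; split.
  - by move=> a b; apply: (lin_comp lg).
  - by move=> x b; apply: (lin_comp lg).
  - by move=> x a; apply: (lin_comp lg).
  - by move=> x a b Hx; rewrite H4 ?(lin0 lg).
  - by move=> i j m x a b Hx Ha Hb; apply: hg; apply: H5.
by rewrite e (lin_sum lg).
Qed.

Lemma coch2_pre r f (g : A -> A) : lin g -> (forall d x, pgr d x -> pgr d (g x)) ->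
  (forall x, pge r x -> pge r (g x)) ->
  coch2 r f -> coch2 r (fun x a b => f (g x) (g a) (g b)).
Proof.
move=> lg hg hr [s [F [us H e]]].
exists s, (fun l x a b => F l (g x) (g a) (g b)); split=> // l.
have [H1 H2 H3 H4 H5] := H l; split.
- by move=> a b; apply: (lin_comp (H1 _ _)).
- by move=> x b; apply: (lin_comp (H2 _ _)).
- by move=> x a; apply: (lin_comp (H3 _ _)).
- by move=> x a b Hx; apply: H4; apply: hr.
- by move=> i j m x a b Hx Ha Hb; apply: H5; apply: hg.
Qed.

Lemma homc2_act r l (f : A -> A -> A -> A) d c : pgr d c -> homc2 r l f -> homc2 r (d%:Z + l) (fun x a b => f (c * x) a b).
Proof.
move=> Hc [H1 H2 H3 H4 H5]; split.
- by move=> a b; apply: (lin_comp (H1 _ _)); apply: lin_mull; apply: lin_id.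
- by move=> x b; apply: H2.
- by move=> x a; apply: H3.
- by move=> x a b Hx; apply: H4; apply: pgeMl.
- move=> i j m x a b Hx Ha Hb.
  have -> : i%:Z + j%:Z + m%:Z + (d%:Z + l) = (d + i)%N%:Z + j%:Z + m%:Z + l by lia.
  by apply: H5 => //; apply: pgrM.
Qed.

Lemma coch2_vanish r f : coch2 r f -> vanish r f.
Proof.
move=> [s [F [us H e]]] x a b Hx; rewrite e big1 // => l _.
by have [_ _ _ -> //] := H l.
Qed.

Lemma coch2_lin r f a b : coch2 r f -> lin (fun x => f x a b).
Proof.
move=> [s [F [us H e]]]; apply: (lin_ext (fun x => e x a b)).
by apply: lin_bigsum => l; have [lF _ _ _ _] := H l; apply: lF.
Qed.

Lemma coch2_act r f c : coch2 r f -> coch2 r (fun x a b => f (c * x) a b).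
Proof.
move=> Hf; have lf a b := coch2_lin a b Hf.
elim/hom_ind: c => [c0 p q IH IH'|d c Hc].
  have e : (fun x a b => f ((c0 *: p + q) * x) a b) =
     (fun x a b => c0 *: f (p * x) a b + f (q * x) a b).
    apply/funext => x; apply/funext => a; apply/funext => b.
    by rewrite mulrDl -scalerAl lf.
  rewrite e; apply: coch2_add => //.
  apply: (@coch2_map r (fun x a b => f (p * x) a b) (fun y => c0 *: y)) => //.
    by apply: lin_scale; apply: lin_id.
  by move=> j x; apply: pgrzZ.
have [s [F [us H e]]] := Hf.
apply: (@coch2_fam r _ s (fun l => d%:Z + l) (fun l x a b => F l (c * x) a b)) => [l|x a b].
  exact: homc2_act.
exact: e.
Qed.

Lemma bar_d1E (h : A -> A -> A) x a b : bar_d1 (N := N) h x a b = d1 h x a b.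
Proof. by []. Qed.

Definition is_cocycle (f : A -> A -> A -> A) := forall x a b c, d2 f x a b c = 0.

Lemma H2mE (f : A -> A -> A -> A) :
  H2m (N := N) gN f <-> (exists2 r, coch2 r f & is_cocycle f).
Proof.
by split=> [[r [/coch2E Hf cf]]|[r /coch2E Hf cf]]; exists r.
Qed.

Lemma d2_hom r l (f : A -> A -> A -> A) i j m n x a b c : homc2 r l f -> pgr i x -> pgr j a -> pgr m b -> pgr n c ->
  pgrz (i%:Z + j%:Z + m%:Z + n%:Z + l) (d2 f x a b c).
Proof.
move=> [_ _ _ _ H] Hx Ha Hb Hc; apply: pgrzB; [apply: pgrzD; [apply: pgrzB|]|].
- have -> : i%:Z + j%:Z + m%:Z + n%:Z + l = (i + j)%N%:Z + m%:Z + n%:Z + l by lia.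
  by apply: H => //; apply: pgrM.
- have -> : i%:Z + j%:Z + m%:Z + n%:Z + l = i%:Z + (j + m)%N%:Z + n%:Z + l by lia.
  by apply: H => //; apply: pgrM.
- have -> : i%:Z + j%:Z + m%:Z + n%:Z + l = i%:Z + j%:Z + (m + n)%N%:Z + l by lia.
  by apply: H => //; apply: pgrM.
- have -> : i%:Z + j%:Z + m%:Z + n%:Z + l = i%:Z + j%:Z + m%:Z + l + n%:Z by lia.
  by apply: pgrzMr => //; apply: H.
Qed.

Lemma d2_lin r l (f : A -> A -> A -> A) : homc2 r l f ->
  [/\ forall a b c, lin (fun x => d2 f x a b c), forall x b c, lin (fun a => d2 f x a b c),
      forall x a c, lin (fun b => d2 f x a b c) & forall x a b, lin (d2 f x a b)].
Proof.
move=> [H1 H2 H3 _ _].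
have ml (c : A) : lin (fun x : A => c * x) by apply: lin_mull; apply: lin_id.
have mr (c : A) : lin (fun x : A => x * c) by apply: lin_mulr; apply: lin_id.
split=> [a b c|x b c|x a c|x a b].
- apply: lin_add; [apply: lin_add; [apply: lin_add|]|].
  + exact: (lin_comp (H1 _ _) (mr _)).
  + exact/lin_opp/H1.
  + exact: H1.
  + by apply: lin_opp; apply: lin_mulr; apply: H1.
- apply: lin_add; [apply: lin_add; [apply: lin_add|]|].
  + exact: (lin_comp (H1 _ _) (ml _)).
  + exact/lin_opp/(lin_comp (H2 _ _) (mr _)).
  + exact: H2.
  + by apply: lin_opp; apply: lin_mulr; apply: H2.
- apply: lin_add; [apply: lin_add; [apply: lin_add|]|].
  + exact: H2.
  + exact/lin_opp/(lin_comp (H2 _ _) (ml _)).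
  + exact: (lin_comp (H3 _ _) (mr _)).
  + by apply: lin_opp; apply: lin_mulr; apply: H3.
- apply: lin_add; [apply: lin_add; [apply: lin_add|]|].
  + exact: H3.
  + exact/lin_opp/H3.
  + exact: (lin_comp (H3 _ _) (ml _)).
  + exact/lin_opp/ml.
Qed.

Lemma d2_sum (s : seq int) (F : int -> A -> A -> A -> A) f x a b c :
  (forall x a b, f x a b = \sum_(l <- s) F l x a b) ->
  d2 f x a b c = \sum_(l <- s) d2 (F l) x a b c.
Proof.
move=> e; rewrite /d2 !e mulr_suml.
elim: s {e} => [|l s IH]; rewrite ?big_nil ?subr0 ?addr0 // !big_cons -IH.
have gen (V : zmodType) (p p' q q' s1 s1' t t' : V) :
    (p + p') - (q + q') + (s1 + s1') - (t + t') = (p - q + s1 - t) + (p' - q' + s1' - t').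
  by rewrite !opprD !addrA [LHS](AC 8 ((1*3*5*7)*(2*4*6*8))) /= !addrA.
exact: gen.
Qed.

(** On homogeneous arguments the coboundaries of the components lie in distinct
degrees. *)
Lemma cocycle_comp r (s : seq int) (F : int -> A -> A -> A -> A) f :
  uniq s -> (forall l, homc2 r l (F l)) ->
  (forall x a b, f x a b = \sum_(l <- s) F l x a b) -> is_cocycle f ->
  forall l, l \in s -> is_cocycle (F l).
Proof.
move=> us H e cf l ls x a b c.
have [L1 L2 L3 L4] := d2_lin (H l).
elim/hom_ind: x => [p q q' IH IH'|i x Hx]; first by rewrite L1 IH IH' scaler0 addr0.
elim/hom_ind: a => [p q q' IH IH'|j a Ha]; first by rewrite L2 IH IH' scaler0 addr0.
elim/hom_ind: b => [p q q' IH IH'|m b Hb]; first by rewrite L3 IH IH' scaler0 addr0.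
elim/hom_ind: c => [p q q' IH IH'|n c Hc]; first by rewrite L4 IH IH' scaler0 addr0.
apply: (@pgrz_indep k Q s (i%:Z + j%:Z + m%:Z + n%:Z) (fun l => d2 (F l) x a b c) us) => //.
  by move=> l'; apply: (d2_hom (H l')).
by rewrite -(d2_sum _ _ _ _ e) cf.
Qed.

Variable sect : A -> T.
Hypothesis sect_lin : lin sect.
Hypothesis sectK : forall x, ppi (sect x) = x.
Hypothesis sect_tlen : forall d x, pgr d x -> tlen (fun n => n = d) (sect x).
Hypothesis sect_ar : forall b, sect (ar b) = darr k b.
Variable R : arrs -> A -> A.
Hypothesis R_lin : forall b, lin (R b).
Hypothesis R_rel : forall w, \sum_b sgn b *: R b (ar (inva b) * w) = w.
Hypothesis R_Er : forall (b : arrs) y, R b (E (tgt b) * y) = R b y.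
Hypothesis R_El : forall (b : arrs) y, E (src b) * R b y = R b y.
Hypothesis R_hom : forall b d y, pgr d.+1 y -> pgr d (R b y).
Hypothesis R_hom0 : forall b y, pgr 0 y -> R b y = 0.
Local Notation theta := (theta sect).
Local Notation trace := (trace sect).

Lemma on_rel_lin r f : coch2 r f -> lin (on_rel f).
Proof.
move=> H; apply: lin_bigsum => b; apply: lin_scale; exact: (coch2_lin _ _ H).
Qed.

Lemma theta_lin r f c x y : coch2 r f -> theta f (c *: x + y) = c * theta f x + theta f y.
Proof.
move=> H; have v := coch2_vanish H; have lf := on_rel_lin H.
rewrite !(thetaE sect_lin _ v) -(trace_scale sect_lin) -(trace_add sect_lin).
by apply: trace_ext => m; rewrite mulrDl -scalerAl lf.
Qed.

Lemma theta0 r f : coch2 r f -> theta f 0 = 0.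
Proof.
move=> H; have := theta_lin (-1) 0 0 H; rewrite scaler0 addr0 => ->.
by rewrite mulN1r addNr.
Qed.

Lemma theta_act r f c x : coch2 r f -> theta (fun x a b => f (c * x) a b) x = theta f (c * x).
Proof.
move=> H; rewrite (thetaE sect_lin _ (coch2_vanish (coch2_act c H))).
rewrite (thetaE sect_lin _ (coch2_vanish H)); apply: trace_ext => m.
by rewrite -mulrA.
Qed.

(** A trace only sees the part of an endomorphism that preserves the degree. *)
Lemma theta_deg r l f d x : homc2 r l f -> pgr d x -> d%:Z != - (l + 2) -> theta f x = 0.
Proof.
move=> H Hx ne; rewrite (thetaE sect_lin _ (coch2_vanish (coch2_hom H))).
apply: big1 => p _.
have [_ _ _ _ hf] := H.
apply: (coord_pgrz sect_lin sect_tlen (j := (d + plen p)%N%:Z + 1 + 1 + l)).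
  apply: pgrz_sum => b _; apply: pgrzZ; apply: hf; [|exact: pgr_ar|exact: pgr_ar].
  by apply: pgrM => //; apply: pgr_mon.
by apply: contra_neq ne => e; lia.
Qed.

Lemma theta_vanish r f x : coch2 r f -> pge r x -> theta f x = 0.
Proof.
move=> H Hx; have v := coch2_vanish H; rewrite (thetaE sect_lin _ v).
apply: big1 => p _; rewrite (on_rel0 v) ?(lin0 (coord_lin sect_lin p)) //.
exact: pgeMr.
Qed.

(** Cyclicity moves the left factor e to the argument. *)
Lemma theta_mul r f e x : coch2 r f -> theta (fun x a b => e * f x a b) x = theta f (x * e).
Proof.
move=> H; have v := coch2_vanish H.
have v' : vanish r (fun x a b => e * f x a b).
  by move=> y a b Hy; rewrite v // mulr0.
rewrite (thetaE sect_lin _ v) (thetaE sect_lin _ v').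
have le : lin (fun m : A => e * m) by apply: lin_mull; apply: lin_id.
transitivity (trace r (fun m => e * on_rel f (x * m))); last first.
  transitivity (trace r (fun m => on_rel f (x * (e * m)))); last first.
    by apply: trace_ext => m; rewrite mulrA.
  symmetry; apply: (trace_cyc sect_lin sectK sect_tlen (psi := fun m => on_rel f (x * m)) _ le).
  - by apply: (lin_comp (on_rel_lin H)); apply: lin_mull; apply: lin_id.
  - by move=> y Hy; apply: (on_rel0 v); apply: pgeMl.
  - by move=> y; apply: pgeMl.
apply: trace_ext => m; rewrite /on_rel mulr_sumr; apply: eq_bigr => b _; exact: scalerAr.
Qed.

Lemma theta_sum r (I : Type) (s : seq I) (F : I -> A -> A -> A -> A) x :
  (forall i, coch2 r (F i)) ->
  theta (fun x a b => \sum_(i <- s) F i x a b) x = \sum_(i <- s) theta (F i) x.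
Proof.
move=> H; elim: s => [|i s IH].
  have v0 : vanish 0 (fun x a b : A => \sum_(i <- [::]) F i x a b).
    by move=> y a b _; rewrite big_nil.
  rewrite big_nil (thetaE sect_lin x v0) /trace.
  have -> : paths Q 0 = [::] by apply/nilP; rewrite /nilp -leqn0 leqNgt -has_predT;
    apply/hasPn => p; rewrite mem_paths.
  by rewrite big_nil.
rewrite big_cons -IH -(theta_add sect_lin (r := r)).
- by apply: theta_ext => y a b; rewrite big_cons.
- exact: coch2_vanish.
- by apply: coch2_vanish; apply: coch2_sum.
Qed.

(** Reduce to homogeneous cocycles: their images under theta live in different
degrees, so that each of them is zero. *)
Lemma inj_general r f : coch2 r f -> is_cocycle f -> (forall x, theta f x = 0) ->
  coboundary2 (N := N) gN r f.
Proof.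
move=> [s [F [us H e]]] cf th0.
have cF := cocycle_comp us H e cf.
have HF l : coch2 r (F l) by apply: coch2_hom.
have th0F l x : l \in s -> theta (F l) x = 0.
  move=> ls; elim/hom_ind: x => [c p q IH IH'|d x Hx].
    by rewrite (theta_lin _ _ _ (HF l)) IH IH' mulr0 addr0.
  have [ed|ne] := eqVneq d%:Z (- (l + 2)); last exact: (theta_deg (H l) Hx).
  have := th0 x; rewrite (theta_ext sect x e) (theta_sum _ _ HF).
  rewrite (sum_only_seq ls us) // => l' ne; apply: (theta_deg (H l') Hx).
  by apply: contra_neq ne => e'; lia.
have /boolp.choice[h Hh] : forall l, exists h : A -> A -> A,
    homc1 r l h /\ (l \in s -> forall x a b, F l x a b = d1 h x a b).
  move=> l; case: (boolP (l \in s)) => ls.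
    have [h h1 h2] := inj_hom sect_lin sectK sect_tlen (H l) (cF l ls) (fun x => th0F l x ls).
    by exists h.
  by exists (fun _ _ => 0); split=> //; exact: homc1_zero.
exists (fun x a => \sum_(l <- s) h l x a).
  by exists s, h; split=> // l; apply/homc1E; case: (Hh l).
move=> x a b; rewrite bar_d1E e /d1.
rewrite big_seq (eq_bigr (fun l => d1 (h l) x a b)) => [|l ls]; last by case: (Hh l) => _ ->.
rewrite -big_seq mulr_suml /d1.
by rewrite big_split sumrB.
Qed.

Lemma theta_coboundary r f x : coboundary2 (N := N) gN r f -> theta f x = 0.
Proof.
move=> [h [s [F [H e]]] ef].
have HF l : homc1 r l (F l) by apply/homc1E.
apply: (theta_d1 sect_lin sectK sect_tlen (r := r) (h := h)) => //.
- move=> a; apply: (lin_ext (fun x => e x a)); apply: lin_bigsum => l.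
  by have [lF _ _ _] := HF l; apply: lF.
- move=> y; apply: (lin_ext (e y)); apply: lin_bigsum => l.
  by have [_ lF _ _] := HF l; apply: lF.
- move=> y a Hy; rewrite e big1 // => l _.
  by have [_ _ -> //] := HF l.
Qed.

Lemma coch2_sub r f f' : coch2 r f -> coch2 r f' -> coch2 r (fun x a b => f x a b - f' x a b).
Proof.
move=> H H'; apply: coch2_add => //.
apply: (coch2_map (g := fun y => - y)) => //; first by apply: lin_opp; apply: lin_id.
by move=> j x; apply: pgrzN.
Qed.

Lemma cocycle_sub f f' : is_cocycle f -> is_cocycle f' -> is_cocycle (fun x a b => f x a b - f' x a b).
Proof. by move=> c c' x a b d; rewrite d2_add d2_opp c c' oppr0 addr0. Qed.

Lemma theta_sub r f f' x : coch2 r f -> coch2 r f' ->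
  theta (fun x a b => f x a b - f' x a b) x = theta f x - theta f' x.
Proof.
move=> H H'; apply/eqP; rewrite eq_sym subr_eq; apply/eqP.
rewrite -(theta_add sect_lin (r := r)); last 2 first.
- exact/coch2_vanish/coch2_sub.
- exact: coch2_vanish.
by apply: theta_ext => y a b; rewrite subrK.
Qed.

Lemma two_radii (f f' : A -> A -> A -> A) :
  H2m (N := N) gN f -> H2m (N := N) gN f' ->
  exists r, [/\ coch2 r f, coch2 r f', is_cocycle f & is_cocycle f'].
Proof.
move=> /H2mE[r Hf cf] /H2mE[r' Hf' cf']; exists (maxn r r'); split => //.
  by apply: coch2_leq Hf; apply: leq_maxl.
by apply: coch2_leq Hf'; apply: leq_maxr.
Qed.

Lemma theta_inj f f' : H2m (N := N) gN f -> H2m (N := N) gN f' ->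
  (theta f =1 theta f' <-> H2m_eq (N := N) gN f f').
Proof.
move=> Hf Hf'; have [r [Cf Cf' cf cf']] := two_radii Hf Hf'; split=> [e|[r' He] x].
  exists r; apply: inj_general; [exact: coch2_sub | exact: cocycle_sub|].
  by move=> x; rewrite (theta_sub x Cf Cf') e subrr.
apply/eqP; rewrite -subr_eq0 -(theta_sub x Cf Cf'); apply/eqP.
exact: theta_coboundary He.
Qed.

(** A form that vanishes from degree r on is the sum of its restrictions to the
degrees below r, and each of them comes from surj_hom. *)
Lemma theta_surj (phi : A -> k) : gdual phi ->
  exists2 f, H2m (N := N) gN f & theta f =1 phi.
Proof.
move=> [lphi [r phi0]].
have lphi' : lin (phi : A -> k^o) by [].
have /boolp.choice[F HF] : forall d : nat, exists F : A -> A -> A -> A,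
   [/\ homc2 d.+1 (- d%:Z - 2) F, is_cocycle F & forall x, theta F x = phi (proj d x)].
  move=> d; apply: (@surj_hom k Q sect sect_lin sectK sect_tlen sect_ar R R_lin R_rel R_Er R_El R_hom R_hom0 d
    (fun x => phi (proj d x) : k^o)).
    exact: (lin_comp lphi' (@proj_lin k Q d)).
  by move=> e x Hx ne; rewrite (proj_hom0 Hx ne) (lin0 lphi').
pose s := iota 0 r.
(* every d in s is below r; minn only gives a bound on the radius that holds for all d *)
have CF : coch2 r.+1 (fun x a b => \sum_(d <- s) F (minn d r) x a b).
  apply: coch2_sum => d; have [H _ _] := HF (minn d r).
  by apply: (coch2_hom (homc2_leq _ H)); rewrite ltnS geq_minr.
have CF' d : coch2 r.+1 (F (minn d r)).
  by have [H _ _] := HF (minn d r); apply: (coch2_hom (homc2_leq _ H)); rewrite ltnS geq_minr.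
exists (fun x a b => \sum_(d <- s) F (minn d r) x a b).
  apply/H2mE; exists r.+1 => // x a b c.
  have d2s (t : seq nat) : d2 (fun x a b => \sum_(d <- t) F (minn d r) x a b) x a b c = 0.
    elim: t => [|d t IH]; first by rewrite /d2 !big_nil mul0r !subr0 addr0.
    have -> : (fun x a b => \sum_(j <- d :: t) F (minn j r) x a b) =
      (fun x a b => F (minn d r) x a b + \sum_(j <- t) F (minn j r) x a b).
      by apply/funext => y; apply/funext => a'; apply/funext => b'; rewrite big_cons.
    by rewrite d2_add IH addr0; have [_ -> _] := HF (minn d r).
  exact: d2s.
move=> x; rewrite (theta_sum _ _ CF').
have eF d : theta (F (minn d r)) x = phi (proj (minn d r) x) by have [_ _ ->] := HF (minn d r).
rewrite (eq_bigr _ (fun d _ => eF d)).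
elim/hom_ind: x {eF} => [c p q IH IH'|d x Hx].
  rewrite lphi -IH -IH' mulr_sumr -big_split; apply: eq_bigr => d _.
  by rewrite (@proj_lin k Q) lphi.
have [lt|ge] := ltnP d r.
  rewrite (@sum_only_seq _ _ _ d) ?mem_iota ?iota_uniq //.
    by rewrite (minn_idPl (ltnW lt)) proj_hom.
  move=> e ne; have [le|le] := leqP e r.
    by rewrite (proj_hom0 Hx) ?(lin0 lphi') // eq_sym.
  by rewrite (proj_hom0 Hx) ?(lin0 lphi') // ltn_eqF.
rewrite phi0; last by apply: pge_leq ge _; apply: pgr_pge.
rewrite big_seq big1 // => e; rewrite mem_iota add0n => /andP[_ lt].
rewrite (minn_idPl (ltnW lt)) (proj_hom0 Hx) ?(lin0 lphi') //.
by rewrite neq_ltn (leq_trans lt ge) orbT.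
Qed.

(** The condition on idempotents follows from theta_mul: left multiplication of the
values by e_b amounts to right multiplication of the argument of theta f by e_b. *)
Theorem theta_duality : local_duality (theta : (A -> A -> A -> N) -> A -> k).
Proof.
split.
- move=> f /H2mE[r Hf cf]; split; first by move=> c x y; apply: theta_lin Hf.
  by exists r => x; apply: theta_vanish Hf.
- move=> f f' Hf Hf' x; have [r [Cf Cf' _ _]] := two_radii Hf Hf'.
  by apply: (theta_add sect_lin (r := r)); apply: coch2_vanish.
- by move=> f c /H2mE[r Hf cf] x; apply: (theta_act c x Hf).
- exact: theta_inj.
- exact: theta_surj.
- move=> l f [r [/homc2E Hf cf]] d x Hx ne; apply: (theta_deg Hf Hx).
  by move: ne; rewrite opprD.
- move=> b f Hf; have /H2mE[r Cf cf] := Hf.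
  pose f1 x u v : A := E b * f x u v.
  have C1 : coch2 r f1.
    apply: (coch2_map (g := fun y => E b * y)) => //.
      by apply: lin_mull; apply: lin_id.
    by move=> j x Hx; rewrite -[j]add0r; apply: (@pgrzMl k Q j 0) => //; apply: pgr_E.
  have c1 : is_cocycle f1.
    move=> x u v w; rewrite /d2 /f1 -[RHS](mulr0 (E b)) -(cf x u v w) /d2.
    by rewrite !mulrDr !mulrN !mulrA.
  have H1 : H2m (N := N) gN f1 by apply/H2mE; exists r.
  split=> [eb|[f' [Hf' /(theta_inj Hf Hf') e e2]] x].
    exists f1; split=> //; last by move=> x u v; rewrite /f1 mulrA idemM eqxx.
    apply/(theta_inj Hf H1) => x.
    by rewrite eb -(theta_mul (E b) x Cf).
  rewrite !e; have /H2mE[r' Cf' _] := Hf'.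
  by rewrite -(theta_mul (E b) x Cf'); apply: theta_ext => y u v; apply: e2.
Qed.

End Duality.

(** * The homological determinant *)

Section Hdet.
Variables (k : fieldType) (Q : quiver).
Local Notation A := (preproj k Q).
Local Notation T := (pathalg k (Defs.double Q)).
Local Notation arrs := (arr (Defs.double Q)).
Local Notation E := (@pidem k Q).
Local Notation ar := (@ar k Q).
Local Notation sgn := (@sgn k Q).
Local Notation N := (regmod k Q).
Local Notation gN := (@pgrz k Q).
Variable kappa : arrs -> k.
Hypothesis kappaV : forall b, kappa b * kappa (inva b) = 1.
Hypothesis kappa2 : forall v : vert Q, \sum_(b : arrs | src b == v) kappa b = 2.
Hypothesis hk : [pchar k] =i pred0.
Local Notation sect := (sect kappa).
Let sl := sect_lin kappaV kappa2.
Let sK := sectK kappaV kappa2 hk.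
Let sT := sect_tlen kappaV kappa2.
Local Notation theta := (theta sect).

Lemma preproj_local_duality : local_duality (theta : (A -> A -> A -> N) -> A -> k).
Proof.
apply: (@theta_duality k Q sect sl sK sT (sect_ar kappaV kappa2) (kdiv kappa)).
- exact: kdiv_lin.
- exact: kdiv_rel.
- exact: kdiv_E.
- exact: kdiv_El.
- exact: kdiv_hom.
- exact: kdiv_hom0.
Qed.

Variable g : gr_aut k Q.
Variable s : arrs -> k.
Hypothesis s0 : forall b, s b != 0.
Hypothesis gE : forall v, g (E v) = E v.
Hypothesis gar : forall b, g (ar b) = s b *: ar b.
Local Notation gV := (gautV g).

Lemma g_lin : lin (g : A -> A). Proof. exact: lin_linear. Qed.

Lemma g_mul x y : g (x * y) = g x * g y. Proof. exact: rmorphM. Qed.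

Lemma gVlin : lin (gV : A -> A).
Proof.
by move=> c x y; apply: (can_inj (gautK g)); rewrite g_lin !gautVK.
Qed.

Lemma gVM x y : gV (x * y) = gV x * gV y.
Proof. by apply: (can_inj (gautK g)); rewrite g_mul !gautVK. Qed.

Lemma gVE v : gV (E v) = E v.
Proof. by apply: (can_inj (gautK g)); rewrite gautVK gE. Qed.

Lemma gVar b : gV (ar b) = (s b)^-1 *: ar b.
Proof.
apply: (can_inj (gautK g)); rewrite gautVK (linZ g_lin) gar scalerA mulVf ?scale1r //.
Qed.

Lemma g_proj d y : g (proj d y) = proj d (g y).
Proof.
elim/hom_ind: y => [c p q IH IH'|e y Hy].
  by rewrite (@proj_lin k Q) !g_lin IH IH' [RHS](@proj_lin k Q).
have Hgy := gaut_gr g Hy.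
have [ed|ne] := eqVneq e d; last by rewrite (proj_hom0 Hy ne) (proj_hom0 Hgy ne) (lin0 g_lin).
by rewrite -ed (proj_hom Hy) (proj_hom Hgy).
Qed.

Lemma gV_gr d x : pgr d x -> pgr d (gV x).
Proof.
move=> Hx; suff <- : proj d (gV x) = gV x by apply: proj_pgr.
by apply: (can_inj (gautK g)); rewrite g_proj gautVK proj_hom.
Qed.

Lemma gV_ge r x : pge r x -> pge r (gV x).
Proof.
rewrite pgeE; apply: (@alen_ind _ _ _ (fun x => pge r (gV x))) => [|c p q IH IH'|p Hp].
- by rewrite (lin0 gVlin); exact: (@alen0 _ _ (fun n => (r <= n)%N)).
- by rewrite gVlin; exact: (@alen_lin _ _ (fun n => (r <= n)%N)).
by apply: pge_leq Hp _; apply: pgr_pge; apply: gV_gr; apply: pgr_mon.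
Qed.

Lemma g_grz j x : pgrz j x -> pgrz j (g x).
Proof.
case: j => d Hx; first exact: gaut_gr.
have -> : x = 0 by exact: Hx.
by rewrite (lin0 g_lin); apply: pgrz0.
Qed.

Lemma autE (f : A -> A -> A -> A) x a b :
  H2m_aut g f x a b = g (f (gV x) (gV a) (gV b)) :> A.
Proof. by []. Qed.

Lemma aut_coch2 r f : coch2 r f -> coch2 r (H2m_aut g f : A -> A -> A -> A).
Proof.
move=> H; apply: (coch2_map g_lin g_grz (f := fun x a b => f (gV x) (gV a) (gV b))).
exact: (coch2_pre gVlin gV_gr (@gV_ge r) H).
Qed.

Lemma aut_cocycle f : is_cocycle f -> is_cocycle (H2m_aut g f : A -> A -> A -> A).
Proof.
move=> cf x a b c; rewrite /d2 !autE !gVM -[in X in _ - X](gautVK g c).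
rewrite -g_mul -!(linB g_lin) -(linD g_lin) -(linB g_lin).
by have := cf (gV x) (gV a) (gV b) (gV c); rewrite /d2 => ->; rewrite (lin0 g_lin).
Qed.

Variable mu : k.
Hypothesis smu : forall b, s b * s (inva b) = mu.

Hypothesis mu0 : mu != 0.

Lemma aut_on_rel r f x : coch2 r f ->
  on_rel (H2m_aut g f : A -> A -> A -> A) x = mu^-1 *: g (on_rel f (gV x)).
Proof.
move=> [t [F [ut H e]]].
have l2 x' b : lin (fun a => f x' a b).
  apply: (lin_ext (fun a => e x' a b)); apply: lin_bigsum => l.
  by have [_ lF _ _ _] := H l; apply: lF.
have l3 x' a : lin (f x' a).
  apply: (lin_ext (e x' a)); apply: lin_bigsum => l.
  by have [_ _ lF _ _] := H l; apply: lF.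
have lL : lin (fun y => mu^-1 *: g y) by apply: lin_scale; apply: g_lin.
rewrite /on_rel [RHS](lin_sum lL); apply: eq_bigr => b _.
rewrite [RHS](linZ lL); apply: (f_equal (fun y : A => sgn b *: y)).
rewrite autE !gVar (linZ (l2 _ _)) (linZ (l3 _ _)) scalerA (linZ g_lin).
by rewrite -(smu b) invfM.
Qed.

(** Transport by g conjugates on_rel f, up to the factor by which g scales b b', and
traces are invariant under conjugation. *)
Lemma theta_aut r f x : coch2 r f ->
  theta (H2m_aut g f : A -> A -> A -> A) x = mu^-1 * theta f (gV x).
Proof.
move=> H; have v := coch2_vanish H.
rewrite (thetaE sl x (coch2_vanish (aut_coch2 H))) (thetaE sl _ v).
transitivity (trace sect r (fun m => mu^-1 *: g (on_rel f (gV x * gV m)))).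
  by apply: trace_ext => m; rewrite (aut_on_rel _ H) gVM.
rewrite (trace_scale sl); congr (_ * _).
have lp : lin (fun m => g (on_rel f (gV x * m))).
  apply: (lin_comp g_lin); apply: (lin_comp (on_rel_lin H)).
  by apply: lin_mull; apply: lin_id.
have cyc := @trace_cyc k Q sect sl sK sT r (fun m => g (on_rel f (gV x * m))) gV lp gVlin.
rewrite cyc.
- by apply: trace_ext => m; rewrite gautK.
- by move=> y Hy; rewrite (on_rel0 v) ?(lin0 g_lin) //; apply: pgeMl.
- exact: gV_ge.
Qed.

Lemma tcoef_g v y : tcoef v (g y) = tcoef v y.
Proof.
elim/A_ind: y => [c p q IH IH'|w|b y _].
- by rewrite g_lin !(@tcoef_lin k Q v) IH IH'.
- by rewrite gE.
rewrite g_mul gar -scalerAl (linZ (@tcoef_lin k Q v)) !tcoefM.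
by rewrite (tcoef_pge v (pge_ar k b)) !mul0r scaler0.
Qed.

Lemma act_H2m (f : A -> A -> A -> A) c : H2m (N := N) gN f -> H2m (N := N) gN (H2m_act (N := N) f c).
Proof.
move=> /H2mE[r Hf cf]; apply/H2mE; exists r; first exact: coch2_act.
by move=> x a b d; rewrite /d2 /H2m_act !mulrA; apply: cf.
Qed.

Lemma aut_H2m (f : A -> A -> A -> A) : H2m (N := N) gN f ->
  H2m (N := N) gN (H2m_aut g f).
Proof.
by move=> /H2mE[r Hf cf]; apply/H2mE; exists r; [apply: aut_coch2 | apply: aut_cocycle].
Qed.

Lemma tcoef_1 v : tcoef v (1 : A) = 1.
Proof.
rewrite -idem_sum (lin_sum (@tcoef_lin k Q v)) (@sum_only _ _ v) ?tcoef_E ?eqxx // => w nw.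
by rewrite tcoef_E eq_sym (negPf nw).
Qed.

Lemma tcoef_gdual v : gdual (tcoef v : A -> k).
Proof.
split; first exact: (@tcoef_lin k Q v).
by exists 1%N => x; apply: tcoef_pge.
Qed.

(** The trace form proves existence.  For an arbitrary duality th, take f with
th f = the coefficient of e_v.  Both th and theta are injective on classes and
linear over A, so that a relation between f^g and multiples of f can be checked
with theta and used with th. *)
Theorem is_HdetE (D : 'M[k]_((nv Q).+1)) : is_Hdet g D <-> D = mu%:M.
Proof.
have ld := preproj_local_duality.
split=> [[th [lam [ld' lam0 Hlam ->]]]|->]; last first.
  exists theta, (fun _ => mu^-1); split=> //.
  - by move=> v; rewrite invr_eq0.
  - by move=> v f /H2mE[r Hf cf] _ x; apply: theta_aut Hf.
  - rewrite -diag_const_mx; congr diag_mx.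
    by apply/rowP => i; rewrite !mxE invrK.
suff H v : lam v = mu^-1.
  rewrite -diag_const_mx; congr diag_mx.
  by apply/rowP => i; rewrite !mxE H invrK.
have [f Hf ef] := ld_surj ld' (tcoef_gdual v).
have /H2mE[r Cf cf] := Hf.
(* an element c of A acts on the class f through its coefficient at e_v *)
have nu c : theta f c = tcoef v c * theta f 1.
  have e : th (H2m_act (N := N) f c) =1 th (H2m_act (N := N) f ((tcoef v c : k) *: (1 : A))).
    move=> x; rewrite !(ld_act ld' _ Hf) !ef !tcoefM.
    rewrite (linZ (@tcoef_lin k Q v)) tcoef_1.
    by rewrite -[_ *: _]/((tcoef v c : k) * 1) mulr1.
  have /(ld_inj ld' (act_H2m _ Hf) (act_H2m _ Hf)) := e.
  move=> /(ld_inj ld (act_H2m _ Hf) (act_H2m _ Hf)) /(_ 1).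
  rewrite !(ld_act ld _ Hf) !mulr1 => ->.
  by have := theta_lin sl (tcoef v c) 1 0 Cf; rewrite addr0 (theta0 sl Cf) addr0.
have e : theta (H2m_aut g f) =1 theta (H2m_act (N := N) f (mu^-1 *: 1)).
  move=> x; rewrite (ld_act ld _ Hf) (theta_aut _ Cf) -scalerAl mul1r.
  rewrite nu [RHS]nu (linZ (@tcoef_lin k Q v)) -[in RHS](gautVK g x) tcoef_g.
  exact: mulrA.
have /(ld_inj ld (aut_H2m Hf) (act_H2m _ Hf)) := e.
move=> /(ld_inj ld' (aut_H2m Hf) (act_H2m _ Hf)) /(_ (E v)).
have fv : gdual_at v (th f) by move=> x; rewrite !ef tcoefM tcoef_E eqxx mulr1.
rewrite (ld_act ld' _ Hf) (Hlam v f Hf fv).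
rewrite !ef gVE -scalerAl mul1r (linZ (@tcoef_lin k Q v)) !tcoef_E eqxx mulr1 => ->.
exact: mulr1.
Qed.

End Hdet.

(** * The scaling factors at a vertex *)

Section Local.
Variables (k : fieldType) (Q : quiver).
Local Notation A := (preproj k Q).
Local Notation arrs := (arr (Defs.double Q)).
Local Notation E := (@pidem k Q).
Local Notation ar := (@ar k Q).
Local Notation sgn := (@sgn k Q).
Variable kappa : arrs -> k.
Hypothesis kappaV : forall b, kappa b * kappa (inva b) = 1.
Hypothesis kappa2 : forall v : vert Q, \sum_(b : arrs | src b == v) kappa b = 2.
Hypothesis hk : [pchar k] =i pred0.
Variable g : gr_aut k Q.
Variable s : arrs -> k.
Hypothesis gar : forall b, g (ar b) = s b *: ar b.

Lemma partial_self b : partial kappa b (ar b) = E (tgt b).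
Proof.
rewrite -[ar b]ar_idem_tgt (partial_cons kappaV kappa2) eqxx (partial_E kappaV kappa2) mulr0 scaler0 if_same subr0.
by rewrite /deg_succ (degscale_hom _ (pgr_E k _)) scale1r idemM eqxx.
Qed.

Lemma ar_neq0 b : ar b != 0.
Proof.
apply/eqP => e; have := partial_self b; rewrite e (lin0 (partial_lin kappaV kappa2 b)) => /esym H.
have := tcoef_E k (tgt b : vert Q) (tgt b); rewrite H (lin0 (tcoef_lin _)) eqxx => /eqP.
by rewrite eq_sym oner_eq0.
Qed.

(** D_c of g (rel) = 0, read off at c'. *)
Lemma scale_product_sum (c : arrs) :
  2 * (s c * s (inva c)) = \sum_(b : arrs | src b == src c) kappa b * (s b * s (inva b)).
Proof.
pose m b := s b * s (inva b).
have H : \sum_b (sgn b * m b) *: (ar b * ar (inva b)) = 0.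
  have := congr1 g (ar_rel k Q); rewrite (lin0 (g_lin g)) (lin_sum (g_lin g)) => e0.
  rewrite -[RHS]e0; apply: eq_bigr => b _.
  rewrite (linZ (g_lin g)) g_mul !gar -scalerAl -scalerAr !scalerA.
  by rewrite mulrA.
have := congr1 (partial kappa c) H.
rewrite (lin0 (partial_lin kappaV kappa2 c)) (lin_sum (partial_lin kappaV kappa2 c)).
have t b : partial kappa c ((sgn b * m b) *: (ar b * ar (inva b))) =
   ((if b == c then sgn c * m c * 2 else 0) -
    (if src b == src c then sgn c * (kappa b * m b) else 0)) *: ar (inva c).
  rewrite (linZ (partial_lin kappaV kappa2 c)) (partial_cons kappaV kappa2) partial_self tgt_inva.
  rewrite scalerBr scalerBl; apply: (f_equal2 (fun x y : A => x - y)).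
    case: eqP => [->|_]; last by rewrite scaler0 scale0r.
    rewrite /deg_succ (degscale_hom _ (pgr_ar k _)) -scalerAr -(src_inva c) idem_ar_src.
    exact: scalerA.
  rewrite [src c == src b]eq_sym; case: eqP => [e|_]; last by rewrite scaler0 scale0r.
  have -> : ar (inva c) * E (src b) = ar (inva c).
    by rewrite e -(tgt_inva c) ar_idem_tgt.
  rewrite scalerA; apply: (f_equal (fun z : k => z *: ar (inva c))).
  transitivity (sgn b * sgn b * (sgn c * (kappa b * m b))); last by rewrite sgn_sqr mul1r.
  by ring.
rewrite (eq_bigr _ (fun b _ => t b)) -scaler_suml => /eqP.
rewrite scaler_eq0 (negPf (ar_neq0 _)) orbF sumrB subr_eq0 => /eqP.
rewrite (@sum_only _ _ c) ?eqxx => [|b /negPf -> //].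
rewrite -big_mkcond -mulr_sumr -mulrA => e.
have sc0 : sgn c != 0 by apply: contraTneq (oner_neq0 k) => z; rewrite -(sgn_sqr k c) z mul0r eqxx.
by rewrite mulrC; apply: (mulfI sc0).
Qed.

(** The right-hand side of scale_product_sum only depends on the source of c. *)
Lemma scale_product_local (b c : arrs) : src b = src c -> s b * s (inva b) = s c * s (inva c).
Proof.
move=> e; have two0 : (2 : k) != 0 by apply: (natrS_neq0 hk 1).
by apply: (mulfI two0); rewrite !scale_product_sum e.
Qed.

End Local.

(** * Quivers given by lists of edges *)

Section Edges.
Variables (n : nat) (e : nat * nat) (s : seq (nat * nat)).
Local Notation es := (e :: s).
Local Notation Q := (edge_quiver n e s).

Definition in_range (p : nat * nat) : bool :=
  [&& 0 < p.1, p.1 <= n, 0 < p.2 & p.2 <= n]%N.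
Definition share (p q : nat * nat) : bool :=
  [|| p.1 == q.1, p.1 == q.2, p.2 == q.1 | p.2 == q.2].
Definition linked : Prop := forall i, (0 < i < size es)%N ->
  exists2 j, (j < i)%N & share (nth e es i) (nth e es j).
(** C dl = 2 dl for the adjacency matrix C of the graph. *)
Definition balanced (dl : nat -> nat) : Prop := forall v, (0 < v <= n)%N ->
  (\sum_(p <- es) ((p.1 == v) * dl p.2 + (p.2 == v) * dl p.1) = 2 * dl v)%N.

Hypothesis n0 : (0 < n)%N.
Hypothesis rng : all in_range es.

Lemma nth_range (i : 'I_(size s).+1) : in_range (nth e es i).
Proof. by apply: (allP rng); apply: mem_nth. Qed.

Lemma val_src (i : arr Q) : (src i : nat) = (nth e es i).1.-1.
Proof.
have /and4P[p1 p2 _ _] := nth_range i; rewrite /src /= inordK // (prednK n0).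
by rewrite prednK.
Qed.

Lemma val_tgt (i : arr Q) : (tgt i : nat) = (nth e es i).2.-1.
Proof.
have /and4P[_ _ p1 p2] := nth_range i; rewrite /tgt /= inordK // (prednK n0).
by rewrite prednK.
Qed.

Lemma share_vert (i j : arr Q) : share (nth e es i) (nth e es j) ->
  [\/ src i = src j, src i = tgt j, tgt i = src j | tgt i = tgt j].
Proof.
by case/or4P=> /eqP H; [apply: Or41|apply: Or42|apply: Or43|apply: Or44];
   apply: val_inj; rewrite /= ?val_src ?val_tgt H.
Qed.

Lemma linked_const (X : Type) (m : arr Q -> X) : linked ->
  (forall i j : arr Q, [\/ src i = src j, src i = tgt j, tgt i = src j | tgt i = tgt j] ->
     m i = m j) -> forall i, m i = m ord0.
Proof.
move=> lk H [i Hi]; elim/ltn_ind: i Hi => -[|i] IH Hi.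
  by congr m; apply: val_inj.
have [|j lt sh] := lk i.+1; first by rewrite /= Hi.
have Hj : (j < (size s).+1)%N := ltn_trans lt Hi.
by rewrite -(IH j lt Hj); apply: H; apply: share_vert.
Qed.

Variables (k : fieldType) (dl : nat -> nat).
Hypothesis hk : [pchar k] =i pred0.
Hypothesis dl0 : forall v, (0 < v <= n)%N -> (0 < dl v)%N.
Hypothesis bal : balanced dl.
Local Notation arrs := (arr (Defs.double Q)).

Definition weight (v : vert Q) : k := (dl v.+1)%:R.
Definition kappa (b : arrs) : k := weight (tgt b) / weight (src b).

Lemma vert_range (v : vert Q) : (0 < v.+1 <= n)%N.
Proof. by apply: leq_trans (ltn_ord v) _; rewrite (prednK n0). Qed.

Lemma weight_neq0 v : weight v != 0.
Proof.
have := dl0 (vert_range v); rewrite /weight; case: (dl _) => // m _.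
exact: natrS_neq0.
Qed.

Lemma kappaV b : kappa b * kappa (inva b) = 1.
Proof.
rewrite /kappa src_inva tgt_inva mulrA mulfVK ?divff //; exact: weight_neq0.
Qed.

Lemma kappa2 (v : vert Q) : \sum_(b : arrs | src b == v) kappa b = 2.
Proof.
transitivity ((\sum_(b : arrs | src b == v) weight (tgt b)) / weight v).
  by rewrite mulr_suml; apply: eq_bigr => b /eqP <-.
suff -> : \sum_(b : arrs | src b == v) weight (tgt b) = 2 * weight v by rewrite mulfK ?weight_neq0.
rewrite big_mkcond big_sumType /= -big_split /=.
have -> : 2 * weight v = (2 * dl v.+1)%N%:R :> k by rewrite natrM.
rewrite -bal ?vert_range // natr_sum (big_nth e) big_mkord; apply: eq_bigr => i _.
rewrite natrD !natrM.
have /and4P[p1 p2 q1 q2] := nth_range i.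
have a (w : vert Q) m : (0 < m)%N -> (w : nat) = m.-1 -> weight w = (dl m)%:R.
  by move=> m0 ew; rewrite /weight ew prednK.
have b (w : vert Q) m : (0 < m)%N -> (w : nat) = m.-1 -> (w == v) = (m == v.+1).
  by move=> m0 ew; rewrite -val_eqE /= ew -eqSS prednK.
rewrite -(b _ _ p1 (val_src i)) -(b _ _ q1 (val_tgt i)).
rewrite -(a _ _ p1 (val_src i)) -(a _ _ q1 (val_tgt i)).
by case: (_ == v); case: (_ == v); rewrite ?mul1r ?mul0r.
Qed.

End Edges.

(** * The extended Dynkin graphs *)

Lemma sum_iota a m v : (\sum_(i <- iota a m) (i == v) = (a <= v < a + m))%N.
Proof.
elim: m a => [|m IH] a /=; first by rewrite big_nil; lia.
by rewrite big_cons IH; lia.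
Qed.

Lemma sum_iotaS a m v : (\sum_(i <- iota a m) (i.+1 == v) = (a < v <= a + m))%N.
Proof.
elim: m a => [|m IH] a /=; first by rewrite big_nil; lia.
by rewrite big_cons IH; lia.
Qed.

(** The minimal imaginary root of the affine root system. *)
Definition ed_weight (T : ext_dynkin) (v : nat) : nat :=
  match T with
  | ExtA _ => 1
  | ExtD n => if (v <= 2) || (n <= v.+1) then 1 else 2
  | ExtE6 => nth 0 [:: 0; 1; 2; 3; 2; 1; 2; 1] v
  | ExtE7 => nth 0 [:: 0; 1; 2; 3; 4; 3; 2; 1; 2] v
  | ExtE8 => nth 0 [:: 0; 1; 2; 3; 4; 5; 6; 4; 2; 3] v
  end%N.

Section Types.
Variable T : ext_dynkin.
Hypothesis hT : ext_dynkin_ok T.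
Local Notation n := (ed_size T).
Local Notation e := (ed_arrows T).1.
Local Notation s := (ed_arrows T).2.

Lemma ed_size_gt0 : (0 < n)%N.
Proof. by case: T hT => //= m; lia. Qed.

Lemma ed_range : all (in_range n) (e :: s).
Proof.
case: T hT => [m|m|||] //= hm; rewrite all_cat all_map /in_range /=.
  apply/andP; split; first lia.
  apply/andP; split; last lia.
  by apply/allP => i; rewrite mem_iota /=; lia.
do 2 (apply/andP; split; first lia).
apply/andP; split; last lia.
by apply/allP => i; rewrite mem_iota /=; lia.
Qed.

Lemma ed_weight_gt0 v : (0 < v <= n)%N -> (0 < ed_weight T v)%N.
Proof.
case: T => [m|m|||] //=; first by case: ifP.
- by do 8 case: v => [|v] //.
- by do 9 case: v => [|v] //.
- by do 10 case: v => [|v] //.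
Qed.

Lemma ed_balanced : balanced n e s (ed_weight T).
Proof.
move=> v hv; case: T hT hv => [m|m|||] /= hm hv.
- rewrite big_cons big_cat big_map big_seq1 /= big_split /=.
  under eq_bigr do rewrite muln1.
  under [X in (_ + (_ + X + _))%N]eq_bigr do rewrite muln1.
  by rewrite sum_iota sum_iotaS; lia.
- rewrite !big_cons big_cat big_map !big_cons big_nil /=.
  have -> : (\sum_(i <- iota 3 (m - 5))
      ((i == v) * (if (i.+1 <= 2) || (m <= i.+2) then 1 else 2) +
       (i.+1 == v) * (if (i <= 2) || (m <= i.+1) then 1 else 2)) =
      2 * \sum_(i <- iota 3 (m - 5)) (i == v) + 2 * \sum_(i <- iota 3 (m - 5)) (i.+1 == v))%N.
    rewrite !big_distrr /= -big_split /= big_seq [RHS]big_seq; apply: eq_bigr => i.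
    rewrite mem_iota => hi.
    have -> : ((i.+1 <= 2) || (m <= i.+2))%N = false by lia.
    have -> : ((i <= 2) || (m <= i.+1))%N = false by lia.
    by rewrite ![(2 * _)%N]mulnC.
  rewrite sum_iota sum_iotaS.
  have -> : (m <= 4)%N = false by lia.
  have -> : ((m - 2 <= 2) || (m <= (m - 2).+1))%N = false by lia.
  have -> : ((m - 1 <= 2) || (m <= (m - 1).+1))%N = true by lia.
  have -> : ((m <= 2) || (m <= m.+1))%N = true by lia.
  case: ifP; lia.
- by rewrite !big_cons big_nil; do 8 (case: v hv => [|v] hv //).
- by rewrite !big_cons big_nil; do 9 (case: v hv => [|v] hv //).
- by rewrite !big_cons big_nil; do 10 (case: v hv => [|v] hv //).
Qed.

Lemma path_linked (x : nat * nat) (t : seq (nat * nat)) :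
  path (fun p q => share q p) x t -> linked x t.
Proof.
move=> /(pathP x) H [|i] //= Hi; exists i => //.
by apply: H.
Qed.

(** In types A and D consecutive arrows meet; in type E the last branch starts at an
inner vertex of the chain. *)
Lemma ed_linked : linked e s.
Proof.
case: T hT => [m|m|||] /= hm.
- apply: path_linked.
  have H a b : path (fun p q => share q p) (a, a.+1) ([seq (i, i.+1) | i <- iota a.+1 b] ++ [:: ((a + b).+1, 1)])%N.
    elim: b a => [|b IH] a /=; first by rewrite /share /= addn0 eqxx !orbT.
    by rewrite /share /= eqxx !orbT /= -addSnnS.
  have := H 1%N (m - 2)%N.
  by have -> : (1 + (m - 2)).+1 = m by lia.
- apply: path_linked.
  have H a b : path (fun p q => share q p) (a, a.+1) ([seq (i, i.+1) | i <- iota a.+1 b] ++ [:: ((a + b).+1, m.-1); ((a + b).+1, m)])%N.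
    elim: b a => [|b IH] a /=; first by rewrite /share /= addn0 !eqxx !orbT.
    by rewrite /share /= eqxx !orbT /= -addSnnS.
  have := H 2%N (m - 5)%N.
  have -> : (2 + (m - 5)).+1 = (m - 2)%N by lia.
  have -> : m.-1 = (m - 1)%N by lia.
  by move=> Hp; exact: (introT andP (conj (isT : share (2, 3)%N (1, 3)%N) Hp)).
- move=> i Hi; have : has (fun j => share (nth (1,2) [:: (1,2); (2, 3); (3, 4); (4, 5); (3, 6); (6, 7)] i)%N
     (nth (1,2) [:: (1,2); (2, 3); (3, 4); (4, 5); (3, 6); (6, 7)] j)%N) (iota 0 i).
    by do 6 (case: i Hi => [|i] Hi //).
  by case/hasP=> j; rewrite mem_iota => lt sh; exists j.
- move=> i Hi; have : has (fun j => share (nth (1,2) [:: (1,2); (2, 3); (3, 4); (4, 5); (5, 6); (6, 7); (4, 8)] i)%N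
     (nth (1,2) [:: (1,2); (2, 3); (3, 4); (4, 5); (5, 6); (6, 7); (4, 8)] j)%N) (iota 0 i).
    by do 7 (case: i Hi => [|i] Hi //).
  by case/hasP=> j; rewrite mem_iota => lt sh; exists j.
- move=> i Hi; have : has (fun j => share (nth (1,2) [:: (1,2); (2, 3); (3, 4); (4, 5); (5, 6); (6, 7); (7, 8); (6, 9)] i)%N
     (nth (1,2) [:: (1,2); (2, 3); (3, 4); (4, 5); (5, 6); (6, 7); (7, 8); (6, 9)] j)%N) (iota 0 i).
    by do 8 (case: i Hi => [|i] Hi //).
  by case/hasP=> j; rewrite mem_iota => lt sh; exists j.
Qed.

End Types.

Theorem corollary5p8 (k : closedFieldType) (hk : [pchar k] =i pred0)
    (T : ext_dynkin) (hT : ext_dynkin_ok T)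
    (g : gr_aut k (ed_quiver T))
    (hfin : exists2 m : nat, (0 < m)%N & forall x, iter m g x = x)
    (c t : arr (ed_quiver T) -> k)
    (hc : forall a, c a != 0) (ht : forall a, t a != 0)
    (hv : forall v, g (pidem k v) = pidem k v)
    (ha : forall a, g (parrow k a) = c a *: parrow k a)
    (ha' : forall a, g (parrowV k a) = t a *: parrowV k a) :
  forall D : 'M[k]_((nv (ed_quiver T)).+1),
    is_Hdet g D <-> D = (c (ed_alpha1 T) * t (ed_alpha1 T))%:M.
Proof.
pose kp := @kappa (ed_size T) (ed_arrows T).1 (ed_arrows T).2 k (ed_weight T).
have n0 := ed_size_gt0 hT; have rng := ed_range hT.
have kV : forall b, kp b * kp (inva b) = 1 := kappaV n0 hk (@ed_weight_gt0 T).
have k2 : forall v, \sum_(b | src b == v) kp b = 2 :=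
  kappa2 n0 rng hk (@ed_weight_gt0 T) (ed_balanced hT).
pose s (b : arr (Defs.double (ed_quiver T))) := match b with inl a => c a | inr a => t a end.
have gs b : g (ar k b) = s b *: ar k b by case: b => a; [apply: ha | apply: ha'].
have s0 b : s b != 0 by case: b => a; [apply: hc | apply: ht].
have loc := scale_product_local kV k2 hk gs.
have cst a : c a * t a = c (ed_alpha1 T) * t (ed_alpha1 T).
  apply: (@linked_const _ _ _ n0 rng k (fun a => c a * t a) (ed_linked hT)) => i j.
  have tc x : t x * c x = c x * t x by apply: mulrC.
  case=> E; [have := loc (inl i) (inl j) E | have := loc (inl i) (inr j) E
            |have := loc (inr i) (inl j) E | have := loc (inr i) (inr j) E]; rewrite /s /= ?tc //.
apply: (is_HdetE kV k2 hk s0 hv gs).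
- by case=> a; rewrite /s /= ?[t a * _]mulrC cst.
- by rewrite mulf_neq0.
Qed.
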